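(* Let $F$ be a perfect field of characteristic not two, $\bar F$ an algebraic closure, $\Gamma$ the absolute Galois group, and $\mathbb{G}$ an affine group superscheme over $F$. Let $V'$ be an irreducible representation of $\mathbb{G}\otimes_F\bar F$, and set $\Gamma_{V'}=\{\sigma\in\Gamma:\ {}^\sigma V'\cong V'\text{ or }{}^\sigma V'\cong\Pi V'\}$. (1) The even part $F'$ of the center of $\underline{\mathrm{End}}_{\mathbb{G}}(V'_F)$ is isomorphic over $F$ to the fixed subfield $\bar F^{\Gamma_{V'}}$ of $\bar F$. (2) Regard $F'$ as a subfield of $\bar F$ via (1). The irreducible representation $V'_{F'}$ of $\mathbb{G}\otimes_F F'$ is super quasi-rational, i.e. $\underline{\mathrm{End}}_{\mathbb{G}\otimes_F F'}(V'_{F'})$ is a central division superalgebra over $F'$. Moreover, $V'_F=\mathrm{Res}_{F'/F}V'_{F'}$ and $\underline{\mathrm{End}}_{\mathbb{G}}(V'_F)=\underline{\mathrm{End}}_{\mathbb{G}\otimes_F F'}(V'_{F'})$.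
   Context: Affine group superschemes over $F$ correspond to commutative Hopf superalgebras; a representation is a right supercomodule, homomorphisms preserve parity, $\Pi V$ is the parity change of $V$ (same coaction). $\underline{\mathrm{End}}_{\mathbb{G}}(V)$ is the superalgebra under composition with even part $\mathrm{End}_{\mathbb{G}}(V)$ and odd part $\mathrm{Hom}_{\mathbb{G}}(V,\Pi V)$. The even part of the center of a superalgebra $A$ is $\{a\in A_{\bar0}:ab=ba\ \forall b\in A\}$, and $A$ is central over $F$ if this equals $F$. A division superalgebra is one in which every nonzero homogeneous element is invertible. ${}^\sigma V'$ is the base change of $V'$ along $\sigma$. For an intermediate field $F\subset E\subset\bar F$ and an irreducible representation $V'$ of $\mathbb{G}\otimes_F\bar F$, $V'_E$ denotes the unique (up to isomorphism) irreducible representation of $\mathbb{G}\otimes_F E$ such that $V'$ is a subrepresentation of $V'_E\otimes_E\bar F$. $\mathrm{Res}_{F'/F}$ is restriction of scalars; equalities of representations are up to isomorphism. *)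

(* Defs.v *)
From HB Require Import structures.
From mathcomp Require Import all_boot all_algebra all_field.
From mathcomp Require Import boolp functions.

Set Implicit Arguments.
Unset Strict Implicit.
Unset Printing Implicit Defensive.

Import GRing.Theory.
Local Open Scope ring_scope.
Local Open Scope quotient_scope.

Section Semilinear.
Variables (K L : fieldType) (phi : K -> L).

Definition semilin (V : lmodType K) (W : lmodType L) (f : V -> W) : Prop :=
  {morph f : u v / u + v} /\ forall k v, f (k *: v) = phi k *: f v.

End Semilinear.

Lemma semilin_id (K : fieldType) (V : lmodType K) :
  semilin idfun (fun v : V => v).
Proof. by split. Qed.

Lemma linear_semilin (K : fieldType) (V W : lmodType K) (f : V -> W) :
  linear f -> semilin idfun f.
Proof.
move=> lf; split=> [u v|k v]; first by have := lf 1 u v; rewrite !scale1r.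
have f0 : f 0 = 0 by have := lf (- 1) 0 0; rewrite !scaleN1r oppr0 addr0 addNr.
by have := lf k v 0; rewrite !addr0 f0 addr0.
Qed.

Lemma lin_semilin (K : fieldType) (V W : lmodType K) (f : {linear V -> W}) :
  semilin idfun f.
Proof. exact/linear_semilin/linearP. Qed.

Lemma semilin_linear (K : fieldType) (V W : lmodType K) (f : V -> W) :
  semilin idfun f -> linear f.
Proof. by move=> [fD fZ] k u v; rewrite fD fZ. Qed.

Lemma semilin_comp (K L M : fieldType) (phi : K -> L) (psi : L -> M)
    (V : lmodType K) (W : lmodType L) (U : lmodType M)
    (f : V -> W) (g : W -> U) :
  semilin phi f -> semilin psi g -> semilin (psi \o phi) (g \o f).
Proof.
by move=> [fD fZ] [gD gZ]; split=> [u v|k v] /=; rewrite ?fD ?gD // fZ gZ.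
Qed.

Lemma addf0 (U W : zmodType) (f : U -> W) :
  {morph f : u v / u + v} -> f 0 = 0.
Proof. by move=> fD; apply: (addrI (f 0)); rewrite -fD !addr0. Qed.

Lemma addfN (U W : zmodType) (f : U -> W) :
  {morph f : u v / u + v} -> {morph f : u / - u}.
Proof. by move=> fD u; apply: (addrI (f u)); rewrite -fD !subrr (addf0 fD). Qed.

Lemma addf_sum (U W : zmodType) (f : U -> W) (I : Type) (r : seq I)
    (F : I -> U) :
  {morph f : u v / u + v} -> f (\sum_(i <- r) F i) = \sum_(i <- r) f (F i).
Proof. by move=> fD; apply: (big_morph f fD (addf0 fD)). Qed.

Definition mklin (K : fieldType) (V W : lmodType K) (f : V -> W)
    (lf : linear f) : {linear V -> W} :=
  HB.pack f (GRing.isLinear.Build K V W _ f lf).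

Definition mkscalar (K : fieldType) (V : lmodType K) (f : V -> K)
    (lf : linear (f : V -> K^o)) : {scalar V} :=
  HB.pack f (GRing.isLinear.Build K V K _ f lf).

(* Elements of the tensor product are represented by finite formal sums of    *)
(* pairs; two formal sums are identified when no balanced biadditive map      *)
(* separates them, which is the universal property of the tensor product.     *)

Section Tensor.
Variables (K : fieldType) (V W : lmodType K).

Definition balanced (U : zmodType) (b : V -> W -> U) : Prop :=
  [/\ forall v v' w, b (v + v') w = b v w + b v' w,
      forall v w w', b v (w + w') = b v w + b v w'
    & forall k v w, b (k *: v) w = b v (k *: w)].

Definition fsum (U : zmodType) (b : V -> W -> U) (s : seq (V * W)) : U :=
  \sum_(p <- s) b p.1 p.2.

Definition tens_eq (s t : seq (V * W)) : bool :=
  `[< forall (U : zmodType) (b : V -> W -> U), balanced b ->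
        fsum b s = fsum b t >].

Lemma tens_eq_refl : reflexive tens_eq.
Proof. by move=> s; apply/asboolP. Qed.

Lemma tens_eq_sym : symmetric tens_eq.
Proof.
by move=> s t; apply/asboolP/asboolP=> st U b bb; rewrite st.
Qed.

Lemma tens_eq_trans : transitive tens_eq.
Proof.
move=> t s r /asboolP st /asboolP tr; apply/asboolP=> U b bb.
by rewrite st ?tr.
Qed.

Canonical tens_equiv :=
  EquivRel tens_eq tens_eq_refl tens_eq_sym tens_eq_trans.

Definition tens : Type := {eq_quot tens_equiv}.
HB.instance Definition _ := Choice.on tens.

Definition tclass (s : seq (V * W)) : tens := \pi_{eq_quot tens_equiv} s.
Definition trepr (x : tens) : seq (V * W) :=
  repr (x : {eq_quot tens_equiv}).

Lemma treprK x : tclass (trepr x) = x.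
Proof. exact: reprK. Qed.

Lemma tclassP (U : zmodType) (b : V -> W -> U) s t :
  balanced b -> tclass s = tclass t -> fsum b s = fsum b t.
Proof. by move=> bb /eqquotP/asboolP; apply. Qed.

Lemma eq_tclass s t :
  (forall (U : zmodType) (b : V -> W -> U), balanced b ->
     fsum b s = fsum b t) -> tclass s = tclass t.
Proof. by move=> st; apply/eqquotP/asboolP. Qed.

Definition topp_seq (s : seq (V * W)) := [seq (- p.1, p.2) | p <- s].
Definition t_zero : tens := tclass [::].
Definition t_add (x y : tens) : tens := tclass (trepr x ++ trepr y).
Definition t_opp (x : tens) : tens := tclass (topp_seq (trepr x)).

Lemma fsum_cat (U : zmodType) (b : V -> W -> U) s t :
  fsum b (s ++ t) = fsum b s + fsum b t.
Proof. exact: big_cat. Qed.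

Lemma fsum_opp (U : zmodType) (b : V -> W -> U) s :
  balanced b -> fsum b (topp_seq s) = - fsum b s.
Proof.
case=> bD _ _; rewrite /fsum big_map -sumrN; apply: eq_bigr => p _ /=.
by rewrite (addfN (f := b^~ p.2)) // => v v'; apply: bD.
Qed.

Lemma fsum_repr (U : zmodType) (b : V -> W -> U) s :
  balanced b -> fsum b (trepr (tclass s)) = fsum b s.
Proof. by move=> bb; apply: tclassP => //; rewrite treprK. Qed.

Lemma t_addA : associative t_add.
Proof.
move=> x y z; apply: eq_tclass => U b bb.
by rewrite !fsum_cat !fsum_repr // !fsum_cat addrA.
Qed.

Lemma t_addC : commutative t_add.
Proof.
by move=> x y; apply: eq_tclass => U b bb; rewrite !fsum_cat addrC.
Qed.

Lemma t_add0 : left_id t_zero t_add.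
Proof.
move=> x; rewrite -[RHS]treprK; apply: eq_tclass => U b bb.
by rewrite !fsum_cat fsum_repr // [X in X + _]big_nil add0r.
Qed.

Lemma t_addN : left_inverse t_zero t_opp t_add.
Proof.
move=> x; apply: eq_tclass => U b bb.
by rewrite !fsum_cat fsum_repr // fsum_opp // addNr [RHS]big_nil.
Qed.

HB.instance Definition _ :=
  GRing.isZmodule.Build tens t_addA t_addC t_add0 t_addN.

Definition tpure (v : V) (w : W) : tens := tclass [:: (v, w)].

Definition tlift (U : zmodType) (b : V -> W -> U) (x : tens) : U :=
  fsum b (trepr x).

Section Lift.
Variables (U : zmodType) (b : V -> W -> U).
Hypothesis bb : balanced b.

Lemma tliftE v w : tlift b (tpure v w) = b v w.
Proof. by rewrite /tlift fsum_repr // /fsum big_seq1. Qed.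

Lemma tliftD : {morph tlift b : x y / x + y}.
Proof.
by move=> x y; rewrite /tlift [in LHS]/GRing.add /= fsum_repr // fsum_cat.
Qed.

End Lift.

Lemma tpure_balanced : balanced tpure.
Proof.
split=> [v v' w|v w w'|k v w]; apply: eq_tclass => U b bb;
  rewrite ?fsum_cat ?fsum_repr // /fsum !big_seq1 /=; by case: bb.
Qed.

Lemma tpureDl v v' w : tpure (v + v') w = tpure v w + tpure v' w.
Proof. by case: tpure_balanced => ->. Qed.
Lemma tpureDr v w w' : tpure v (w + w') = tpure v w + tpure v w'.
Proof. by case: tpure_balanced => _ ->. Qed.
Lemma tpureZ k v w : tpure (k *: v) w = tpure v (k *: w).
Proof. by case: tpure_balanced => _ _ ->. Qed.

Lemma tens_sum x : x = \sum_(p <- trepr x) tpure p.1 p.2.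
Proof.
rewrite -[LHS]treprK; elim: (trepr x) => [|p s ih]; first by rewrite big_nil.
rewrite big_cons -ih; apply: eq_tclass => U b bb.
by rewrite fsum_cat !fsum_repr // -fsum_cat -surjective_pairing.
Qed.

Lemma tens_ind (P : tens -> Prop) :
  P 0 -> (forall x y, P x -> P y -> P (x + y)) ->
  (forall v w, P (tpure v w)) -> forall x, P x.
Proof.
move=> P0 PD Pp x; rewrite (tens_sum x).
by elim/big_rec: _ => // p y _; apply: PD.
Qed.

Lemma tens_ext (U : zmodType) (f g : tens -> U) :
  {morph f : x y / x + y} -> {morph g : x y / x + y} ->
  (forall v w, f (tpure v w) = g (tpure v w)) -> f =1 g.
Proof.
move=> fD gD fg; elim/tens_ind => [|x y fx fy|//].
  by rewrite (addf0 fD) (addf0 gD).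
by rewrite fD gD fx fy.
Qed.

Definition t_scale (k : K) : tens -> tens := tlift (fun v w => tpure (k *: v) w).

Lemma t_scale_balanced k : balanced (fun v w => tpure (k *: v) w).
Proof.
split=> [v v' w|v w w'|k' v w]; rewrite ?scalerDr ?tpureDl ?tpureDr //.
by rewrite scalerA mulrC -scalerA tpureZ.
Qed.

Lemma t_scaleE k v w : t_scale k (tpure v w) = tpure (k *: v) w.
Proof. exact/tliftE/t_scale_balanced. Qed.

Lemma t_scaleD k : {morph t_scale k : x y / x + y}.
Proof. exact/tliftD/t_scale_balanced. Qed.

Lemma t_scaleA k k' x : t_scale k (t_scale k' x) = t_scale (k * k') x.
Proof.
move: x; apply: tens_ext => [x y|x y|v w]; rewrite ?t_scaleD //.
by rewrite !t_scaleE scalerA.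
Qed.

Lemma t_scale1 : left_id 1 t_scale.
Proof.
by apply: tens_ext => [x y|x y|v w]; rewrite ?t_scaleD // t_scaleE scale1r.
Qed.

Lemma t_scaleDr : right_distributive t_scale +%R.
Proof. by move=> k x y; rewrite t_scaleD. Qed.

Lemma t_scaleDl x : {morph t_scale^~ x : k k' / k + k'}.
Proof.
move=> k k'; move: x; apply: tens_ext => [x y|x y|v w]; rewrite ?t_scaleD //.
  by rewrite addrACA.
by rewrite !t_scaleE scalerDl tpureDl.
Qed.

HB.instance Definition _ :=
  GRing.Zmodule_isLmodule.Build K tens t_scaleA t_scale1 t_scaleDr t_scaleDl.

Lemma scale_tpure k v w : k *: tpure v w = tpure (k *: v) w.
Proof. exact: t_scaleE. Qed.

Lemma tlift_linear (U : lmodType K) (b : V -> W -> U) : balanced b ->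
  (forall k v w, b (k *: v) w = k *: b v w) -> linear (tlift b).
Proof.
move=> bb bZ k x y; rewrite tliftD //; congr (_ + _).
move: x; apply: tens_ext => [x x'|x x'|v w]; rewrite ?scalerDr ?tliftD //.
  by rewrite scalerDr.
by rewrite scale_tpure !tliftE.
Qed.

End Tensor.

Notation "v ⊗ w" := (tpure v w) (at level 39, left associativity).

Section TensorMap.
Variables (K L : fieldType) (phi : {rmorphism K -> L}).
Variables (V W : lmodType K) (V' W' : lmodType L).

Definition tmap (f : V -> V') (g : W -> W') : tens V W -> tens V' W' :=
  tlift (fun v w => f v ⊗ g w).

Variables (f : V -> V') (g : W -> W').
Hypotheses (sf : semilin phi f) (sg : semilin phi g).

Lemma tmap_balanced : balanced (fun v w => f v ⊗ g w).
Proof.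
case: sf sg => fD fZ [gD gZ].
by split=> [v v' w|v w w'|k v w]; rewrite ?fD ?gD ?tpureDl ?tpureDr // fZ gZ tpureZ.
Qed.

Lemma tmapE v w : tmap f g (v ⊗ w) = f v ⊗ g w.
Proof. exact/tliftE/tmap_balanced. Qed.

Lemma tmapD : {morph tmap f g : x y / x + y}.
Proof. exact/tliftD/tmap_balanced. Qed.

Lemma tmap_semilin : semilin phi (tmap f g).
Proof.
split=> [|k]; first exact: tmapD.
apply: tens_ext => [x y|x y|v w]; rewrite ?scalerDr ?tmapD ?scalerDr //.
by rewrite scale_tpure !tmapE scale_tpure (proj2 sf).
Qed.

End TensorMap.

Lemma tmap_linear (K : fieldType) (V W V' W' : lmodType K)
    (f : V -> V') (g : W -> W') :
  semilin idfun f -> semilin idfun g -> linear (tmap f g).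
Proof. by move=> sf sg; apply/semilin_linear/tmap_semilin. Qed.

Lemma tmap_comp (K L M : fieldType) (phi : {rmorphism K -> L})
    (psi : {rmorphism L -> M}) (V W : lmodType K) (V' W' : lmodType L)
    (V'' W'' : lmodType M) (f : V -> V') (g : W -> W') (f' : V' -> V'')
    (g' : W' -> W'') :
  semilin phi f -> semilin phi g -> semilin psi f' -> semilin psi g' ->
  forall x, tmap f' g' (tmap f g x) = tmap (f' \o f) (g' \o g) x.
Proof.
move=> sf sg sf' sg'.
have sff := semilin_comp sf sf'; have sgg := semilin_comp sg sg'.
have c := @tmapD _ _ (psi \o phi : {rmorphism _ -> _}) _ _ _ _ _ _ sff sgg.
apply: tens_ext => [x y|x y|v w]; last 1 first.
- rewrite (tmapE sf sg) (tmapE sf' sg').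
  by rewrite (@tmapE _ _ (psi \o phi : {rmorphism _ -> _}) _ _ _ _ _ _ sff sgg).
- by rewrite (tmapD sf sg) (tmapD sf' sg').
- exact: c.
Qed.

Lemma eq_tmap (K L : fieldType) (V W : lmodType K) (V' W' : lmodType L)
    (f f' : V -> V') (g g' : W -> W') :
  f =1 f' -> g =1 g' -> tmap f g =1 tmap f' g'.
Proof. by move=> /funext -> /funext ->. Qed.

Lemma tmap_id (K : fieldType) (V W : lmodType K) :
  tmap (fun v : V => v) (fun w : W => w) =1 id.
Proof.
have si := @semilin_id K.
apply: tens_ext => [x y|//|v w]; first exact: (tmapD (si _) (si _)).
exact: (tmapE (si _) (si _)).
Qed.

Section TensorAssoc.
Variables (K : fieldType) (U V W : lmodType K).

Definition tassoc (x : tens U (tens V W)) : tens (tens U V) W :=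
  tlift (fun (u : U) (y : tens V W) =>
    tlift (fun (v : V) (w : W) => (u ⊗ v) ⊗ w) y) x.

Lemma tassoc_balanced1 (u : U) : balanced (fun (v : V) (w : W) => (u ⊗ v) ⊗ w).
Proof.
split=> [v v' w|v w w'|k v w]; rewrite ?tpureDr ?tpureDl ?tpureDr //.
by rewrite -tpureZ -scale_tpure tpureZ.
Qed.

Lemma tassoc_balanced :
  balanced (fun (u : U) => tlift (fun (v : V) (w : W) => (u ⊗ v) ⊗ w)).
Proof.
have b1 := tassoc_balanced1; have tD u := tliftD (b1 u).
split=> [u u'|u x y|k u]; last 1 first.
- apply: tens_ext => [x y|x y|v w]; rewrite ?scalerDr ?tD //.
  by rewrite scale_tpure !tliftE // tpureZ.
- apply: tens_ext => [x y|x y|v w]; rewrite ?tD //; first by rewrite addrACA.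
  by rewrite !tliftE // !tpureDl.
- exact: tD.
Qed.

Lemma tassocE u v w : tassoc (u ⊗ (v ⊗ w)) = (u ⊗ v) ⊗ w.
Proof.
rewrite /tassoc (tliftE tassoc_balanced) (tliftE (tassoc_balanced1 u)) //.
Qed.

Lemma tassocD : {morph tassoc : x y / x + y}.
Proof. exact/tliftD/tassoc_balanced. Qed.

Lemma tassoc_ext (T : zmodType) (f g : tens U (tens V W) -> T) :
  {morph f : x y / x + y} -> {morph g : x y / x + y} ->
  (forall u v w, f (u ⊗ (v ⊗ w)) = g (u ⊗ (v ⊗ w))) -> f =1 g.
Proof.
move=> fD gD fg; apply: tens_ext => // u.
by apply: tens_ext => [x y|x y|v w //]; rewrite tpureDr ?fD ?gD.
Qed.

End TensorAssoc.

Lemma tmap_tassoc (K L : fieldType) (phi : {rmorphism K -> L})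
    (U V W : lmodType K) (U' V' W' : lmodType L)
    (f : U -> U') (g : V -> V') (h : W -> W') :
  semilin phi f -> semilin phi g -> semilin phi h ->
  forall x, tmap (tmap f g) h (tassoc x) = tassoc (tmap f (tmap g h) x).
Proof.
move=> sf sg sh; have sfg := tmap_semilin sf sg; have sgh := tmap_semilin sg sh.
apply: tassoc_ext => [x y|x y|u v w].
- by rewrite tassocD (tmapD sfg sh).
- by rewrite (tmapD sf sgh) tassocD.
- by rewrite tassocE (tmapE sfg sh) (tmapE sf sg) (tmapE sf sgh) (tmapE sg sh) tassocE.
Qed.

(* Biadditive operations on tensor products, given on pure tensors.           *)
Section Lift2.
Variables (K L : fieldType) (V W : lmodType K) (V' W' : lmodType L).
Variables (U : zmodType) (B : V -> W -> V' -> W' -> U).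

Definition tlift2 (x : tens V W) (y : tens V' W') : U :=
  tlift (fun v w => tlift (B v w) y) x.

Hypothesis B1 : forall v' w', balanced (fun v w => B v w v' w').
Hypothesis B2 : forall v w, balanced (B v w).

Lemma tlift2_balanced y : balanced (fun v w => tlift (B v w) y).
Proof.
have tD v w := tliftD (B2 v w).
split=> [v v' w|v w w'|k v w]; move: y; apply: tens_ext => [x y|x y|a b].
- exact: tD.
- by rewrite !tD addrACA.
- by rewrite !tliftE //; case: (B1 a b).
- exact: tD.
- by rewrite !tD addrACA.
- by rewrite !tliftE //; case: (B1 a b).
- exact: tD.
- exact: tD.
- by rewrite !tliftE //; case: (B1 a b).
Qed.

Lemma tlift2E v w v' w' : tlift2 (v ⊗ w) (v' ⊗ w') = B v w v' w'.
Proof. by rewrite /tlift2 (tliftE (tlift2_balanced _)) tliftE. Qed.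

Lemma tlift2Dl x x' y : tlift2 (x + x') y = tlift2 x y + tlift2 x' y.
Proof. exact/tliftD/tlift2_balanced. Qed.

Lemma tlift2Dr x y y' : tlift2 x (y + y') = tlift2 x y + tlift2 x y'.
Proof.
move: x; apply: tens_ext => [x x'|x x'|v w]; rewrite ?tlift2Dl //.
  by rewrite addrACA.
by rewrite /tlift2 !(tliftE (tlift2_balanced _)) tliftD.
Qed.

Lemma tlift2_ext (f g : tens V W -> tens V' W' -> U) :
  (forall y, {morph f^~ y : x x' / x + x'}) ->
  (forall x, {morph f x : y y' / y + y'}) ->
  (forall y, {morph g^~ y : x x' / x + x'}) ->
  (forall x, {morph g x : y y' / y + y'}) ->
  (forall v w v' w', f (v ⊗ w) (v' ⊗ w') = g (v ⊗ w) (v' ⊗ w')) -> f =2 g.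
Proof.
move=> fl fr gl gr fg x y; move: x; apply: tens_ext; [exact: fl|exact: gl|].
by move=> v w; move: y; apply: tens_ext; [exact: fr|exact: gr|].
Qed.

End Lift2.

HB.mixin Record isSuperModule (K : fieldType) V of GRing.Lmodule K V := {
  par : bool -> V -> V;
  par_linear : forall i, linear (par i);
  par_par : forall i j v, par i (par j v) = if i == j then par j v else 0;
  par_sum : forall v, par false v + par true v = v
}.

(* A superspace: [par i v] is the homogeneous component of [v] of parity [i], *)
(* with [false] for even and [true] for odd.                                  *)
#[short(type="superModType")]
HB.structure Definition SuperModule (K : fieldType) :=
  {V of GRing.Lmodule K V & isSuperModule K V}.

HB.mixin Record isSuperAlgebra (K : fieldType) A
    of GRing.Algebra K A & SuperModule K A := {
  par1 : par false (1 : A) = 1;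
  parM : forall (i : bool) (a b : A),
    par i (a * b) = par false a * par i b + par true a * par (~~ i) b
}.

#[short(type="superAlgType")]
HB.structure Definition SuperAlgebra (K : fieldType) :=
  {A of GRing.Algebra K A & SuperModule K A & isSuperAlgebra K A}.

Section SuperTheory.
Variables (K : fieldType).

Lemma par_semilin (V : superModType K) i : semilin idfun (par i : V -> V).
Proof. exact/linear_semilin/par_linear. Qed.

Lemma parD (V : superModType K) i : {morph (par i : V -> V) : u v / u + v}.
Proof. by case: (par_semilin V i). Qed.

Lemma parZ (V : superModType K) i k (v : V) : par i (k *: v) = k *: par i v.
Proof. by case: (par_semilin V i) => _ ->. Qed.

Lemma par0 (V : superModType K) i : par i (0 : V) = 0.
Proof. exact: addf0 (@parD V i). Qed.

(* The grading of the tensor product of two superspaces. *)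
Definition tpar (V W : superModType K) (i : bool) (x : tens V W) : tens V W :=
  tmap (par false) (par i) x + tmap (par true) (par (~~ i)) x.

(* The product of the tensor product superalgebra:                            *)
(* (a ⊗ b)(c ⊗ d) = (-1)^{|b||c|} ac ⊗ bd for homogeneous b and c.            *)
Definition tsmul (A B : superAlgType K) : tens A B -> tens A B -> tens A B :=
  tlift2 (fun a b c d => \sum_(i : bool) \sum_(j : bool)
    (-1) ^+ (i && j) *: ((a * par j c) ⊗ (par i b * d))).

Section TsMul.
Variables (A B : superAlgType K).

Let Bm (a : A) (b : B) (c : A) (d : B) := \sum_(i : bool) \sum_(j : bool)
    (-1) ^+ (i && j) *: ((a * par j c) ⊗ (par i b * d)).

Let balanced_sum (V W : lmodType K) (U : zmodType) (I : finType)
    (F : I -> V -> W -> U) : (forall i, balanced (F i)) ->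
  balanced (fun v w => \sum_i F i v w).
Proof.
move=> bF; split=> [v v' w|v w w'|k v w]; rewrite -?big_split;
  by apply: eq_bigr => i _; case: (bF i).
Qed.

Let balanced_scale (V W U : lmodType K) (F : V -> W -> U) k :
  balanced F -> balanced (fun v w => k *: F v w).
Proof.
by case=> F1 F2 F3; split=> *; rewrite ?F1 ?F2 ?F3 // scalerDr.
Qed.

Lemma tsmul_balanced1 c d : balanced (fun a b => Bm a b c d).
Proof.
apply: balanced_sum => i; apply: balanced_sum => j; apply: balanced_scale.
split=> [a a' b|a b b'|k a b].
- by rewrite mulrDl tpureDl.
- by rewrite parD mulrDl tpureDr.
- by rewrite -scalerAl tpureZ parZ scalerAl.
Qed.

Lemma tsmul_balanced2 a b : balanced (Bm a b).
Proof.
apply: balanced_sum => i; apply: balanced_sum => j; apply: balanced_scale.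
split=> [c c' d|c d d'|k c d].
- by rewrite parD mulrDr tpureDl.
- by rewrite mulrDr tpureDr.
- by rewrite parZ -!scalerAr tpureZ.
Qed.

Lemma tsmulE a b c d : tsmul (a ⊗ b) (c ⊗ d) = Bm a b c d.
Proof. exact: (tlift2E tsmul_balanced1 tsmul_balanced2). Qed.

Lemma tsmulDl (y : tens A B) : {morph (@tsmul A B)^~ y : x x' / x + x'}.
Proof. by move=> x x'; exact: (tlift2Dl tsmul_balanced1 tsmul_balanced2). Qed.

Lemma tsmulDr (x : tens A B) : {morph (@tsmul A B) x : y y' / y + y'}.
Proof. by move=> y y'; exact: (tlift2Dr tsmul_balanced1 tsmul_balanced2). Qed.

Lemma tsmulZl k x y : k *: tsmul x y = tsmul (k *: x) y :> tens A B.
Proof.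
move: x y; apply: tlift2_ext => [y x x'|x y y'|y x x'|x y y'|a b c d].
- by rewrite tsmulDl scalerDr.
- by rewrite tsmulDr scalerDr.
- by rewrite scalerDr tsmulDl.
- by rewrite tsmulDr.
- rewrite scale_tpure !tsmulE /Bm scaler_sumr; apply: eq_bigr => i _.
  rewrite scaler_sumr; apply: eq_bigr => j _.
  by rewrite scalerA mulrC -scalerA scale_tpure scalerAl.
Qed.

Lemma tsmulZr k x y : k *: tsmul x y = tsmul x (k *: y) :> tens A B.
Proof.
move: x y; apply: tlift2_ext => [y x x'|x y y'|y x x'|x y y'|a b c d].
- by rewrite tsmulDl scalerDr.
- by rewrite tsmulDr scalerDr.
- by rewrite tsmulDl.
- by rewrite scalerDr tsmulDr.
- rewrite scale_tpure !tsmulE /Bm scaler_sumr; apply: eq_bigr => i _.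
  rewrite scaler_sumr; apply: eq_bigr => j _.
  by rewrite scalerA mulrC -scalerA scale_tpure parZ scalerAr.
Qed.

End TsMul.

End SuperTheory.

(* An affine group superscheme over K, given by its coordinate superalgebra,  *)
(* a commutative Hopf superalgebra.                                           *)
Record supergroup (K : fieldType) := SuperGroup {
  coord :> superAlgType K;
  coord_comm : forall (i j : bool) (a b : coord),
    par i a * par j b = (-1) ^+ (i && j) *: (par j b * par i a);
  comul : {linear coord -> tens coord coord};
  counit : {scalar coord};
  antip : {linear coord -> coord};
  comul_par : forall i a, comul (par i a) = tpar i (comul a);
  comul1 : comul 1 = 1 ⊗ 1;
  comulM : forall a b, comul (a * b) = tsmul (comul a) (comul b);
  counit_par : forall a, counit (par true a) = 0;
  counit1 : counit 1 = 1;
  counitM : forall a b, counit (a * b) = counit a * counit b;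
  antip_par : forall i a, antip (par i a) = par i (antip a);
  comulA : forall a, tassoc (tmap id comul (comul a))
                     = tmap comul id (comul a);
  counitl : forall a, tlift (fun x y => counit x *: y) (comul a) = a;
  counitr : forall a, tlift (fun x y => counit y *: x) (comul a) = a;
  antipl : forall a, tlift (fun x y => antip x * y) (comul a) = (counit a)%:A;
  antipr : forall a, tlift (fun x y => x * antip y) (comul a) = (counit a)%:A
}.

Arguments comul {K s}.
Arguments counit {K s}.
Arguments antip {K s}.

(* A representation of G: a right supercomodule over the coordinate algebra.  *)
Record rep (K : fieldType) (G : supergroup K) := Rep {
  rep_space :> superModType K;
  coact : {linear rep_space -> tens rep_space G};
  coact_par : forall i v, coact (par i v) = tpar i (coact v);
  coactA : forall v, tassoc (tmap id comul (coact v))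
                     = tmap coact id (coact v);
  coact_counit : forall v, tlift (fun x a => counit a *: x) (coact v) = v
}.
Arguments coact {K G r}.

Section ParityChange.
Variables (K : fieldType).

Definition parity_change (V : Type) : Type := V.

HB.instance Definition _ (V : lmodType K) :=
  GRing.Lmodule.on (parity_change V).

Section Mixin.
Variable (V : superModType K).

Definition pc_par (i : bool) : parity_change V -> parity_change V :=
  par (~~ i) : V -> V.

Lemma pc_par_linear i : linear (pc_par i).
Proof. exact: par_linear. Qed.

Lemma pc_par_par i j v :
  pc_par i (pc_par j v) = if i == j then pc_par j v else 0.
Proof. by rewrite /pc_par par_par; case: i; case: j. Qed.

Lemma pc_par_sum v : pc_par false v + pc_par true v = v.
Proof. by rewrite addrC; apply: (par_sum (v : V)). Qed.

HB.instance Definition _ := isSuperModule.Build K (parity_change V)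
  pc_par_linear pc_par_par pc_par_sum.
End Mixin.

Section Rep.
Variables (G : supergroup K) (V : rep G).

Let rho (v : parity_change V) : tens (parity_change V) G := coact (v : V).

Let rho_linear : linear rho.
Proof. exact: (linearP (@coact K G V)). Qed.

Let rho_par i v : mklin rho_linear (par i v) = tpar i (mklin rho_linear v).
Proof.
rewrite /= [LHS](coact_par (~~ i) (v : V)) /tpar [RHS]addrC /=.
by rewrite negbK; case: i.
Qed.

Definition parity_rep : rep G :=
  @Rep K G (parity_change V) (mklin rho_linear) rho_par
    (@coactA K G V) (@coact_counit K G V).
End Rep.

End ParityChange.

Section RepTheory.
Variables (K : fieldType) (G : supergroup K).

Definition rep_hom (V W : rep G) (f : {linear V -> W}) : Prop :=
  (forall i v, f (par i v) = par i (f v)) /\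
  (forall v, coact (f v) = tmap f id (coact v)).

Definition rep_isom (V W : rep G) : Prop :=
  exists f : {linear V -> W}, rep_hom f /\ bijective f.

Definition subrep_of (V W : rep G) : Prop :=
  exists f : {linear V -> W}, rep_hom f /\ injective f.

(* Last clause: the coaction maps U into the image of U ⊗ K[G].               *)
Definition is_subrep (V : rep G) (U : V -> Prop) : Prop :=
  [/\ U 0, (forall k u v, U u -> U v -> U (k *: u + v)),
      (forall i u, U u -> U (par i u))
    & (forall u, U u -> exists s : seq (V * G),
         (forall p, p \in s -> U p.1) /\ coact u = \sum_(p <- s) p.1 ⊗ p.2)].

Definition irreducible_rep (V : rep G) : Prop :=
  (exists v : V, v != 0) /\
  (forall U : V -> Prop, is_subrep U ->
     (forall u, U u -> u = 0) \/ (forall u, U u)).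

Record irrep := Irrep {
  irrep_rep :> rep G;
  irrep_irr : irreducible_rep irrep_rep
}.

End RepTheory.

(* The superalgebra of endomorphisms of V: the maps f0 + f1 with f0 an        *)
(* endomorphism of V and f1 a homomorphism from V to its parity change.       *)
(* V is taken irreducible, hence nonzero, because an [algType] has 1 != 0.    *)
Section Uend.
Variables (K : fieldType) (G : supergroup K) (V : irrep G).

Definition uend_decomp (f : V -> V) (f0 : {linear V -> V})
    (f1 : {linear V -> parity_rep V}) : Prop :=
  [/\ rep_hom f0, rep_hom f1 & forall v, f v = f0 v + (f1 v : V)].

Definition uend_pred : {pred V -> V} :=
  fun f => `[< exists f0 f1, uend_decomp f f0 f1 >].

Definition uend : Type := {f : V -> V | f \in uend_pred}.
HB.instance Definition _ := SubChoice.on uend.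

(* Homogeneous maps of parity i: even maps commuting with the coaction, or    *)
(* odd ones. *)
Let hm (i : bool) (f : V -> V) : Prop :=
  [/\ linear f, forall j v, f (par j v) = par (i (+) j) (f v)
    & forall v, coact (f v) = tmap f id (coact v)].

Let uendP (f : V -> V) : reflect
  (exists f0 f1, [/\ hm false f0, hm true f1 & f = f0 + f1]) (f \in uend_pred).
Proof.
apply: (iffP (asboolP _)) => [[f0 [f1 [[p0 c0] [p1 c1] fE]]]|].
  exists f0, (f1 : V -> V); split; last exact/funext.
    by split; [exact: linearP|exact: p0|exact: c0].
  by split; [exact: (linearP f1)|exact: p1|exact: c1].
move=> [f0 [f1 [[l0 p0 c0] [l1 p1 c1] ->]]].
exists (mklin l0), (@mklin K V (parity_change V) f1 l1); split=> //; split=> //.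
Qed.

Let hm0 i : hm i (fun=> 0).
Proof.
split=> [k u v|j v|v]; rewrite ?scaler0 ?addr0 ?par0 ?linear0 //.
have b : semilin idfun (fun _ : V => 0 : V).
  by split=> [u u'|k u] /=; rewrite ?scaler0 ?addr0.
move: (coact v); apply: tens_ext => [x y|x y|v' a].
- by rewrite addr0.
- exact: (tmapD b (@semilin_id K G)).
- rewrite (tmapE b (@semilin_id K G)).
  by apply/esym; apply: addf0 (fun x => x ⊗ a) _ => u u'; rewrite tpureDl.
Qed.

Let hmD i k f g : hm i f -> hm i g -> hm i (fun v => k *: f v + g v).
Proof.
move=> [lf pf cf] [lg pg cg].
have sf := linear_semilin lf; have sg := linear_semilin lg.
have si := @semilin_id K G.
have lfg : linear (fun v => k *: f v + g v).
  move=> a u v; rewrite lf lg !scalerDr !scalerA mulrC -!addrA; congr (_ + _).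
  by rewrite [LHS]addrCA.
split=> // [j v|v].
  by rewrite pf pg parD parZ.
rewrite linearP cf cg.
move: (coact v); apply: tens_ext => [x y|x y|v' a].
- by rewrite !(tmapD sf si) !(tmapD sg si) scalerDr addrACA.
- exact: (tmapD (linear_semilin lfg) si).
- rewrite (tmapE sf si) (tmapE sg si) (tmapE (linear_semilin lfg) si).
  by rewrite scale_tpure tpureDl.
Qed.

Let hmM i j f g : hm i f -> hm j g -> hm (i (+) j) (f \o g).
Proof.
move=> [lf pf cf] [lg pg cg]; split=> [k u v|k v|v] /=.
- by rewrite lg lf.
- by rewrite pg pf addbA.
- rewrite cf cg.
  exact: (tmap_comp (linear_semilin lg) (@semilin_id K G)
                    (linear_semilin lf) (@semilin_id K G)).
Qed.

Let hm1 : hm false id.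
Proof. by split=> // v; rewrite tmap_id. Qed.

Lemma uend_submod_closed : submod_closed uend_pred.
Proof.
split=> [|k f g /uendP[f0 [f1 [h0 h1 ->]]] /uendP[g0 [g1 [e0 e1 ->]]]].
  apply/uendP; exists (fun=> 0), (fun=> 0); split; [exact: hm0|exact: hm0|].
  by apply/funext => v; rewrite addrfctE addr0.
apply/uendP.
exists (fun v => k *: f0 v + g0 v), (fun v => k *: f1 v + g1 v); split.
- exact: hmD.
- exact: hmD.
- by apply/funext => v; rewrite !addrfctE /= [in LHS]/GRing.scale /= scalerDr addrACA.
Qed.

HB.instance Definition _ :=
  GRing.isSubmodClosed.Build K (V -> V) uend_pred uend_submod_closed.
HB.instance Definition _ := [SubChoice_isSubLmodule of uend by <:].

Let uend_lin (f : uend) : linear (val f).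
Proof.
have /uendP[f0 [f1 [[l0 _ _] [l1 _ _] ->]]] := valP f.
by move=> k u v; rewrite !addrfctE l0 l1 scalerDr addrACA.
Qed.

Let uend_comp_mem (f g : uend) : val f \o val g \in uend_pred.
Proof.
have /uendP[f0 [f1 [h0 h1 fE]]] := valP f.
have /uendP[g0 [g1 [e0 e1 gE]]] := valP g.
have [l0 _ _] := h0; have [l1 _ _] := h1.
apply/uendP; exists (fun v => 1 *: (f0 \o g0) v + (f1 \o g1) v).
exists (fun v => 1 *: (f0 \o g1) v + (f1 \o g0) v); split.
- by apply: hmD; [exact: (hmM h0 e0)|exact: (hmM h1 e1)].
- by apply: hmD; [exact: (hmM h0 e1)|exact: (hmM h1 e0)].
- apply/funext => v; rewrite fE gE /= !addrfctE /= !scale1r.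
  rewrite (linear_semilin l0).1 (linear_semilin l1).1.
  by rewrite [f1 _ + f1 _]addrC addrACA.
Qed.

Let uend_id_mem : (id : V -> V) \in uend_pred.
Proof.
apply/uendP; exists id, (fun=> 0); split; [exact: hm1|exact: hm0|].
by apply/funext => v; rewrite addrfctE addr0.
Qed.

Definition uend_mul (f g : uend) : uend := @Sub _ _ uend _ (uend_comp_mem f g).
Definition uend_one : uend := @Sub _ _ uend _ uend_id_mem.

Lemma uend_eqP (f g : uend) : (forall v, val f v = val g v) -> f = g.
Proof. by move=> fg; apply/val_inj/funext. Qed.

Let uend_valD (f g : uend) : val (f + g) = val f + val g.
Proof. exact: (raddfD (val : uend -> (V -> V))). Qed.

Let mulA : associative uend_mul.
Proof. by move=> f g h; apply: uend_eqP => v; rewrite !SubK. Qed.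
Let mul1 : left_id uend_one uend_mul.
Proof. by move=> f; apply: uend_eqP => v; rewrite !SubK. Qed.
Let mulr1 : right_id uend_one uend_mul.
Proof. by move=> f; apply: uend_eqP => v; rewrite !SubK. Qed.
Let mulDl : left_distributive uend_mul +%R.
Proof. by move=> f g h; apply: uend_eqP => v; rewrite !(SubK, raddfD). Qed.
Let mulDr : right_distributive uend_mul +%R.
Proof.
move=> f g h; apply: uend_eqP => v; rewrite !(SubK, raddfD) /=.
by rewrite addrfctE (linear_semilin (uend_lin f)).1.
Qed.
Let one_neq0 : uend_one != 0.
Proof.
have [[v v0] _] := irrep_irr V; apply/eqP => /(congr1 val).
by rewrite SubK raddf0 => /(congr1 (@^~ v)) /= v00; rewrite v00 eqxx in v0.
Qed.

HB.instance Definition _ := GRing.Zmodule_isNzRing.Build uend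
  mulA mul1 mulr1 mulDl mulDr one_neq0.

Let scaleAl (k : K) (f g : uend) : k *: (f * g) = (k *: f) * g.
Proof. by apply: uend_eqP => v; rewrite !(SubK, linearZ). Qed.
HB.instance Definition _ := GRing.Lmodule_isLalgebra.Build K uend scaleAl.
Let scaleAr (k : K) (f g : uend) : k *: (f * g) = f * (k *: g).
Proof.
apply: uend_eqP => v; rewrite !(SubK, linearZ) /=.
by rewrite [RHS](linear_semilin (uend_lin f)).2.
Qed.
HB.instance Definition _ := GRing.Lalgebra_isAlgebra.Build K uend scaleAr.

Definition uend_part (i : bool) (f : V -> V) (v : V) : V :=
  par i (f (par false v)) + par (~~ i) (f (par true v)).

Let uend_partE i f f0 f1 : hm false f0 -> hm true f1 -> f = f0 + f1 ->
  uend_part i f = if i then f1 else f0.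
Proof.
move=> [l0 p0 _] [l1 p1 _] ->; apply/funext => v.
rewrite /uend_part !addrfctE !p0 !p1 !parD !par_par.
have e0 := par_sum (f0 v); have e1 := par_sum (f1 v).
by case: i => /=; rewrite ?add0r ?addr0 // addrC.
Qed.

Let uend_part_mem i (f : uend) : uend_part i (val f) \in uend_pred.
Proof.
have /uendP[f0 [f1 [h0 h1 fE]]] := valP f.
rewrite (uend_partE i h0 h1 fE); apply/uendP.
case: i; [exists (fun=> 0), f1|exists f0, (fun=> 0)]; split=> //;
  by apply/funext => v; rewrite addrfctE ?addr0 ?add0r.
Qed.

Definition uend_par (i : bool) (f : uend) : uend := @Sub _ _ uend _ (uend_part_mem i f).

Let uend_par_linear i : linear (uend_par i).
Proof.
move=> k f g; apply: uend_eqP => v.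
rewrite !(SubK, linearP) /uend_part /=.
rewrite !addrfctE /= [k *: val f]/GRing.scale /= [k *: uend_part _ _]/GRing.scale /=.
by rewrite /uend_part !parD !parZ scalerDr addrACA.
Qed.

Let uend_parE (f : uend) : exists f0 f1,
  [/\ hm false f0, hm true f1, val f = f0 + f1
    & forall i, val (uend_par i f) = if i then f1 else f0].
Proof.
have /uendP[f0 [f1 [h0 h1 fE]]] := valP f.
exists f0, f1; split=> // i; rewrite SubK; exact: uend_partE.
Qed.

Let uend_par_par i j f :
  uend_par i (uend_par j f) = if i == j then uend_par j f else 0.
Proof.
apply: val_inj; rewrite SubK.
have [f0 [f1 [h0 h1 fE fp]]] := uend_parE f.
have := fp j; case: j => /= e; rewrite e.
- rewrite (uend_partE i (hm0 false) h1) ?[RHS]fun_if ?raddf0; last first.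
    by apply/funext => v; rewrite addrfctE add0r.
  by case: i => //=.
- rewrite (uend_partE i h0 (hm0 true)) ?[RHS]fun_if ?raddf0; last first.
    by apply/funext => v; rewrite addrfctE addr0.
  by case: i => //=.
Qed.

Let uend_par_sum f : uend_par false f + uend_par true f = f.
Proof.
have [f0 [f1 [_ _ fE fp]]] := uend_parE f.
by apply: val_inj; rewrite uend_valD !fp fE.
Qed.

HB.instance Definition _ := isSuperModule.Build K uend
  uend_par_linear uend_par_par uend_par_sum.

Let uend_par1 : par false (1 : uend) = 1.
Proof.
apply: val_inj; rewrite SubK (@uend_partE _ _ id (fun=> 0)) //.
by apply/funext => v; rewrite addrfctE addr0.
Qed.

Let uend_parM i (f g : uend) :
  par i (f * g) = par false f * par i g + par true f * par (~~ i) g.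
Proof.
have [f0 [f1 [h0 h1 fE fp]]] := uend_parE f.
have [g0 [g1 [e0 e1 gE gp]]] := uend_parE g.
have [l0 _ _] := h0; have [l1 _ _] := h1.
have vM (a b : uend) : val (a * b) = val a \o val b by rewrite [LHS]SubK.
have fp' j : val (par j f) = if j then f1 else f0 := fp j.
have gp' j : val (par j g) = if j then g1 else g0 := gp j.
apply: val_inj; rewrite uend_valD !vM !fp' !gp' [LHS]SubK vM.
rewrite (@uend_partE _ _ (fun v => 1 *: (f0 \o g0) v + (f1 \o g1) v)
   (fun v => 1 *: (f0 \o g1) v + (f1 \o g0) v)).
- by case: i; apply/funext => v /=; rewrite scale1r.
- by apply: hmD; [exact: (hmM h0 e0)|exact: (hmM h1 e1)].
- by apply: hmD; [exact: (hmM h0 e1)|exact: (hmM h1 e0)].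
- apply/funext => v; rewrite fE gE /= !addrfctE /= !scale1r.
  rewrite (linear_semilin l0).1 (linear_semilin l1).1.
  by rewrite [f1 _ + f1 _]addrC addrACA.
Qed.

HB.instance Definition _ :=
  isSuperAlgebra.Build K uend uend_par1 uend_parM.

End Uend.

Section SuperAlgebraNotions.
Variables (K : fieldType) (A : superAlgType K).

Definition even_center (a : A) : Prop :=
  par false a = a /\ forall b, a * b = b * a.

(* k |-> k%:A is injective, so this says that the even center equals K.       *)
Definition central_superalg : Prop :=
  forall a : A, even_center a <-> exists k : K, a = k%:A.

Definition division_superalg : Prop :=
  forall (i : bool) (a : A), par i a = a -> a != 0 ->
    exists b, a * b = 1 /\ b * a = 1.

End SuperAlgebraNotions.

Definition super_quasi_rational (K : fieldType) (G : supergroup K)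
    (V : irrep G) : Prop :=
  central_superalg (uend V) /\ division_superalg (uend V).

(* The carrier for restriction of scalars along phi. *)
Definition restr (K L : fieldType) (phi : {rmorphism K -> L}) (V : Type) :
  Type := V.

Section Restriction.
Variables (K L : fieldType) (phi : {rmorphism K -> L}).

Notation restr := (restr phi).

HB.instance Definition _ (V : lmodType L) := GRing.Zmodule.on (restr V).

Section Lmod.
Variable V : lmodType L.
Definition restr_scale (k : K) (v : restr V) : restr V := phi k *: (v : V).

Let scaleA k k' v : restr_scale k (restr_scale k' v) = restr_scale (k * k') v.
Proof. by rewrite /restr_scale scalerA rmorphM. Qed.
Let scale1 : left_id 1 restr_scale.
Proof. by move=> v; rewrite /restr_scale rmorph1 scale1r. Qed.
Let scaleDr : right_distributive restr_scale +%R.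
Proof. by move=> k u v; apply: scalerDr. Qed.
Let scaleDl v : {morph restr_scale^~ v : k k' / k + k'}.
Proof. by move=> k k'; rewrite /restr_scale rmorphD scalerDl. Qed.

HB.instance Definition _ :=
  GRing.Zmodule_isLmodule.Build K (restr V) scaleA scale1 scaleDr scaleDl.
End Lmod.

Section Super.
Variable V : superModType L.
Definition restr_par (i : bool) : restr V -> restr V := par i : V -> V.

Let restr_par_linear i : linear (restr_par i).
Proof. by move=> k; apply: (par_linear i (phi k)). Qed.

HB.instance Definition _ := isSuperModule.Build K (restr V)
  restr_par_linear (@par_par L V) (@par_sum L V).
End Super.

Lemma restrZ (V : lmodType L) k (v : V) : k *: (v : restr V) = phi k *: v.
Proof. by []. Qed.

End Restriction.

(* Extension of scalars along phi : K -> L, that is L ⊗_K V with L acting on  *)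
(* the left factor.                                                           *)
Section BaseChange.
Variables (K L : fieldType) (phi : {rmorphism K -> L}).

Definition bc (V : lmodType K) : Type := tens (restr phi L^o : lmodType K) V.

Section Lmod.
Variable V : lmodType K.
HB.instance Definition _ := GRing.Zmodule.on (bc V).

Definition bct (l : L) (v : V) : bc V := tpure (l : restr phi L^o) v.

Lemma bct_balanced (U : zmodType) (b : L -> V -> U) :
  (forall l l' v, b (l + l') v = b l v + b l' v) ->
  (forall l v v', b l (v + v') = b l v + b l v') ->
  (forall k l v, b (phi k * l) v = b l (k *: v)) ->
  balanced (b : restr phi L^o -> V -> U).
Proof. by move=> b1 b2 b3; split. Qed.

Lemma bctDl l l' v : bct (l + l') v = bct l v + bct l' v.
Proof. exact: (@tpureDl K (restr phi L^o) V). Qed.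
Lemma bctDr l v v' : bct l (v + v') = bct l v + bct l v'.
Proof. exact: (@tpureDr K (restr phi L^o) V). Qed.
Lemma bctZ k l v : bct (phi k * l) v = bct l (k *: v).
Proof. exact: (@tpureZ K (restr phi L^o) V k l v). Qed.

Lemma bc_scale_balanced (l : L) :
  balanced (fun (m : restr phi L^o) v => bct (l * (m : L)) v).
Proof.
apply: (bct_balanced (b := fun m v => bct (l * m) v)) => [m m' v|m v v'|k m v].
- by rewrite mulrDr bctDl.
- exact: bctDr.
- by rewrite mulrCA bctZ.
Qed.

Definition bc_scale (l : L) (x : bc V) : bc V :=
  tlift (fun (m : restr phi L^o) v => bct (l * (m : L)) v) x.

Lemma bc_scaleE l m v : bc_scale l (bct m v) = bct (l * m) v.
Proof. exact: (tliftE (bc_scale_balanced l)). Qed.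
Lemma bc_scaleD l : {morph bc_scale l : x y / x + y}.
Proof. exact: (tliftD (bc_scale_balanced l)). Qed.

Lemma bc_addext (U : zmodType) (f g : bc V -> U) :
  {morph f : x y / x + y} -> {morph g : x y / x + y} ->
  (forall l v, f (bct l v) = g (bct l v)) -> f =1 g.
Proof. exact: tens_ext. Qed.

Let scaleA l m x : bc_scale l (bc_scale m x) = bc_scale (l * m) x.
Proof.
move: x; apply: bc_addext => [x y|x y|k v]; rewrite ?bc_scaleD //.
by rewrite !bc_scaleE mulrA.
Qed.
Let scale1 : left_id 1 bc_scale.
Proof.
by apply: bc_addext => [x y|x y|k v]; rewrite ?bc_scaleD // bc_scaleE mul1r.
Qed.
Let scaleDr : right_distributive bc_scale +%R.
Proof. exact: bc_scaleD. Qed.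
Let scaleDl x : {morph bc_scale^~ x : l m / l + m}.
Proof.
move=> l m; move: x; apply: bc_addext => [x y|x y|k v]; rewrite ?bc_scaleD //.
  by rewrite addrACA.
by rewrite !bc_scaleE mulrDl bctDl.
Qed.

HB.instance Definition _ :=
  GRing.Zmodule_isLmodule.Build L (bc V) scaleA scale1 scaleDr scaleDl.

Lemma scale_bct l m v : l *: bct m v = bct (l * m) v.
Proof. exact: bc_scaleE. Qed.

Definition bcin (v : V) : bc V := bct 1 v.

Lemma bctE l v : bct l v = l *: bcin v.
Proof. by rewrite scale_bct mulr1. Qed.

Lemma bcin_semilin : semilin phi bcin.
Proof.
split=> [u v|k v]; first exact: bctDr.
by rewrite /bcin -bctZ scale_bct.
Qed.

Lemma bc_ext (U : lmodType L) (f g : bc V -> U) :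
  semilin idfun f -> semilin idfun g ->
  (forall v, f (bcin v) = g (bcin v)) -> f =1 g.
Proof.
move=> [fD fZ] [gD gZ] fg; apply: bc_addext => // l v.
by rewrite bctE fZ gZ fg.
Qed.

End Lmod.

Section Lift.
Variables (M : fieldType) (psi : {rmorphism L -> M}).
Variables (V : lmodType K) (U : lmodType M) (f : V -> U).
(* The psi-semilinear extension l ⊗ v |-> psi(l) f(v). *)
Definition bclift (x : bc V) : U :=
  tlift (fun (l : restr phi L^o) v => psi l *: f v) x.

Hypothesis sf : semilin (psi \o phi) f.

Lemma bclift_balanced :
  balanced (fun (l : restr phi L^o) v => psi l *: f v).
Proof.
apply: (bct_balanced (b := fun l v => psi l *: f v)) => [l l' v|l v v'|k l v].
- by rewrite rmorphD scalerDl.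
- by rewrite sf.1 scalerDr.
- by rewrite sf.2 scalerA -rmorphM mulrC.
Qed.

Lemma bcliftE l v : bclift (bct l v) = psi l *: f v.
Proof. exact: (tliftE bclift_balanced). Qed.
Lemma bclift_in v : bclift (bcin v) = f v.
Proof. by rewrite bcliftE rmorph1 scale1r. Qed.
Lemma bclift_semilin : semilin psi bclift.
Proof.
have bD : {morph bclift : x y / x + y} := tliftD bclift_balanced.
split=> // k; apply: bc_addext => [x y|x y|l v]; rewrite ?scalerDr ?bD //.
  by rewrite scalerDr.
by rewrite scale_bct !bcliftE rmorphM scalerA.
Qed.
End Lift.

Section Super.
Variable V : superModType K.
Definition bc_par (i : bool) : bc V -> bc V :=
  bclift idfun (fun v => bcin (par i v)).

Lemma bc_par_semi i : semilin (idfun \o phi) (fun v : V => bcin (par i v)).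
Proof.
have [pD pZ] := @bcin_semilin V.
by split=> [u v|k v]; rewrite ?parD ?parZ ?pD ?pZ.
Qed.

Let bc_par_linear i : linear (bc_par i).
Proof. exact/semilin_linear/bclift_semilin/bc_par_semi. Qed.

Let bc_par_in i v : bc_par i (bcin v) = bcin (par i v).
Proof. exact/bclift_in/bc_par_semi. Qed.

Let bc_par_par i j x :
  bc_par i (bc_par j x) = if i == j then bc_par j x else 0.
Proof.
have sp k := linear_semilin (bc_par_linear k).
move: x; apply: bc_ext => [||v].
- exact: (semilin_comp (sp j) (sp i)).
- case: eqP => _; first exact: sp.
  by split=> [x y|k x]; rewrite ?addr0 ?scaler0.
- rewrite !bc_par_in par_par; case: eqP => // _.
  exact/addf0/(proj1 (@bcin_semilin V)).
Qed.

Let bc_par_sum x : bc_par false x + bc_par true x = x.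
Proof.
have sp k := linear_semilin (bc_par_linear k).
move: x; apply: bc_ext => [||v]; last 1 first.
- by rewrite !bc_par_in -(bcin_semilin V).1 par_sum.
- split=> [x y|k x]; first by rewrite !(sp _).1 addrACA.
  by rewrite !(sp _).2 scalerDr.
- exact: semilin_id.
Qed.

HB.instance Definition _ := isSuperModule.Build L (bc V)
  bc_par_linear bc_par_par bc_par_sum.

Lemma par_bcin i (v : V) : par i (bcin v) = bcin (par i v).
Proof. exact: bc_par_in. Qed.

End Super.
End BaseChange.

Lemma tlift_tmap (K L : fieldType) (phi : {rmorphism K -> L})
    (V W : lmodType K) (V' W' : lmodType L) (U : zmodType)
    (f : V -> V') (g : W -> W') (b : V' -> W' -> U) :
  semilin phi f -> semilin phi g -> balanced b ->
  forall x, tlift b (tmap f g x) = tlift (fun v w => b (f v) (g w)) x.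
Proof.
move=> sf sg [b1 b2 b3].
have bb : balanced (fun v w => b (f v) (g w)).
  split=> [v v' w|v w w'|k v w]; rewrite ?sf.1 ?sg.1 ?b1 ?b2 //.
  by rewrite sf.2 sg.2 b3.
have bb' : balanced b by [].
apply: tens_ext => [x y|x y|v w].
- by rewrite (tmapD sf sg) tliftD.
- exact: tliftD.
- by rewrite (tmapE sf sg) !tliftE.
Qed.

Lemma tlift_comp (K : fieldType) (V W : lmodType K) (U U' : zmodType)
    (b : V -> W -> U) (h : U -> U') : balanced b -> {morph h : x y / x + y} ->
  forall x, h (tlift b x) = tlift (fun v w => h (b v w)) x.
Proof.
move=> bb hD; have bb' : balanced (fun v w => h (b v w)).
  by case: bb => b1 b2 b3; split=> *; rewrite -?hD ?b1 ?b2 ?b3.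
apply: tens_ext => [x y|x y|v w]; last by rewrite !tliftE.
- by rewrite tliftD.
- exact: tliftD.
Qed.

Lemma eq_tlift (K : fieldType) (V W : lmodType K) (U : zmodType)
  (b b' : V -> W -> U) : b =2 b' -> tlift b =1 tlift b'.
Proof. by move=> bb x; apply: eq_bigr. Qed.

Lemma tmap_tpar (K L : fieldType) (phi : {rmorphism K -> L})
    (V W : superModType K) (V' W' : superModType L)
    (f : V -> V') (g : W -> W') :
  semilin phi f -> semilin phi g ->
  (forall i v, f (par i v) = par i (f v)) ->
  (forall i v, g (par i v) = par i (g v)) ->
  forall i x, tmap f g (tpar i x) = tpar i (tmap f g x).
Proof.
move=> sf sg pf pg i x; rewrite /tpar (tmapD sf sg).
have ps := par_semilin; congr (_ + _);
  rewrite (tmap_comp (ps _ V _) (ps _ W _) sf sg);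
  rewrite (tmap_comp sf sg (ps _ V' _) (ps _ W' _));
  by apply: eq_tmap => v /=; rewrite ?pf ?pg.
Qed.

Lemma tpar_linear (K : fieldType) (V W : superModType K) i :
  linear (@tpar K V W i).
Proof.
have ps := par_semilin.
move=> k x y; rewrite /tpar !(tmap_linear (ps _ V _) (ps _ W _)).
by rewrite scalerDr addrACA.
Qed.

Lemma tmap_tsmul (K L : fieldType) (phi : {rmorphism K -> L})
    (A B : superAlgType K) (A' B' : superAlgType L)
    (f : A -> A') (g : B -> B') :
  semilin phi f -> semilin phi g ->
  (forall i v, f (par i v) = par i (f v)) ->
  (forall i v, g (par i v) = par i (g v)) ->
  {morph f : a b / a * b} -> {morph g : a b / a * b} ->
  forall x y, tmap f g (tsmul x y) = tsmul (tmap f g x) (tmap f g y).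
Proof.
move=> sf sg pf pg fM gM; have tD := tmapD sf sg.
apply: tlift2_ext => [y x x'|x y y'|y x x'|x y y'|a b c d].
- by rewrite tsmulDl tD.
- by rewrite tsmulDr tD.
- by rewrite tD tsmulDl.
- by rewrite tD tsmulDr.
rewrite !(tmapE sf sg) !tsmulE addf_sum //; apply: eq_bigr => i _.
rewrite addf_sum //; apply: eq_bigr => j _.
rewrite (tmap_semilin sf sg).2 (tmapE sf sg) fM gM pf pg.
by rewrite rmorphXn rmorphN1.
Qed.

Section BaseChangeGroup.
Variables (K L : fieldType) (phi : {rmorphism K -> L}) (G : supergroup K).

Definition sgbc_coord : Type := bc phi G.
HB.instance Definition _ := SuperModule.on sgbc_coord.

Local Notation B := sgbc_coord.
Local Notation j := (@bcin K L phi G).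

Let sj : semilin phi j := @bcin_semilin K L phi G.

Let mul_fun (l : restr phi L^o) (a : G) (m : restr phi L^o) (b : G) : B :=
  bct phi ((l : L) * (m : L)) (a * b).

(* (l ⊗ a)(m ⊗ b) = lm ⊗ ab *)
Definition bc_mul (x y : B) : B := tlift2 mul_fun x y.

Let mul_fun1 m b : balanced (fun l a => mul_fun l a m b).
Proof.
apply: (bct_balanced (b := fun l a => mul_fun l a m b)) => [l l' a|l a a'|k l a].
- by rewrite /mul_fun mulrDl bctDl.
- by rewrite /mul_fun mulrDl bctDr.
- by rewrite /mul_fun -mulrA bctZ scalerAl.
Qed.

Let mul_fun2 l a : balanced (mul_fun l a).
Proof.
apply: (bct_balanced (b := mul_fun l a)) => [m m' b|m b b'|k m b].
- by rewrite /mul_fun mulrDr bctDl.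
- by rewrite /mul_fun mulrDr bctDr.
- by rewrite /mul_fun mulrCA bctZ scalerAr.
Qed.

Let bc_mulE l a m b : bc_mul (bct phi l a) (bct phi m b) = bct phi (l * m) (a * b).
Proof. exact: (tlift2E mul_fun1 mul_fun2). Qed.
Let bc_mulDl y : {morph bc_mul^~ y : x x' / x + x'}.
Proof. by move=> x x'; exact: (tlift2Dl mul_fun1 mul_fun2). Qed.
Let bc_mulDr x : {morph bc_mul x : y y' / y + y'}.
Proof. by move=> y y'; exact: (tlift2Dr mul_fun1 mul_fun2). Qed.

Let mulA : associative bc_mul.
Proof.
move=> x y z; move: x.
apply: bc_addext => [x x'|x x'|l a]; rewrite ?bc_mulDl //.
move: y; apply: bc_addext => [y y'|y y'|m b]; rewrite ?(bc_mulDl, bc_mulDr) //.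
move: z; apply: bc_addext => [z z'|z z'|n c]; rewrite ?bc_mulDr //.
by rewrite !bc_mulE !mulrA.
Qed.

Let mul1 : left_id (j 1) bc_mul.
Proof.
apply: bc_addext => [x y|//|l a]; first by rewrite bc_mulDr.
by rewrite bc_mulE !mul1r.
Qed.

Let bmulr1 : right_id (j 1) bc_mul.
Proof.
apply: bc_addext => [x y|//|l a]; first by rewrite bc_mulDl.
by rewrite bc_mulE !mulr1.
Qed.

Let eps_fun (a : G) : L^o := phi (counit a).

Let eps_semi : semilin (idfun \o phi) eps_fun.
Proof.
split=> [a b|k a]; rewrite /eps_fun; first by rewrite linearD rmorphD.
by rewrite linearZ rmorphM.
Qed.

Definition bc_counit : B -> L := bclift idfun eps_fun.

Let bc_counit_semi : semilin idfun (bc_counit : B -> L^o).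
Proof. exact: bclift_semilin eps_semi. Qed.

Let bc_counit_in a : bc_counit (j a) = phi (counit a).
Proof. exact: bclift_in eps_semi _. Qed.

Let one_neq0 : j 1 != 0 :> B.
Proof.
apply/eqP => /(congr1 bc_counit); rewrite bc_counit_in counit1 rmorph1.
by rewrite (addf0 bc_counit_semi.1); apply/eqP/oner_neq0.
Qed.

HB.instance Definition _ := GRing.Zmodule_isNzRing.Build B
  mulA mul1 bmulr1 (fun x y z => bc_mulDl z x y) bc_mulDr one_neq0.

Let bmE l a m b : (bct phi l a : B) * (bct phi m b : B) = bct phi (l * m) (a * b).
Proof. exact: bc_mulE. Qed.
Let bsE k l a : k *: (bct phi l a : B) = bct phi (k * l) a.
Proof. exact: scale_bct. Qed.

Let scaleAl (k : L) (x y : B) : k *: (x * y) = (k *: x) * y.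
Proof.
move: x; apply: bc_addext => [x x'|x x'|l a].
- by rewrite mulrDl scalerDr.
- by rewrite scalerDr mulrDl.
move: y; apply: bc_addext => [y y'|y y'|m b].
- by rewrite mulrDr scalerDr.
- by rewrite mulrDr.
by rewrite bsE !bmE bsE mulrA.
Qed.
HB.instance Definition _ := GRing.Lmodule_isLalgebra.Build L B scaleAl.

Let scaleAr (k : L) (x y : B) : k *: (x * y) = x * (k *: y).
Proof.
move: x; apply: bc_addext => [x x'|x x'|l a].
- by rewrite mulrDl scalerDr.
- by rewrite mulrDl.
move: y; apply: bc_addext => [y y'|y y'|m b].
- by rewrite mulrDr scalerDr.
- by rewrite scalerDr mulrDr.
by rewrite bsE !bmE bsE mulrCA.
Qed.
HB.instance Definition _ := GRing.Lalgebra_isAlgebra.Build L B scaleAr.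

Let jM : {morph (j : G -> B) : a b / a * b}.
Proof. by move=> a b; rewrite [RHS]bc_mulE mulr1. Qed.
Let j1 : (j 1 : B) = 1. Proof. by []. Qed.
Let jD : {morph (j : G -> B) : a b / a + b}. Proof. exact: sj.1. Qed.
Let parj i a : par i (j a : B) = j (par i a).
Proof. exact: par_bcin. Qed.

Let pj i a : j (par i a) = par i (j a : B). Proof. by rewrite parj. Qed.

Let mul_semil (y : B) : semilin idfun (fun x : B => x * y).
Proof. by split=> [x x'|k x]; rewrite ?mulrDl // scalerAl. Qed.
Let mul_semir (x : B) : semilin idfun (fun y : B => x * y).
Proof. by split=> [y y'|k y]; rewrite ?mulrDr // scalerAr. Qed.

Let semi_add (V W : lmodType L) (f g : V -> W) :
  semilin idfun f -> semilin idfun g -> semilin idfun (fun x => f x + g x).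
Proof.
move=> [fD fZ] [gD gZ]; split=> [x y|k x].
  by rewrite fD gD addrACA.
by rewrite fZ gZ scalerDr.
Qed.
Let semi_scale (V W : lmodType L) c (f : V -> W) :
  semilin idfun f -> semilin idfun (fun x => c *: f x).
Proof.
move=> [fD fZ]; split=> [x y|k x]; first by rewrite fD scalerDr.
by rewrite fZ !scalerA mulrC.
Qed.
Let ps i : semilin idfun (par i : B -> B) := par_semilin B i.

Let bc_parM i (x y : B) :
  par i (x * y) = par false x * par i y + par true x * par (~~ i) y.
Proof.
move: x; apply: bc_ext => [||a].
- exact: (semilin_comp (mul_semil y) (ps i)).
- by apply: semi_add;
    [exact: (semilin_comp (ps _) (mul_semil _))|exact: (semilin_comp (ps _) (mul_semil _))].
move: y; apply: bc_ext => [||b].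
- exact: (semilin_comp (mul_semir (j a)) (ps i)).
- by apply: semi_add;
    [exact: (semilin_comp (ps _) (mul_semir _))|exact: (semilin_comp (ps _) (mul_semir _))].
by rewrite -jM !parj -!jM -jD parM.
Qed.

Let bc_par1 : par false (1 : B) = 1.
Proof. by rewrite -j1 parj par1. Qed.

HB.instance Definition _ := isSuperAlgebra.Build L B bc_par1 bc_parM.

Let bc_comm (i k : bool) (x y : B) :
  par i x * par k y = (-1) ^+ (i && k) *: (par k y * par i x).
Proof.
move: x; apply: bc_ext => [||a].
- exact: (semilin_comp (ps i) (mul_semil _)).
- by apply: semi_scale; exact: (semilin_comp (ps i) (mul_semir _)).
move: y; apply: bc_ext => [||b].
- exact: (semilin_comp (ps k) (mul_semir _)).
- by apply: semi_scale; exact: (semilin_comp (ps k) (mul_semil _)).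
by rewrite !parj -!jM coord_comm sj.2 rmorphXn rmorphN1.
Qed.

Let sjj : semilin phi (tmap (j : G -> B) (j : G -> B)).
Proof. exact: tmap_semilin. Qed.

Definition bc_comul : B -> tens B B :=
  bclift idfun (fun a => tmap (j : G -> B) (j : G -> B) (comul a)).

Let com_semi :
  semilin (idfun \o phi) (fun a : G => tmap (j : G -> B) (j : G -> B) (comul a)).
Proof. exact: (semilin_comp (lin_semilin comul) sjj). Qed.

Let bc_comul_semi : semilin idfun bc_comul.
Proof. exact: bclift_semilin com_semi. Qed.
Let bc_comul_in a : bc_comul (j a) = tmap (j : G -> B) (j : G -> B) (comul a).
Proof. exact: bclift_in com_semi _. Qed.

Definition bc_antip : B -> B := bclift idfun (fun a => j (antip a)).
Let ant_semi : semilin (idfun \o phi) (fun a : G => j (antip a)).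
Proof. exact: (semilin_comp (lin_semilin antip) sj). Qed.
Let bc_antip_semi : semilin idfun bc_antip.
Proof. exact: bclift_semilin ant_semi. Qed.
Let bc_antip_in a : bc_antip (j a) = j (antip a).
Proof. exact: bclift_in ant_semi _. Qed.

Let comul_lin := mklin (semilin_linear bc_comul_semi).
Let counit_lin := mkscalar (semilin_linear bc_counit_semi).
Let antip_lin := mklin (semilin_linear bc_antip_semi).
Let sid (V : lmodType L) := @semilin_id L V.

Let bc_comul_par i (x : B) : comul_lin (par i x) = tpar i (comul_lin x).
Proof.
move: x; apply: bc_ext => [||a].
- exact: (semilin_comp (ps i) bc_comul_semi).
- exact: (semilin_comp bc_comul_semi (linear_semilin (@tpar_linear L B B i))).
rewrite parj [LHS]bc_comul_in /= bc_comul_in comul_par.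
exact: (@tmap_tpar K L phi G G B B j j sj sj pj pj).
Qed.

Let bc_comul1 : comul_lin 1 = 1 ⊗ 1.
Proof. by rewrite -j1 [LHS]bc_comul_in comul1 (tmapE sj sj). Qed.

Let tsm_l (y : tens B B) : semilin idfun (fun x => tsmul x y).
Proof. by split=> [x x'|k x]; [apply: tsmulDl|rewrite tsmulZl]. Qed.
Let tsm_r (x : tens B B) : semilin idfun (fun y => tsmul x y).
Proof. by split=> [y y'|k y]; [apply: tsmulDr|rewrite tsmulZr]. Qed.

Let bc_comulM (x y : B) : comul_lin (x * y) = tsmul (comul_lin x) (comul_lin y).
Proof.
move: x; apply: bc_ext => [||a].
- exact: (semilin_comp (mul_semil _) bc_comul_semi).
- exact: (semilin_comp bc_comul_semi (tsm_l _)).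
move: y; apply: bc_ext => [||b].
- exact: (semilin_comp (mul_semir _) bc_comul_semi).
- exact: (semilin_comp bc_comul_semi (tsm_r _)).
rewrite -jM /= !bc_comul_in comulM.
exact: (@tmap_tsmul K L phi G G B B j j sj sj pj pj jM jM).
Qed.

Let bc_counit_par (x : B) : counit_lin (par true x) = 0.
Proof.
move: x; apply: (@bc_ext _ _ _ _ L^o) => [||a].
- exact: (semilin_comp (ps true) bc_counit_semi).
- by split=> [x y|k x]; rewrite ?addr0 ?scaler0.
by rewrite parj [LHS]bc_counit_in counit_par rmorph0.
Qed.

Let bc_counit1 : counit_lin 1 = 1.
Proof. by rewrite -j1 [LHS]bc_counit_in counit1 rmorph1. Qed.

Let bc_counitM (x y : B) : counit_lin (x * y) = counit_lin x * counit_lin y.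
Proof.
move: x; apply: (@bc_ext _ _ _ _ L^o) => [||a].
- exact: (semilin_comp (mul_semil _) bc_counit_semi).
- split=> [x x'|k x]; first by rewrite linearD mulrDl.
  by rewrite linearZ /= -mulrA.
move: y; apply: (@bc_ext _ _ _ _ L^o) => [||b].
- exact: (semilin_comp (mul_semir _) bc_counit_semi).
- split=> [y y'|k y]; first by rewrite linearD mulrDr.
  by rewrite linearZ /= mulrCA.
by rewrite -jM /= !bc_counit_in counitM rmorphM.
Qed.

Let bc_antip_par i (x : B) : antip_lin (par i x) = par i (antip_lin x).
Proof.
move: x; apply: bc_ext => [||a].
- exact: (semilin_comp (ps i) bc_antip_semi).
- exact: (semilin_comp bc_antip_semi (ps i)).
by rewrite parj /= !bc_antip_in antip_par parj.
Qed.

Let tassoc_semi (U V W : lmodType L) : semilin idfun (@tassoc L U V W).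
Proof.
split=> [|k]; first exact: tassocD.
apply: tassoc_ext => [x y|x y|u v w].
- by rewrite scalerDr tassocD.
- by rewrite tassocD scalerDr.
- by rewrite scale_tpure !tassocE !scale_tpure.
Qed.

Let bc_comulA (x : B) :
  tassoc (tmap id comul_lin (comul_lin x)) = tmap comul_lin id (comul_lin x).
Proof.
have sc := lin_semilin (@comul K G); have si := @semilin_id K G.
move: x; apply: bc_ext => [||a].
- exact: (semilin_comp bc_comul_semi
           (semilin_comp (tmap_semilin (sid _) bc_comul_semi) (tassoc_semi _ _ _))).
- exact: (semilin_comp bc_comul_semi (tmap_semilin bc_comul_semi (sid _))).
rewrite /= bc_comul_in (tmap_comp sj sj (sid _) bc_comul_semi).
rewrite (tmap_comp sj sj bc_comul_semi (sid _)).
rewrite (@eq_tmap _ _ _ _ _ _ _ (j \o id) _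
  (tmap (j : G -> B) (j : G -> B) \o comul)) //.
rewrite -(tmap_comp si sc sj sjj) -(tmap_tassoc sj sj sj) comulA.
rewrite (tmap_comp sc si sjj sj); apply: eq_tmap => // b.
by rewrite /= bc_comul_in.
Qed.

Let scal_bal (V : lmodType L) : balanced (fun (x : B) (y : V) => counit_lin x *: y).
Proof.
split=> [x x' y|x y y'|k x y]; rewrite ?linearD ?scalerDl ?scalerDr //.
by rewrite linearZ /= scalerA mulrC.
Qed.
Let scal_balr (V : lmodType L) : balanced (fun (x : V) (y : B) => counit_lin y *: x).
Proof.
split=> [x x' y|x y y'|k x y]; rewrite ?scalerDr //.
  by rewrite linearD scalerDl.
by rewrite [counit_lin (k *: y)]linearZ /= scalerA mulrC.
Qed.
Let scalG_bal : balanced (fun (x y : G) => counit x *: y).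
Proof.
split=> [x x' y|x y y'|k x y]; rewrite ?scalerDr //.
  by rewrite linearD scalerDl.
by rewrite linearZ /= scalerA mulrC.
Qed.
Let scalG_balr : balanced (fun (x y : G) => counit y *: x).
Proof.
split=> [x x' y|x y y'|k x y]; rewrite ?scalerDr //.
  by rewrite linearD scalerDl.
by rewrite [counit (k *: y)]linearZ /= scalerA mulrC.
Qed.

Let tl_semi (U : lmodType L) (b : B -> B -> U) : balanced b ->
  (forall k v w, b (k *: v) w = k *: b v w) ->
  semilin idfun (fun x => tlift b (comul_lin x)).
Proof.
move=> bb bZ; have tb := linear_semilin (tlift_linear bb bZ).
exact: (semilin_comp bc_comul_semi tb).
Qed.

Let bc_counitl (x : B) : tlift (fun x y => counit_lin x *: y) (comul_lin x) = x.
Proof.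
move: x; apply: bc_ext => [||a]; last 1 first.
- rewrite /= bc_comul_in (tlift_tmap sj sj (scal_bal _)).
  rewrite -[in RHS](counitl a) (tlift_comp scalG_bal jD).
  by apply: eq_tlift => x y; rewrite /= bc_counit_in sj.2.
- apply: tl_semi.
    exact: scal_bal.
  by move=> k x y; rewrite linearZ scalerA.
- exact: sid.
Qed.

Let bc_counitr (x : B) : tlift (fun x y => counit_lin y *: x) (comul_lin x) = x.
Proof.
move: x; apply: bc_ext => [||a]; last 1 first.
- rewrite /= bc_comul_in (tlift_tmap sj sj (scal_balr _)).
  rewrite -[in RHS](counitr a) (tlift_comp scalG_balr jD).
  by apply: eq_tlift => x y; rewrite /= bc_counit_in sj.2.
- apply: tl_semi.
    exact: scal_balr.
  by move=> k x y; rewrite !scalerA mulrC.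
- exact: sid.
Qed.

Let ant_ball : balanced (fun x y : B => antip_lin x * y).
Proof.
split=> [x x' y|x y y'|k x y]; rewrite ?linearD ?mulrDl ?mulrDr //.
by rewrite linearZ -scalerAl scalerAr.
Qed.
Let ant_balr : balanced (fun x y : B => x * antip_lin y).
Proof.
split=> [x x' y|x y y'|k x y]; rewrite ?linearD ?mulrDl ?mulrDr //.
by rewrite linearZ -scalerAl scalerAr.
Qed.
Let antG_ball : balanced (fun x y : G => antip x * y).
Proof.
split=> [x x' y|x y y'|k x y]; rewrite ?linearD ?mulrDl ?mulrDr //.
by rewrite linearZ -scalerAl scalerAr.
Qed.
Let antG_balr : balanced (fun x y : G => x * antip y).
Proof.
split=> [x x' y|x y y'|k x y]; rewrite ?linearD ?mulrDl ?mulrDr //.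
by rewrite linearZ -scalerAl scalerAr.
Qed.

Let unit_semi : semilin idfun (fun x : B => (counit_lin x)%:A : B).
Proof.
by split=> [x y|k x]; rewrite ?linearD ?scalerDl // linearZ /= scalerA.
Qed.

Let bc_antipl (x : B) :
  tlift (fun x y => antip_lin x * y) (comul_lin x) = (counit_lin x)%:A.
Proof.
move: x; apply: bc_ext => [||a]; last 1 first.
- rewrite /= bc_comul_in (tlift_tmap sj sj ant_ball) bc_counit_in.
  rewrite -j1 -sj.2 -antipl (tlift_comp antG_ball jD).
  by apply: eq_tlift => x y; rewrite /= bc_antip_in jM.
- apply: tl_semi.
    exact: ant_ball.
  by move=> k x y; rewrite linearZ scalerAl.
- exact: unit_semi.
Qed.

Let bc_antipr (x : B) :
  tlift (fun x y => x * antip_lin y) (comul_lin x) = (counit_lin x)%:A.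
Proof.
move: x; apply: bc_ext => [||a]; last 1 first.
- rewrite /= bc_comul_in (tlift_tmap sj sj ant_balr) bc_counit_in.
  rewrite -j1 -sj.2 -antipr (tlift_comp antG_balr jD).
  by apply: eq_tlift => x y; rewrite /= bc_antip_in jM.
- apply: tl_semi.
    exact: ant_balr.
  by move=> k x y; rewrite scalerAl.
- exact: unit_semi.
Qed.

(* The base change of G along phi; its coordinate algebra is L ⊗_K K[G].      *)
Definition sgbc : supergroup L :=
  @SuperGroup L sgbc_coord bc_comm comul_lin counit_lin antip_lin
    bc_comul_par bc_comul1 bc_comulM bc_counit_par bc_counit1 bc_counitM
    bc_antip_par bc_comulA bc_counitl bc_counitr bc_antipl bc_antipr.

Lemma sgbc_comulE (a : G) :
  @comul L sgbc (j a) = tmap (j : G -> sgbc) (j : G -> sgbc) (comul a).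
Proof. exact: bc_comul_in. Qed.
Lemma sgbc_counitE (a : G) : @counit L sgbc (j a) = phi (counit a).
Proof. exact: bc_counit_in. Qed.

End BaseChangeGroup.

Lemma scale_swap (K : fieldType) (V : lmodType K) (k l : K) (v : V) :
  l *: (k *: v) = k *: (l *: v).
Proof. by rewrite !scalerA mulrC. Qed.

Lemma bc_ext_semi (K L M : fieldType) (phi : {rmorphism K -> L})
    (psi : {rmorphism L -> M}) (V : lmodType K) (U : lmodType M)
    (f g : bc phi V -> U) :
  semilin psi f -> semilin psi g ->
  (forall v, f (bcin phi v) = g (bcin phi v)) -> f =1 g.
Proof.
move=> [fD fZ] [gD gZ] fg; apply: bc_addext => // l v.
by rewrite bctE fZ gZ fg.
Qed.

(* A phi-semilinear morphism of supercoalgebras K[G] -> L[H], along which     *)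
(* representations of G can be base changed to representations of H.          *)
Record sgmor (K L : fieldType) (phi : {rmorphism K -> L}) (G : supergroup K)
    (H : supergroup L) := SgMor {
  sgm :> G -> H;
  sgm_semilin : semilin phi sgm;
  sgm_par : forall i a, sgm (par i a) = par i (sgm a);
  sgm_comul : forall a, comul (sgm a) = tmap sgm sgm (comul a);
  sgm_counit : forall a, counit (sgm a) = phi (counit a)
}.

Definition sgbc_in (K L : fieldType) (phi : {rmorphism K -> L})
    (G : supergroup K) : sgmor phi G (sgbc phi G) :=
  @SgMor K L phi G (sgbc phi G) (@bcin K L phi G) (@bcin_semilin K L phi G)
    (fun i a => esym (@par_bcin K L phi G i a))
    (@sgbc_comulE K L phi G) (@sgbc_counitE K L phi G).

(* The map e ⊗ a |-> psi(e) ⊗ a from E ⊗_K K[G] to L ⊗_K K[G], for a          *)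
(* morphism psi : E -> L of extensions of K.                                  *)
Section BaseChangeMap.
Variables (K E L : fieldType) (phi1 : {rmorphism K -> E}).
Variables (phi2 : {rmorphism K -> L}) (psi : {rmorphism E -> L}).
Hypothesis phiE : forall k, psi (phi1 k) = phi2 k.
Variable G : supergroup K.

Let B1 := sgbc phi1 G.
Let B2 := sgbc phi2 G.
Let j1 : G -> B1 := @bcin K E phi1 G.
Let j2 : G -> B2 := @bcin K L phi2 G.
Let sj1 : semilin phi1 j1 := @bcin_semilin K E phi1 G.
Let sj2 : semilin phi2 j2 := @bcin_semilin K L phi2 G.

Definition bcmap : B1 -> B2 := @bclift K E phi1 L psi G B2 j2.

Let sj2' : semilin (psi \o phi1) j2.
Proof. by split=> [a b|k a]; rewrite ?sj2.1 // sj2.2 /= phiE. Qed.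
Let bcmap_semi : semilin psi bcmap.
Proof. exact: (bclift_semilin sj2'). Qed.
Let bcmap_in a : bcmap (j1 a) = j2 a.
Proof. exact: (bclift_in sj2'). Qed.

Let bcmap_par i (x : B1) : bcmap (par i x) = par i (bcmap x).
Proof.
move: x; apply: (bc_ext_semi (psi := psi)) => [||a].
- exact: (semilin_comp (par_semilin B1 i) bcmap_semi).
- exact: (semilin_comp bcmap_semi (par_semilin B2 i)).
by rewrite par_bcin !bcmap_in [RHS]par_bcin.
Qed.

Let bcmap_comul (x : B1) : comul (bcmap x) = tmap bcmap bcmap (comul x).
Proof.
move: x; apply: (bc_ext_semi (psi := psi)) => [||a].
- exact: (semilin_comp bcmap_semi (lin_semilin comul)).
- exact: (semilin_comp (lin_semilin (@comul E B1))
                       (tmap_semilin bcmap_semi bcmap_semi)).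
rewrite bcmap_in !sgbc_comulE (tmap_comp sj1 sj1 bcmap_semi bcmap_semi).
by apply: eq_tmap => b /=; rewrite bcmap_in.
Qed.

Let bcmap_counit (x : B1) : counit (bcmap x) = psi (counit x).
Proof.
move: x; apply: (@bc_ext_semi _ _ _ _ psi _ L^o) => [||a].
- by split=> [x y|k x]; rewrite ?bcmap_semi.1 ?bcmap_semi.2 ?linearD ?linearZ.
- by split=> [x y|k x]; rewrite ?linearD ?linearZ ?rmorphD ?rmorphM.
by rewrite bcmap_in !sgbc_counitE phiE.
Qed.

Definition sgbc_map : sgmor psi B1 B2 :=
  SgMor bcmap_semi bcmap_par bcmap_comul bcmap_counit.

End BaseChangeMap.

(* The base change of V along j: the coaction of L ⊗_K V sends 1 ⊗ v to the   *)
(* image of coact v.                                                          *)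
Section RepBaseChange.
Variables (K L : fieldType) (phi : {rmorphism K -> L}).
Variables (G : supergroup K) (H : supergroup L) (j : sgmor phi G H).
Variable V : rep G.

Let W := bc phi V.
Let i : V -> W := @bcin K L phi V.
Let si : semilin phi i := @bcin_semilin K L phi V.
Let sj : semilin phi j := sgm_semilin j.
Let sid (U : lmodType L) := @semilin_id L U.

Definition bc_coact : W -> tens W H :=
  bclift idfun (fun v => tmap i j (coact v)).

Let co_semi : semilin (idfun \o phi) (fun v : V => tmap i j (coact v)).
Proof. exact: (semilin_comp (lin_semilin coact) (tmap_semilin si sj)). Qed.
Let bc_coact_semi : semilin idfun bc_coact.
Proof. exact: bclift_semilin co_semi. Qed.
Let bc_coact_in v : bc_coact (i v) = tmap i j (coact v).
Proof. exact: bclift_in co_semi _. Qed.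

Let coact_lin := mklin (semilin_linear bc_coact_semi).

Let pi k v : i (par k v) = par k (i v).
Proof. by rewrite [RHS]par_bcin. Qed.

Let bc_coact_par k (x : W) : coact_lin (par k x) = tpar k (coact_lin x).
Proof.
move: x; apply: bc_ext => [||v].
- exact: (semilin_comp (par_semilin W k) bc_coact_semi).
- exact: (semilin_comp bc_coact_semi (linear_semilin (@tpar_linear L W H k))).
rewrite par_bcin /= !bc_coact_in coact_par.
exact: (@tmap_tpar K L phi V G W H i j si sj pi (sgm_par j)).
Qed.

Let tassoc_semi (U1 U2 U3 : lmodType L) : semilin idfun (@tassoc L U1 U2 U3).
Proof.
split=> [|k]; first exact: tassocD.
apply: tassoc_ext => [x y|x y|u v w].
- by rewrite scalerDr tassocD.
- by rewrite tassocD scalerDr.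
- by rewrite scale_tpure !tassocE !scale_tpure.
Qed.

Let bc_coactA (x : W) :
  tassoc (tmap id comul (coact_lin x)) = tmap coact_lin id (coact_lin x).
Proof.
have sc := lin_semilin (@comul K G); have scH := lin_semilin (@comul L H).
have sk (U : lmodType K) := @semilin_id K U.
have sr := lin_semilin (@coact K G V).
have sjj := tmap_semilin sj sj; have sij := tmap_semilin si sj.
move: x; apply: bc_ext => [||v].
- exact: (semilin_comp bc_coact_semi
           (semilin_comp (tmap_semilin (sid W) scH) (tassoc_semi _ _ _))).
- exact: (semilin_comp bc_coact_semi (tmap_semilin bc_coact_semi (sid _))).
rewrite /= bc_coact_in (tmap_comp si sj (sid _) scH).
rewrite (tmap_comp si sj bc_coact_semi (sid _)).
rewrite (@eq_tmap _ _ _ _ _ _ _ (i \o id) _ (tmap j j \o comul)) //; last first.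
  exact: sgm_comul.
rewrite -(tmap_comp (sk _) sc si sjj) -(tmap_tassoc si sj sj) coactA.
rewrite (tmap_comp sr (sk _) sij sj); apply: eq_tmap => // b.
by rewrite /= bc_coact_in.
Qed.

Let bc_coact_counit (x : W) :
  tlift (fun w a => counit a *: w) (coact_lin x) = x.
Proof.
have bH : balanced (fun (w : W) (a : H) => counit a *: w).
  split=> [w w' a|w a a'|k w a]; rewrite ?scalerDr //.
    by rewrite linearD scalerDl.
  by rewrite [counit (k *: a)]linearZ /= scalerA mulrC.
have bG : balanced (fun (w : V) (a : G) => counit a *: w).
  split=> [w w' a|w a a'|k w a]; rewrite ?scalerDr //.
    by rewrite linearD scalerDl.
  by rewrite [counit (k *: a)]linearZ /= scalerA mulrC.
move: x; apply: bc_ext => [||v]; last 1 first.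
- rewrite /= bc_coact_in (tlift_tmap si sj bH).
  rewrite -[in RHS](coact_counit v) [RHS](tlift_comp bG si.1).
  by apply: eq_tlift => w a; rewrite /= sgm_counit si.2.
- have tb := linear_semilin (tlift_linear bH
    (fun k w a => scale_swap k (counit a) w)).
  exact: (semilin_comp bc_coact_semi tb).
- exact: sid.
Qed.

Definition rep_bc : rep H :=
  @Rep L H W coact_lin bc_coact_par bc_coactA bc_coact_counit.

End RepBaseChange.

(* Restriction of scalars of a representation W of the base change of G: the  *)
(* coaction is that of W followed by W ⊗_L (L ⊗_K K[G]) = W ⊗_K K[G].         *)
Section RepRestriction.
Variables (K L : fieldType) (phi : {rmorphism K -> L}) (G : supergroup K).
Variable W : rep (sgbc phi G).

Let R := restr phi W.
Let B := sgbc phi G.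
Let j : G -> B := @bcin K L phi G.
Let sj : semilin phi j := @bcin_semilin K L phi G.
Let sid (U : lmodType K) := @semilin_id K U.

(* w ⊗ (l ⊗ a) |-> lw ⊗ a *)
Definition collapse (U : lmodType L) (x : tens U B) :
    tens (restr phi U : lmodType K) G :=
  tlift (fun (w : U) (b : B) =>
    tlift (fun (l : restr phi L^o) (a : G) =>
      ((l : L) *: w : restr phi U) ⊗ a) b) x.

Let bsE k l (a : G) : k *: (bct phi l a : B) = bct phi (k * l) a.
Proof. exact: scale_bct. Qed.

Let col1 (U : lmodType L) (w : U) :
  balanced (fun (l : restr phi L^o) (a : G) => ((l : L) *: w : restr phi U) ⊗ a).
Proof.
split=> [l l' a|l a a'|k l a].
- by rewrite scalerDl [LHS]tpureDl.
- exact: tpureDr.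
- by rewrite -tpureZ; congr (_ ⊗ _); rewrite [RHS]scalerA.
Qed.

Let col2 (U : lmodType L) : balanced (fun (w : U) (b : B) =>
    tlift (fun (l : restr phi L^o) (a : G) =>
      ((l : L) *: w : restr phi U) ⊗ a) b).
Proof.
split=> [w w' b|w b b'|k w b].
- move: b; apply: bc_addext => [x y|x y|l a]; first exact: tliftD (col1 _) _ _.
    by rewrite !(tliftD (col1 _)) addrACA.
  by rewrite !(tliftE (col1 _)) scalerDr [LHS]tpureDl.
- exact: tliftD (col1 _) _ _.
- move: b; apply: bc_addext => [x y|x y|l a]; first exact: tliftD (col1 _) _ _.
    by rewrite scalerDr (tliftD (col1 _)).
  by rewrite bsE !(tliftE (col1 _)) scalerA mulrC.
Qed.

Let collapseD (U : lmodType L) : {morph @collapse U : x y / x + y}.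
Proof. exact: tliftD (col2 _). Qed.
Let collapseE (U : lmodType L) (w : U) l a :
  collapse (w ⊗ (bct phi l a : B)) = (l *: w : restr phi U) ⊗ a.
Proof. by rewrite /collapse (tliftE (col2 _)) (tliftE (col1 _)). Qed.

Let collapse_semi (U : lmodType L) k (x : tens U B) :
  collapse (phi k *: x) = k *: collapse x.
Proof.
move: x; apply: tens_ext => [x y|x y|w b].
- by rewrite scalerDr collapseD.
- by rewrite collapseD scalerDr.
move: b; apply: bc_addext => [b b'|b b'|l a].
- by rewrite tpureDr scalerDr collapseD.
- by rewrite tpureDr collapseD scalerDr.
by rewrite !scale_tpure !collapseE scale_tpure restrZ !scalerA mulrC.
Qed.

Definition res_coact (w : R) : tens R G := collapse (coact (w : W)).

Let res_linear : linear res_coact.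
Proof.
move=> k u v; rewrite /res_coact restrZ.
by rewrite linearP collapseD collapse_semi.
Qed.

Let res_lin := mklin res_linear.

Let tens_bc_ext (U : lmodType L) (T : zmodType) (f g : tens U B -> T) :
  {morph f : x y / x + y} -> {morph g : x y / x + y} ->
  (forall w l a, f (w ⊗ (bct phi l a : B)) = g (w ⊗ (bct phi l a : B))) ->
  f =1 g.
Proof.
move=> fD gD fg; apply: tens_ext => // w.
by apply: bc_addext => [b b'|b b'|l a]; rewrite ?tpureDr ?fD ?gD.
Qed.

Let collapse_tpar k (x : tens W B) : collapse (tpar k x) = tpar k (collapse x).
Proof.
have ps := par_semilin.
have tL : {morph @tpar L W B k : u v / u + v}.
  exact: (linear_semilin (@tpar_linear L W B k)).1.
have tK : {morph @tpar K R G k : u v / u + v}.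
  exact: (linear_semilin (@tpar_linear K R G k)).1.
move: x; apply: tens_bc_ext => [x y|x y|w l a].
- by rewrite tL collapseD.
- by rewrite collapseD tK.
rewrite collapseE /tpar !(tmapE (ps _ W _) (ps _ B _)) !(tmapE (ps _ R _) (ps _ G _)).
have pb i : par i (bct phi l a : B) = bct phi l (par i a).
  by rewrite bctE [LHS]parZ [par i _]par_bcin -bctE.
by rewrite !pb collapseD !collapseE -!parZ.
Qed.

Let res_par i (w : R) : res_lin (par i w) = tpar i (res_lin w).
Proof. by rewrite /= /res_coact -collapse_tpar -coact_par. Qed.

Let res_coactA (w : R) :
  tassoc (tmap id comul (res_lin w)) = tmap res_lin id (res_lin w).
Proof.
have sB (U : lmodType L) := @semilin_id L U.
have sc := lin_semilin (@comul K G); have scB := lin_semilin (@comul L B).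
have sr := lin_semilin (@coact L B W); have sres := linear_semilin res_linear.
(* (u ⊗ b) ⊗ (l ⊗ a) |-> collapse (l (u ⊗ b)) ⊗ a *)
pose c1 (t : tens W B) (l : restr phi L^o) (a : G) : tens (tens R G) G :=
  collapse ((l : L) *: t) ⊗ a.
have c1b t : balanced (c1 t).
  split=> [l l' a|l a a'|k l a].
  - by rewrite /c1 scalerDl collapseD tpureDl.
  - exact: tpureDr.
  - by rewrite -[RHS]tpureZ /c1 -collapse_semi scalerA.
pose c2 (t : tens W B) (b : B) := tlift (c1 t) b.
have c2b : balanced c2.
  split=> [t t' b|t b b'|k t b].
  - move: b; apply: bc_addext => [x y|x y|l a]; first exact: tliftD (c1b _) _ _.
      by rewrite /c2 !(tliftD (c1b _)) addrACA.
    by rewrite /c2 !(tliftE (c1b _)) /c1 scalerDr collapseD tpureDl.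
  - exact: tliftD (c1b _) _ _.
  - move: b; apply: bc_addext => [x y|x y|l a]; first exact: tliftD (c1b _) _ _.
      by rewrite /c2 scalerDr (tliftD (c1b _)).
    by rewrite bsE /c2 !(tliftE (c1b _)) /c1 scalerA mulrC.
pose c (x : tens (tens W B) B) := tlift c2 x.
have cD : {morph c : x y / x + y} := tliftD c2b.
have cE t l a : c (t ⊗ (bct phi l a : B)) = collapse (l *: t) ⊗ a.
  by rewrite /c (tliftE c2b) /c2 (tliftE (c1b t)).
have lhs (x : tens W B) :
    c (tassoc (tmap id comul x)) = tassoc (tmap id comul (collapse x)).
  have tD1 := tmapD (sB W) scB; have tD2 := tmapD (sid R) sc.
  move: x; apply: tens_bc_ext => [x y|x y|u l a].
  - by rewrite tD1 tassocD cD.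
  - by rewrite collapseD tD2 tassocD.
  rewrite collapseE (tmapE (sB W) scB) (tmapE (sid R) sc).
  rewrite bctE linearZ [comul _]sgbc_comulE -tpureZ.
  move: (comul a); apply: tens_ext => [x y|x y|a1 a2].
  - by rewrite (tmapD sj sj) tpureDr tassocD cD.
  - by rewrite tpureDr tassocD.
  by rewrite (tmapE sj sj) !tassocE cE scale1r collapseE scale1r.
have rhs (x : tens W B) : c (tmap coact id x) = tmap res_lin id (collapse x).
  have tD1 := tmapD sr (sB B); have tD2 := tmapD sres (sid G).
  move: x; apply: tens_bc_ext => [x y|x y|u l a].
  - by rewrite tD1 cD.
  - by rewrite collapseD tD2.
  rewrite collapseE (tmapE sr (sB B)) cE (tmapE sres (sid G)).
  by rewrite /res_coact linearZ.
by rewrite /= /res_coact -lhs coactA rhs.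
Qed.

Let res_counit (w : R) : tlift (fun x a => counit a *: x) (res_lin w) = w.
Proof.
have bB : balanced (fun (w : W) (a : B) => counit a *: w).
  split=> [u u' a|u a a'|k u a]; rewrite ?scalerDr //.
    by rewrite linearD scalerDl.
  by rewrite [counit (k *: a)]linearZ /= scalerA mulrC.
have bG : balanced (fun (w : R) (a : G) => counit a *: w).
  split=> [u u' a|u a a'|k u a]; rewrite ?scalerDr //.
    by rewrite linearD scalerDl.
  by rewrite [counit (k *: a)]linearZ /= scalerA mulrC.
have h (x : tens W B) : tlift (fun (x : R) a => counit a *: x) (collapse x) =
    tlift (fun (w : W) (a : B) => counit a *: w) x.
  move: x; apply: tens_bc_ext => [x y|x y|u l a].
  - by rewrite collapseD (tliftD bG).
  - exact: tliftD.
  rewrite collapseE (tliftE bG) (tliftE bB) restrZ bctE.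
  have -> : @counit L B (l *: bcin phi a) = l * phi (counit a).
    by rewrite linearZ /=; congr (_ * _); exact: sgbc_counitE.
  by rewrite scalerA mulrC.
by rewrite /= /res_coact h coact_counit.
Qed.

Definition rep_res : rep G := @Rep K G R res_lin res_par res_coactA res_counit.

End RepRestriction.

Definition perfect_field (F : fieldType) : Prop :=
  forall p : {poly F}, irreducible_poly p -> separable_poly p.

Section Galois.
Variables (F Fbar : fieldType) (iota : {rmorphism F -> Fbar}).

Record galois_aut := GaloisAut {
  gal_fun :> {rmorphism Fbar -> Fbar};
  gal_bij : bijective gal_fun;
  gal_fix : forall x, gal_fun (iota x) = iota x
}.

Section FixedField.
Variable S : galois_aut -> Prop.

Definition fixed_pred : {pred Fbar} :=
  fun x => `[< forall s : galois_aut, S s -> s x = x >].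

Let fixedP x :
  reflect (forall s : galois_aut, S s -> s x = x) (x \in fixed_pred).
Proof. exact: asboolP. Qed.

Lemma fixed_divring_closed : divring_closed fixed_pred.
Proof.
split=> [|x y /fixedP fx /fixedP fy|x y /fixedP fx /fixedP fy];
  apply/fixedP => s Ss; first exact: rmorph1.
- by rewrite rmorphB fx ?fy.
- by rewrite rmorphM fmorphV fx ?fy.
Qed.

HB.instance Definition _ :=
  GRing.isDivringClosed.Build Fbar fixed_pred fixed_divring_closed.

Definition fixed_field : Type := {x : Fbar | x \in fixed_pred}.
HB.instance Definition _ := SubChoice.on fixed_field.
HB.instance Definition _ := [SubChoice_isSubComUnitRing of fixed_field by <:].
HB.instance Definition _ :=
  [SubComUnitRing_isSubIntegralDomain of fixed_field by <:].
HB.instance Definition _ :=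
  [SubIntegralDomain_isSubField of fixed_field by <:].

Definition fixed_val : {rmorphism fixed_field -> Fbar} :=
  val : {rmorphism fixed_field -> Fbar}.

Let iota_fixed x : iota x \in fixed_pred.
Proof. by apply/fixedP => s _; apply: gal_fix. Qed.

Definition fixed_iota (x : F) : fixed_field := @Sub _ _ fixed_field _ (iota_fixed x).

Let fixed_iotaB : zmod_morphism fixed_iota.
Proof. by move=> x y; apply: val_inj; rewrite raddfB !SubK raddfB. Qed.
Let fixed_iotaM : monoid_morphism fixed_iota.
Proof.
by split=> [|x y]; apply: val_inj; rewrite ?rmorph1 ?rmorphM !SubK ?rmorph1 ?rmorphM.
Qed.

HB.instance Definition _ :=
  GRing.isZmodMorphism.Build F fixed_field fixed_iota fixed_iotaB.
HB.instance Definition _ :=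
  GRing.isMonoidMorphism.Build F fixed_field fixed_iota fixed_iotaM.

Lemma fixed_val_iota x : fixed_val (fixed_iota x) = iota x.
Proof. exact: SubK. Qed.

End FixedField.

Variable G : supergroup F.

(* The base change of V along s; representations of G ⊗ Fbar pulled back      *)
(* along s are again ones of G ⊗ Fbar by id ⊗ s on F[G] ⊗ Fbar.               *)
Definition galois_conj (s : galois_aut) (V : rep (sgbc iota G)) :
    rep (sgbc iota G) :=
  rep_bc (sgbc_map (gal_fix s) G) V.

Definition gal_stab (V : rep (sgbc iota G)) (s : galois_aut) : Prop :=
  rep_isom (galois_conj s V) V \/ rep_isom (galois_conj s V) (parity_rep V).

End Galois.

(* W is the irreducible form V'_E of V', where H = G ⊗ Fbar, GE = G ⊗ E and j *)
(* is the canonical map E[GE] -> Fbar[H].                                     *)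
Definition is_irr_form (E Fbar : fieldType) (psi : {rmorphism E -> Fbar})
    (GE : supergroup E) (H : supergroup Fbar) (j : sgmor psi GE H)
    (V' : irrep H) (W : irrep GE) : Prop :=
  subrep_of V' (rep_bc j W).

Definition superalg_iso (K L : fieldType) (phi : K -> L)
    (A : superAlgType K) (B : superAlgType L) (f : {rmorphism A -> B}) : Prop :=
  [/\ bijective f, forall i a, f (par i a) = par i (f a)
    & forall k a, f (k *: a) = phi k *: f a].

(* Main.v *)
(* Let V' be irreducible over Fbar and S = Fbar ⊗ VF.  An F-linear functional *)
(* of F[G] acts, via the coaction, on every representation of G and of any     *)
(* base change of G, and these operators, with the parity projections,         *)
(* determine subrepresentations and homomorphisms; they commute with the       *)
(* semilinear action of the Galois group on S.  Galois descent, with           *)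
(* Fbar^Gal = F because F is perfect, shows that S is the sum of the           *)
(* conjugates of V' it contains (up to parity), and conjugates under s and t   *)
(* with s(x) != t(x), for x fixed by the inertia group of V', are independent. *)
(* Hence x acts on S as s(x) on the conjugates by s, and this operator         *)
(* descends to an endomorphism of VF commuting with uend VF.  Conversely S is  *)
(* semisimple, so V' is a direct factor of S and Schur's lemma makes an even   *)
(* central endomorphism act on V' by a scalar c; it then acts as s(c) on the   *)
(* conjugates by s, which forces c to be fixed by the inertia group.  Finally, *)
(* if V' embeds in Fbar ⊗_F' VF', composing S -> V' -> Fbar ⊗_F' VF' with an   *)
(* F'-linear functional of Fbar gives a nonzero map VF -> VF' which turns the  *)
(* action of F' on VF into scalars, so it is bijective.                        *)

Require Import Defs.
From HB Require Import structures.
From mathcomp Require Import all_boot all_algebra all_field.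
From mathcomp Require Import boolp classical_sets functions.

Set Implicit Arguments.
Unset Strict Implicit.
Unset Printing Implicit Defensive.

Import GRing.Theory.
Local Open Scope ring_scope.

(** * Galois automorphisms of an algebraic closure *)

(** The representation [V'] embeds in S = Fbar ⊗ VF, on which the Galois group acts semilinearly.
    The conjugates of [V'] inside S, up to parity, span a Galois stable subspace; by Galois descent
    and irreducibility of VF it is all of S ([descent], [tw_img_span]). [galois_fixed] supplies the
    input that only F is fixed by the whole group.

    Let x be fixed by the inertia group, and let x act on a conjugate by s as s(x). This is
    consistent: if conjugates by s and t are not independent, comparing them gives a semilinear
    automorphism of [V'] for the composite of the inverse of t with s, so s(x) = t(x) ([tw_img_eq0],
    [tw_rel0]). The operator so obtained commutes with all semilinear equivariant maps of S
    ([eigen_operator_comm]). Commuting with the Galois action, it descends to VF; commuting with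
    endomorphisms, it is central there. Conversely VF is finitely generated, so finitely many
    conjugates span S and [V'] is a direct factor. Schur's lemma then makes an even central
    endomorphism a scalar c on [V'], hence s(c) on conjugates by s, which forces c to be fixed by
    inertia ([eigen_end_center]). This is (1).

    For (2), the composite S -> [V'] -> Fbar ⊗ VF' followed by an F'-linear functional of Fbar gives
    a nonzero map from VF to VF' that turns the central action of F' into scalars; its kernel and
    image are subrepresentations, so it is bijective ([irr_form_restriction]). Endomorphisms of VF
    commute with F', so conjugation by this map identifies the two endomorphism superalgebras.
    Centrality is then (1), and division is Schur's lemma.

    Throughout, a representation is replaced by a superspace with operators labelled by the
    functionals of F[G]. The labels do not depend on the field, so semilinear equivariant maps make
    sense, and nothing is lost because the functionals contain the coordinates of a basis
    ([coact_ophom], [irreducible_repom]). *)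

Lemma inj_surj_bij (T U : Type) (f : T -> U) :
  injective f -> (forall y, exists x, f x = y) -> bijective f.
Proof.
move=> fI fS; exists (fun y => sval (cid (fS y))) => [x|y].
  exact: fI (svalP (cid (fS (f x)))).
exact: svalP (cid (fS y)).
Qed.

Section EmbeddingExtension.
Variables (F L : fieldType) (iota : {rmorphism F -> L}).

(* Partial embeddings of L into L over F are handled as their graphs. *)
Definition embedding_graph (R : set (L * L)) : Prop :=
  [/\ forall c, R (iota c, iota c),
      forall x y x' y', R (x, y) -> R (x', y') -> R (x - x', y - y'),
      forall x y x' y', R (x, y) -> R (x', y') -> R (x * x', y * y'),
      forall x y, R (x, y) -> R (x^-1, y^-1)
    & forall x y, R (x, y) -> (x == 0) = (y == 0)].

Lemma embedding_graph_bigcup (C : set (set (L * L))) :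
  (exists R, C R) -> (forall R, C R -> embedding_graph R) ->
  total_on C subset -> embedding_graph (\bigcup_(R in C) R)%classic.
Proof.
move=> [R0 CR0] Cg tot.
have two a b : (\bigcup_(R in C) R)%classic a -> (\bigcup_(R in C) R)%classic b ->
    exists R, [/\ C R, R a & R b].
  move=> [R CR Ra] [R' CR' Rb].
  have [s|s] := tot _ _ CR CR'; first by exists R'; split=> //; exact: s.
  by exists R; split=> //; exact: s.
split=> [c|x y x' y' h h'|x y x' y' h h'|x y [R CR Rxy]|x y [R CR Rxy]].
- by exists R0 => //; have [+ _ _ _ _] := Cg _ CR0; apply.
- have [R [CR Rx Rx']] := two _ _ h h'; exists R => //.
  by have [_ + _ _ _] := Cg _ CR; apply.
- have [R [CR Rx Rx']] := two _ _ h h'; exists R => //.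
  by have [_ _ + _ _] := Cg _ CR; apply.
- by exists R => //; have [_ _ _ + _] := Cg _ CR; apply.
- by have [_ _ _ _] := Cg _ CR; apply.
Qed.

Section Domain.
Variable R : set (L * L).
Hypothesis gR : embedding_graph R.

Definition graph_dom : {pred L} := fun x => `[< exists y, R (x, y) >].

Let domP x : reflect (exists y, R (x, y)) (x \in graph_dom).
Proof. exact: asboolP. Qed.

Lemma graph_dom_divring_closed : divring_closed graph_dom.
Proof.
have [R1 RB RM RV _] := gR.
split=> [|x y /domP[x' Rx] /domP[y' Ry]|x y /domP[x' Rx] /domP[y' Ry]].
- by apply/domP; exists (iota 1); rewrite -[X in R (X, _)](rmorph1 iota).
- by apply/domP; exists (x' - y'); apply: RB.
- by apply/domP; exists (x' / y'); apply: RM => //; apply: RV.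
Qed.

Lemma graph_fun x y y' : R (x, y) -> R (x, y') -> y = y'.
Proof.
have [_ RB _ _ R0] := gR.
by move=> Rxy /(RB _ _ _ _ Rxy)/R0; rewrite subrr eqxx subr_eq0 => /esym/eqP.
Qed.

End Domain.

Section DomainField.
Variables (R : set (L * L)) (gR : embedding_graph R).
HB.instance Definition _ :=
  GRing.isDivringClosed.Build L (graph_dom R) (graph_dom_divring_closed gR).

(** The proof that [R] is a graph is an argument of the type so that the field structure, which
    depends on it, can be inferred. *)
Definition dom_field of embedding_graph R : Type := {x : L | x \in graph_dom R}.
Local Notation D := (dom_field gR).
HB.instance Definition _ := SubChoice.on D.
HB.instance Definition _ := [SubChoice_isSubComUnitRing of D by <:].
HB.instance Definition _ := [SubComUnitRing_isSubIntegralDomain of D by <:].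
HB.instance Definition _ := [SubIntegralDomain_isSubField of D by <:].

Definition dom_val : {rmorphism D -> L} := val : {rmorphism D -> L}.

Lemma dom_imageP (x : D) : exists y, R (dom_val x, y).
Proof. exact/asboolP/(valP x). Qed.

Definition dom_image (x : D) : L := sval (cid (dom_imageP x)).
Lemma dom_imageE x : R (dom_val x, dom_image x).
Proof. exact: svalP (cid (dom_imageP x)). Qed.

Lemma dom_image_is_zmod : zmod_morphism dom_image.
Proof.
have [_ RB _ _ _] := gR => x y; apply: (graph_fun gR (dom_imageE _)).
by rewrite rmorphB; apply: RB; apply: dom_imageE.
Qed.
Lemma dom_image_is_monoid : monoid_morphism dom_image.
Proof.
have [R1 _ RM _ _] := gR; split=> [|x y]; apply: (graph_fun gR (dom_imageE _)).
  by rewrite rmorph1 -(rmorph1 iota).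
by rewrite rmorphM; apply: RM; apply: dom_imageE.
Qed.
HB.instance Definition _ := GRing.isZmodMorphism.Build D L dom_image dom_image_is_zmod.
HB.instance Definition _ := GRing.isMonoidMorphism.Build D L dom_image dom_image_is_monoid.

End DomainField.

(* The extension of a pair of embeddings f, g of K to K(w), sending w to a    *)
(* conjugate w'.                                                              *)
Lemma embedding_graph_adjoin (K : fieldType) (f g : {rmorphism K -> L})
    (m : {poly K}) (w w' : L) :
  (forall c, exists2 k, f k = iota c & g k = iota c) ->
  irreducible_poly m -> root (map_poly f m) w -> root (map_poly g m) w' ->
  embedding_graph [set xy | exists p : {poly K},
     xy = ((map_poly f p).[w], (map_poly g p).[w'])].
Proof.
move=> Fk irm mw mw'.
have bez p : ~~ (m %| p) -> exists u v, u * p + v * m = 1.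
  move=> ndm; have cop : coprimep p m.
    apply: contraNT ndm => /(irm.2 _) /(_ (dvdp_gcdr p m)) /eqp_dvdl <-.
    exact: dvdp_gcdl.
  by have /Bezout_eq1_coprimepP[[u v] uv] := cop; exists u, v.
have nz (h : {rmorphism K -> L}) z p :
    root (map_poly h m) z -> ~~ (m %| p) -> (map_poly h p).[z] != 0.
  move=> /rootP mz /bez[u [v uv]]; apply/eqP => pz.
  have := congr1 (fun q => (map_poly h q).[z]) uv.
  rewrite rmorphD !rmorphM rmorph1 !hornerE mz pz !mulr0 addr0 => /eqP.
  by rewrite eq_sym oner_eq0.
have zero p : ((map_poly f p).[w] == 0) = ((map_poly g p).[w'] == 0).
  have [/dvdpP[q ->]|ndm] := boolP (m %| p).
    by rewrite !rmorphM !hornerM (rootP mw) (rootP mw') !mulr0.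
  by rewrite !(negbTE (nz _ _ _ _ ndm)).
split=> [c|x y x' y' [p [-> ->]] [q [-> ->]]|x y x' y' [p [-> ->]] [q [-> ->]]
        |x y [p [-> ->]]|x y [p [-> ->]]].
- have [k fk gk] := Fk c; exists k%:P.
  by rewrite !map_polyC !hornerC /= fk gk.
- by exists (p - q); rewrite !rmorphB !hornerE.
- by exists (p * q); rewrite !rmorphM !hornerE.
(* If m divides p both values are 0, and so are their inverses by convention; otherwise a Bezout
   coefficient of p modulo m evaluates to the inverse on both sides. *)
- have [dm|ndm] := boolP (m %| p).
    exists 0; rewrite !rmorph0 !horner0.
    have /eqP p0 : (map_poly f p).[w] == 0.
      by move: dm => /dvdpP[q ->]; rewrite rmorphM hornerM (rootP mw) mulr0.
    by move: (zero p); rewrite p0 eqxx => /esym/eqP ->; rewrite invr0.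
  have [u [v uv]] := bez p ndm; exists u.
  have inv (h : {rmorphism K -> L}) z : root (map_poly h m) z ->
      (map_poly h p).[z] ^-1 = (map_poly h u).[z].
    move=> mz; apply: (mulIf (nz _ _ _ mz ndm)); rewrite mulVf ?(nz _ _ _ mz) //.
    have := congr1 (fun q => (map_poly h q).[z]) uv.
    by rewrite rmorphD !rmorphM rmorph1 !hornerE (rootP mz) mulr0 addr0.
  by rewrite !inv.
- exact: zero.
Qed.

End EmbeddingExtension.

Section GaloisFixed.
Variables (F : fieldType) (L : closedFieldType) (iota : {rmorphism F -> L}).
Hypothesis algL : forall x : L, algebraicOver iota x.

(** An equation of x over F is moved to K by choosing preimages of its coefficients;
    [minPoly_decidable_closure] then applies because membership in the image of K is classically
    decidable. *)
Lemma algebraic_minPoly (K : fieldType) (f : {rmorphism K -> L}) x :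
  (forall c, exists k, f k = iota c) ->
  exists m : {poly K}, [/\ m \is monic, root (map_poly f m) x & irreducible_poly m].
Proof.
move=> Fk; pose k c := sval (cid (Fk c)); have fk c : f (k c) = iota c.
  exact: svalP (cid (Fk c)).
have [p p0 px] := algL x.
have k0 : k 0 = 0 by apply: (fmorph_inj f); rewrite fk !rmorph0.
have kE : map_poly f (map_poly k p) = map_poly iota p.
  apply/polyP => i; rewrite !coef_map coef_map_id0 //; exact: fk.
have intx : integralOver f x.
  apply/integral_algebraic; exists (map_poly k p); last by rewrite kE.
  by rewrite -(map_poly_eq0 f) kE map_poly_eq0.
have decf : decidable_embedding f.
  move=> y; case: (pselect (exists z, y = f z)) => h; first by left.
  by right.
by have [m mP] := minPoly_decidable_closure decf intx; exists m.
Qed.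

Lemma embedding_graph_extend (R0 : set (L * L)) : embedding_graph iota R0 ->
  exists R, [/\ embedding_graph iota R, R0 `<=` R & forall x, exists y, R (x, y)]%classic.
Proof.
(* Zorn's lemma is run on the part added to [R0], so that the empty chain is harmless: its union
   satisfies [P] by [g0]. *)
move=> g0; pose P (R : set (L * L)) := embedding_graph iota (R0 `|` R)%classic.
have [|R [PR Rmax]] := @Zorn_bigcup _ P.
  move=> C CP tot; rewrite /P.
  have -> : (R0 `|` \bigcup_(X in C) X =
      \bigcup_(Y in [set R0] `|` [set (R0 `|` X) | X in C]) Y)%classic.
    apply/seteqP; split=> [a [h|[X CX Xa]]|a [Y [->|[X CX <-]]]].
    - by exists R0 => //; left.
    - by exists (R0 `|` X)%classic; [right; exists X|right].
    - by left.
    - by case=> h; [left|right; exists X].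
  apply: embedding_graph_bigcup.
  - by exists R0; left.
  - by move=> Y [->//|[X CX <-]]; exact: CP.
  - move=> Y Z [->|[X CX <-]] [->|[X' CX' <-]]; rewrite ?setUid.
    + by left.
    + by left; left.
    + by right; left.
    + have [s|s] := tot _ _ CX CX'; [left|right]; exact: setUS.
exists (R0 `|` R)%classic; split=> //.
move=> w; apply: contrapT => nw.
(* [f] and [g] are the inclusion and the embedding of the domain of the maximal graph. The minimal
   polynomial of [w] over that domain has a root [w'] after transport by [g], and sending [w] to
   [w'] contradicts maximality. *)
pose f := dom_val PR; pose g : {rmorphism _ -> L} := @dom_image _ _ _ _ PR.
have Fk c : exists2 k, f k = iota c & g k = iota c.
  have [/(_ c) Rc _ _ _ _] := PR.
  have dc : iota c \in graph_dom (R0 `|` R)%classic by apply/asboolP; exists (iota c).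
  pose k : dom_field PR := Sub (iota c) dc; have fk : f k = iota c by [].
  exists k => //; apply: (graph_fun PR) Rc.
  by have := dom_imageE k.
have [m [mm mw irm]] := @algebraic_minPoly _ f w
  (fun c => let: ex_intro2 k fk _ := Fk c in ex_intro _ k fk).
have [w' mw'] : exists w', root (map_poly g m) w'.
  by apply/closed_rootP; rewrite size_map_poly neq_ltn irm.1 orbT.
have gE := embedding_graph_adjoin Fk irm mw mw'.
set E := mkset _ in gE.
have sub : (R0 `|` R `<=` E)%classic.
  move=> [x y] Rxy; have dx : x \in graph_dom (R0 `|` R)%classic by apply/asboolP; exists y.
  pose k : dom_field PR := Sub x dx; exists k%:P; rewrite !map_polyC !hornerC.
  congr (_, _); apply: (graph_fun PR) Rxy _; exact: (dom_imageE k).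
apply: (Rmax E); last first.
  rewrite /P; suff -> : (R0 `|` E)%classic = E by [].
  by apply/seteqP; split=> [a [R0a|//]|a Ea]; [exact: (sub a (or_introl R0a))|right].
rewrite properEneq; split; last by move=> a Ra; exact: (sub a (or_intror Ra)).
apply/eqP => ER; apply: nw; exists w'; right; rewrite ER; exists 'X.
by rewrite !map_polyX !hornerX.
Qed.

Lemma galois_aut_of_graph (R : set (L * L)) : embedding_graph iota R ->
  (forall x, exists y, R (x, y)) ->
  exists s : galois_aut iota, forall x, R (x, s x).
Proof.
move=> gR tot; have [R1 RB RM _ R0] := gR.
pose s x := sval (cid (tot x)); have sE x : R (x, s x) := svalP (cid (tot x)).
have sF c : s (iota c) = iota c by apply: (graph_fun gR) (sE _) (R1 _).
have sB : zmod_morphism s.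
  by move=> x y; apply: (graph_fun gR) (sE _) _; apply: RB.
have sM : monoid_morphism s.
  split=> [|x y]; first by rewrite -(rmorph1 iota).
  by apply: (graph_fun gR) (sE _) _; apply: RM.
pose S : {rmorphism L -> L} := HB.pack s (GRing.isZmodMorphism.Build _ _ s sB)
  (GRing.isMonoidMorphism.Build _ _ s sM).
have bS : bijective S.
  apply: inj_surj_bij => [|y]; first exact: fmorph_inj.
  (* Surjectivity: [S] maps the finite set of roots of an equation of [y] over F injectively to
     itself, hence onto itself. *)
  have [p p0 py] := algL y; pose q := map_poly iota p.
  have [rs qE] := closed_field_poly_normal q.
  have q0 : lead_coef q != 0 by rewrite lead_coef_eq0 map_poly_eq0.
  have rootE z : root q z = (z \in undup rs).
    by rewrite qE rootZ // root_prod_XsubC mem_undup.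
  have Sq z : root q z -> root q (S z).
    move=> qz; have -> : q = map_poly S q.
      by rewrite -map_poly_comp; apply/esym/eq_map_poly => c; exact: sF.
    by rewrite fmorph_root.
  have uS : uniq (map S (undup rs)) by rewrite map_inj_uniq ?undup_uniq //; exact: fmorph_inj.
  have sub : {subset map S (undup rs) <= undup rs}.
    by move=> _ /mapP[z zr ->]; rewrite -rootE Sq ?rootE.
  have [_ eqS] := uniq_min_size uS sub (eq_leq (esym (size_map _ _))).
  have : y \in map S (undup rs) by rewrite eqS -rootE.
  by case/mapP=> x _ ->; exists x.
by exists (GaloisAut bS sF).
Qed.

(** If x is not in F, its separable minimal polynomial has a second root y; the embedding of F(x)
    sending x to y extends to an automorphism moving x. *)
Lemma galois_fixed x : perfect_field F ->
  (forall s : galois_aut iota, s x = x) -> exists c, x = iota c.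
Proof.
move=> perf fx; apply: contrapT => nx.
have [m [mm mx irm]] := @algebraic_minPoly _ iota x (fun c => ex_intro _ c erefl).
have [rs mE] := closed_field_poly_normal (map_poly iota m).
rewrite lead_coef_map (monicP mm) rmorph1 scale1r in mE.
have urs : uniq rs.
  by rewrite -separable_prod_XsubC -mE separable_map; apply: perf.
have xrs : x \in rs by rewrite -root_prod_XsubC -mE.
have [y yrs yx] : exists2 y, y \in rs & y != x.
  apply: contrapT => /forall2NP ny; apply: nx.
  have rsE : perm_eq rs [:: x].
    apply: uniq_perm => // z; rewrite inE; apply/idP/eqP => [zr|-> //].
    by have [|/negP/negPn/eqP] := ny z.
  have {}mE : map_poly iota m = 'X - x%:P.
    by rewrite mE (perm_big _ rsE) big_seq1.
  exists (- m`_0); rewrite rmorphN -coef_map mE !coefE /=.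
  by rewrite sub0r opprK.
have my : root (map_poly iota m) y by rewrite mE root_prod_XsubC.
have g0 := embedding_graph_adjoin (fun c => ex_intro2 _ _ c erefl erefl) irm mx my.
have [R [gR R0 tot]] := embedding_graph_extend g0.
have [s sR] := galois_aut_of_graph gR tot.
have Rxy : R (x, y) by apply: R0; exists 'X; rewrite !map_polyX !hornerX.
by move: yx; rewrite (graph_fun gR Rxy (sR x)) fx eqxx.
Qed.

End GaloisFixed.

(** * Dual bases *)

(** A possibly infinite basis together with its coordinate functionals; it is mostly the functionals
    that are used. *)
Definition dual_basis (K : fieldType) (V : lmodType K) (I : choiceType)
    (b : I -> V) (c : I -> V -> K) : Prop :=
  [/\ forall i, semilin idfun (c i : V -> K^o),
      forall i j, c i (b j) = (i == j)%:R
    & forall v, exists s : seq I, uniq s /\ v = \sum_(i <- s) c i v *: b i].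

Section DualBasis.
Variables (K : fieldType) (V : lmodType K).

Lemma sum_mask (I : eqType) (s s' : seq I) (f : I -> V) : uniq s -> uniq s' ->
  {subset s <= s'} -> (forall i, i \notin s -> f i = 0) ->
  \sum_(i <- s') f i = \sum_(i <- s) f i.
Proof.
move=> us us' ss f0; rewrite (bigID (mem s)) /= [X in _ + X]big1_seq ?addr0; last first.
  by move=> i /andP[/f0].
rewrite -big_filter; apply: perm_big; apply: uniq_perm => //.
  exact: filter_uniq.
by move=> i; rewrite mem_filter /=; case: (boolP (i \in s)) => // /ss.
Qed.

Section Theory.
Variables (I : choiceType) (b : I -> V) (c : I -> V -> K).
Hypothesis bc : dual_basis b c.

Lemma dual_basis_coord s v j : uniq s -> v = \sum_(i <- s) c i v *: b i ->
  j \notin s -> c j v = 0.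
Proof.
move=> us vE js; have [cl cb _] := bc.
rewrite vE (addf_sum (f := c j : V -> K^o)) ?big1_seq //; last exact: (cl j).1.
move=> i /= si; rewrite (cl j).2 cb; case: eqP => [ji|_]; last by rewrite [LHS]mulr0.
by move: js; rewrite ji si.
Qed.

(** Allowing any larger list makes it possible to expand several vectors over a common list of
    indices. *)
Lemma dual_basis_sum v : exists s : seq I, forall s', uniq s' ->
  {subset s <= s'} -> v = \sum_(i <- s') c i v *: b i.
Proof.
have [cl cb /(_ v)[s [us vE]]] := bc; exists s => s' us' ss.
rewrite (@sum_mask _ s s') // => i /(dual_basis_coord us vE) ->.
by rewrite scale0r.
Qed.

Lemma dual_basis_eq0 v : (forall i, c i v = 0) -> v = 0.
Proof.
move=> c0; have [_ _ /(_ v)[s [_ ->]]] := bc.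
by rewrite big1 // => i _; rewrite c0 scale0r.
Qed.

End Theory.

Definition lin_free (B : set V) : Prop := forall (s : seq V) (c : V -> K),
  uniq s -> (forall x, x \in s -> B x) -> \sum_(x <- s) c x *: x = 0 ->
  forall x, x \in s -> c x = 0.

(** Zorn's lemma applies since a finite list from the union of a chain lies in one member. For v
    outside a maximal B, a relation on B with v added must involve v and can be solved for it. *)
Lemma max_lin_free : exists B : set V, lin_free B /\
  forall v, exists s : seq V, exists c : V -> K,
    [/\ uniq s, forall x, x \in s -> B x & v = \sum_(x <- s) c x *: x].
Proof.
have [|B [fB maxB]] := @Zorn_bigcup V lin_free.
  move=> C CP tot s c us sC.
  case: s us sC => // x0 s0 us sC.
  suff [X CX sX] : exists2 X, C X & forall x, x \in x0 :: s0 -> X x by exact: (CP X CX _ c).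
  elim: s0 {us} sC => [|y t ih] sC.
    have [X CX Xx] := sC x0 (mem_head _ _); exists X => // x.
    by rewrite inE => /eqP ->.
  have [|X CX sX] := ih; first by move=> x; rewrite !inE => /orP[xx|xt]; apply: sC; rewrite !inE ?xx ?xt ?orbT.
  have [|Y CY Yy] := sC y; first by rewrite !inE eqxx orbT.
  have [XY|YX] := tot _ _ CX CY; [exists Y|exists X] => // x; rewrite !inE;
    case/or3P=> [xx|/eqP ->|xt] //.
  - by apply/XY/sX; rewrite inE xx.
  - by apply/XY/sX; rewrite inE xt orbT.
  - by apply/sX; rewrite inE xx.
  - exact: YX.
  - by apply/sX; rewrite inE xt orbT.
exists B; split=> // v.
have [Bv|nBv] := pselect (B v).
  exists [:: v], (fun=> 1); split=> // [x|]; first by rewrite inE => /eqP ->.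
  by rewrite big_seq1 scale1r.
have nf : ~ lin_free (B `|` [set v])%classic.
  apply: maxB; rewrite properEneq; split; last by move=> x; left.
  by apply/eqP => BE; apply: nBv; rewrite BE; right.
move: nf => /existsNP[s /existsNP[c]].
move=> /not_implyP[us /not_implyP[sB /not_implyP[s0 /existsNP[x /not_implyP[xs cx]]]]].
have sub y : y \in rem v s -> B y.
  rewrite mem_rem_uniq // inE => /andP[/= yv ys].
  by have [//|yv'] := sB y ys; rewrite yv' eqxx in yv.
have [vs|vs] := boolP (v \in s); last first.
  case: cx; apply: (fB s c) => // y ys; have [//|yv] := sB y ys.
  by move: vs; rewrite -yv ys.
have cv : c v != 0.
  apply/eqP => cv; case: cx; have [-> //|xv] := eqVneq x v.
  apply: (fB (rem v s) c); rewrite ?rem_uniq //; last by rewrite mem_rem_uniq // inE xv.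
  by move: s0; rewrite (perm_big _ (perm_to_rem vs)) big_cons /= cv scale0r add0r.
exists (rem v s), (fun y => - (c v)^-1 * c y); split=> //; first exact: rem_uniq.
have := s0; rewrite (perm_big _ (perm_to_rem vs)) big_cons /= => /eqP.
rewrite addr_eq0 => /eqP cvE.
under eq_bigr do rewrite -scalerA; rewrite -scaler_sumr scaleNr -scalerN -cvE.
by rewrite scalerA mulVf // scale1r.
Qed.

Lemma exists_dual_basis : exists (I : choiceType) (b : I -> V) (c : I -> {scalar V}),
  dual_basis b (fun i => c i : V -> K).
Proof.
have [B [fB genB]] := max_lin_free.
(* Coefficients are required to vanish off the support, which makes them unique and therefore linear
   in [v]. *)
pose good (v : V) (c : V -> K) := exists s : seq V,
  [/\ uniq s, forall x, x \in s -> B x, v = \sum_(x <- s) c x *: x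
    & forall x, x \notin s -> c x = 0].
have ex v : exists c, good v c.
  have [s [c [us sB vE]]] := genB v.
  exists (fun x => if x \in s then c x else 0), s; split=> //.
    by rewrite vE; apply: eq_big_seq => x ->.
  by move=> x /negbTE ->.
have good_lin k u v cu cv : good u cu -> good v cv ->
    good (k *: u + v) (fun x => k * cu x + cv x).
  move=> [s [us sB uE u0]] [t [ut tB vE v0]].
  exists (undup (s ++ t)); split; first exact: undup_uniq.
  - by move=> x; rewrite mem_undup mem_cat => /orP[/sB|/tB].
  - under eq_bigr do rewrite scalerDl -scalerA.
    rewrite big_split /= -scaler_sumr; congr (_ *: _ + _).
    + rewrite uE; apply/esym/sum_mask; rewrite ?undup_uniq //.
        by move=> x xs; rewrite mem_undup mem_cat xs.
      by move=> x /u0 ->; rewrite scale0r.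
    + rewrite vE; apply/esym/sum_mask; rewrite ?undup_uniq //.
        by move=> x xs; rewrite mem_undup mem_cat xs orbT.
      by move=> x /v0 ->; rewrite scale0r.
  - move=> x; rewrite mem_undup mem_cat negb_or => /andP[/u0 -> /v0 ->].
    by rewrite mulr0 addr0.
have good_uniq v c c' : good v c -> good v c' -> c = c'.
  move=> gc gc'; have := good_lin (-1) _ _ _ _ gc gc'.
  rewrite scaleN1r addNr => -[s [us sB /esym s0 nz]]; apply/funext => x.
  have [xs|xs] := boolP (x \in s); last first.
    by have := nz x xs; rewrite mulN1r => /eqP; rewrite addrC subr_eq0 => /eqP.
  have := fB s _ us sB s0 x xs; rewrite mulN1r => /eqP.
  by rewrite addrC subr_eq0 => /eqP.
pose co v := sval (cid (ex v)); have coP v : good v (co v) := svalP (cid (ex v)).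
have co_lin x : linear (fun v => co v x : K^o).
  move=> k u v; have := good_uniq _ _ _ (coP (k *: u + v)) (good_lin k _ _ _ _ (coP u) (coP v)).
  by move=> ->.
exists {x : V | `[< B x >]}, val, (fun i => mkscalar (co_lin (val i))); split.
- by move=> i; apply: linear_semilin; apply: co_lin.
- move=> i j /=; suff -> : co (val j) = (fun x => (x == val j)%:R) by [].
  apply: good_uniq (coP _) _; exists [:: val j]; split=> //.
  + by move=> x; rewrite inE => /eqP ->; apply/asboolP/(valP j).
  + by rewrite big_seq1 eqxx scale1r.
  + by move=> x; rewrite inE => /negbTE ->.
- move=> v; have [s [us sB vE v0]] := coP v.
  have sB' : all (fun x => `[< B x >]) s by apply/allP => x /sB Bx; apply/asboolP.
  exists (pmap insub s); split; first exact: pmap_sub_uniq.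
  rewrite [LHS]vE; move: sB'; elim: (s) => [|x t ih] /=; first by rewrite !big_nil.
  move=> /andP[Bx Bt]; rewrite big_cons ih // insubT /= big_cons; congr (_ + _).
Qed.

End DualBasis.

(** * Functionals and tensor products *)

Section BaseChangeDual.
Variables (K L : fieldType) (phi : {rmorphism K -> L}) (V : lmodType K).

Definition bc_scalar (c : V -> K) : bc phi V -> L :=
  bclift (idfun : {rmorphism L -> L}) (fun v => phi (c v) : L^o).

Section Scalar.
Variable c : V -> K.
Hypothesis cl : semilin idfun (c : V -> K^o).

Let sc : semilin (idfun \o phi) (fun v => phi (c v) : L^o).
Proof. by split=> [u v|k v]; rewrite ?cl.1 ?cl.2 ?rmorphD ?rmorphM. Qed.

Lemma bc_scalar_semilin : semilin idfun (bc_scalar c : bc phi V -> L^o).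
Proof. exact: bclift_semilin. Qed.

Lemma bc_scalar_in v : bc_scalar c (bcin phi v) = phi (c v).
Proof. exact: (bclift_in sc). Qed.
End Scalar.

Lemma bc_dual_basis (I : choiceType) (b : I -> V) (c : I -> V -> K) :
  dual_basis b c ->
  dual_basis (fun i => bcin phi (b i)) (fun i => bc_scalar (c i)).
Proof.
move=> bcV; have [cl cb _] := bcV; have sj := @bcin_semilin K L phi V.
split=> [i|i j|]; first exact: bc_scalar_semilin.
  by rewrite bc_scalar_in // cb rmorph_nat.
(* Quantifying over all larger lists lets the induction on tensors pass through sums. *)
suff gen x : exists s : seq I, forall s', uniq s' -> {subset s <= s'} ->
    x = \sum_(i <- s') bc_scalar (c i) x *: bcin phi (b i).
  move=> x; have [s xE] := gen x; exists (undup s); split; first exact: undup_uniq.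
  by apply: xE => [|i]; rewrite ?undup_uniq ?mem_undup.
have cD i := (bc_scalar_semilin (cl i)).1; have cZ i := (bc_scalar_semilin (cl i)).2.
elim/tens_ind: x => [|x y [s xE] [t yE]|l v].
- exists [::] => s' _ _; rewrite big1 // => i _.
  by rewrite (addf0 (cD i)) scale0r.
- exists (s ++ t) => s' us' ss'; rewrite [X in X + _ = _](xE s') //; last first.
    by move=> i si; rewrite ss' // mem_cat si.
  rewrite [X in _ + X = _](yE s') //; last by move=> i si; rewrite ss' // mem_cat si orbT.
  by rewrite -big_split /=; apply: eq_bigr => i _; rewrite -scalerDl -cD.
- have [s vE] := dual_basis_sum bcV v; exists s => s' us' ss'.
  rewrite -/(bct phi l v) bctE {1}(vE s') // (addf_sum _ _ sj.1) scaler_sumr.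
  apply: eq_bigr => i _; rewrite cZ bc_scalar_in // sj.2 !scalerA.
  by congr (_ *: _).
Qed.

Lemma bcin_inj : injective (@bcin K L phi V).
Proof.
have [I [b [c bcV]]] := exists_dual_basis V; have [cl _ _] := bcV.
have [jD jZ] := @bcin_semilin K L phi V.
move=> u v uv; apply/eqP; rewrite -subr_eq0; apply/eqP.
apply: (dual_basis_eq0 bcV) => i; apply: (fmorph_inj phi).
rewrite -(bc_scalar_in (cl i)) jD -[- v]scaleN1r jZ rmorphN1 scaleN1r uv subrr.
by rewrite rmorph0 (addf0 (bc_scalar_semilin (cl i)).1).
Qed.

(** The map mu ⊗ id from L ⊗ V back to V; it is only K-linear, but commutes with every operator
    extended from V. *)
Definition contract (mu : restr phi L^o -> K) (x : bc phi V) : V :=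
  tlift (fun l v => mu l *: v) x.

Section Contract.
Variable mu : restr phi L^o -> K.
Hypothesis mul : semilin idfun (mu : restr phi L^o -> K^o).

Let bmu : balanced (fun (l : restr phi L^o) (v : V) => mu l *: v).
Proof.
split=> [l l' v|l v v'|k l v]; first by rewrite mul.1 scalerDl.
  by rewrite scalerDr.
by rewrite mul.2 scalerA mulrC.
Qed.

Lemma contractD : {morph contract mu : x y / x + y}.
Proof. exact: tliftD bmu. Qed.

Lemma contractE l v : contract mu (bct phi l v) = mu l *: v.
Proof. exact: (tliftE bmu). Qed.

Lemma contractZ k x : contract mu (phi k *: x) = k *: contract mu x.
Proof.
move: x; apply: bc_addext => [x y|x y|l v]; first by rewrite scalerDr contractD.
  by rewrite contractD scalerDr.
by rewrite scale_bct !contractE -[phi k * l]/(k *: (l : restr phi L^o)) mul.2 -scalerA.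
Qed.
End Contract.

(** A tensor x equals the sum of the b_i ⊗ (c_i ⊗ id)(x), where b is a basis of L over K. *)
Lemma contract_eq0 (I : choiceType) (b : I -> restr phi L^o)
    (c : I -> restr phi L^o -> K) (x : bc phi V) :
  dual_basis b c -> (forall i, contract (c i) x = 0) -> x = 0.
Proof.
move=> bcL; have [cl _ _] := bcL; have cD i := contractD (cl i).
suff [s xE] : exists s : seq I, forall s', uniq s' -> {subset s <= s'} ->
    x = \sum_(i <- s') bct phi (b i) (contract (c i) x).
  move=> x0; rewrite (xE (undup s)) ?undup_uniq // => [|i]; last by rewrite mem_undup.
  by rewrite big1 // => i _; rewrite x0 bctE (addf0 (bcin_semilin phi V).1) scaler0.
elim/tens_ind: x => [|x y [s xE] [t yE]|l v].
- exists [::] => s' _ _; rewrite big1 // => i _.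
  by rewrite (addf0 (cD i)) bctE (addf0 (bcin_semilin phi V).1) scaler0.
- exists (s ++ t) => s' us' ss'; rewrite [X in X + _ = _](xE s') //; last first.
    by move=> i si; rewrite ss' // mem_cat si.
  rewrite [X in _ + X = _](yE s') //; last by move=> i si; rewrite ss' // mem_cat si orbT.
  by rewrite -big_split /=; apply: eq_bigr => i _; rewrite -bctDr -cD.
- have [s lE] := dual_basis_sum bcL l; exists s => s' us' ss'.
  rewrite -/(bct phi l v) {1}(lE s') //.
  rewrite (addf_sum (f := fun l => bct phi l v)); last by move=> ? ?; rewrite bctDl.
  by apply: eq_bigr => i _; rewrite contractE // -bctZ.
Qed.

End BaseChangeDual.
Arguments bc_scalar {K L} phi {V} c x.

Lemma contract_tmap (K L : fieldType) (phi : {rmorphism K -> L}) (V W : lmodType K)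
    (f : V -> W) (g : bc phi V -> bc phi W) (mu : restr phi L^o -> K) (x : bc phi V) :
  semilin idfun (mu : restr phi L^o -> K^o) ->
  semilin idfun f -> {morph g : x y / x + y} ->
  (forall l v, g (bct phi l v) = bct phi l (f v)) ->
  contract mu (g x) = f (contract mu x).
Proof.
move=> mul sf gD gE; have cD V' := contractD (V := V') mul.
move: x; apply: bc_addext => [x y|x y|l v]; first by rewrite gD cD.
  by rewrite cD sf.1.
by rewrite gE !contractE // sf.2.
Qed.

Section Slice.
Variables (K : fieldType) (W H : lmodType K).

(** The map id ⊗ mu. Applied after the coaction it is the action of the functional [mu] on a
    representation. *)
Definition slice (mu : H -> K) (x : tens W H) : W := tlift (fun w a => mu a *: w) x.

Section Theory.
Variable mu : H -> K.
Hypothesis mul : semilin idfun (mu : H -> K^o).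

Lemma slice_balanced : balanced (fun (w : W) (a : H) => mu a *: w).
Proof.
split=> [w w' a|w a a'|k w a]; rewrite ?scalerDr //; first by rewrite mul.1 scalerDl.
by rewrite mul.2 scalerA mulrC.
Qed.

Lemma sliceE w a : slice mu (w ⊗ a) = mu a *: w.
Proof. exact: (tliftE slice_balanced). Qed.

Lemma slice_semilin : semilin idfun (slice mu).
Proof.
apply: linear_semilin; apply: tlift_linear slice_balanced _ => k w a.
by rewrite !scalerA mulrC.
Qed.
End Theory.

(** This expansion turns stability under the slices of the coaction into the condition that the
    coaction maps U into the image of U ⊗ H. *)
Lemma slice_sum (I : choiceType) (b : I -> H) (c : I -> H -> K) x :
  dual_basis b c -> exists s : seq I, x = \sum_(i <- s) slice (c i) x ⊗ b i.
Proof.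
move=> bcH; have [cl _ _] := bcH; have cD i := (slice_semilin (cl i)).1.
suff [s xE] : exists s : seq I, forall s', uniq s' -> {subset s <= s'} ->
    x = \sum_(i <- s') slice (c i) x ⊗ b i.
  by exists (undup s); apply: xE => [|i]; rewrite ?undup_uniq ?mem_undup.
have t0 (a : H) : (0 : W) ⊗ a = 0 by apply: (addf0 (f := fun w => w ⊗ a)) => ? ?; rewrite tpureDl.
elim/tens_ind: x => [|x y [s xE] [t yE]|w a].
- by exists [::] => s' _ _; rewrite big1 // => i _; rewrite (addf0 (cD i)) t0.
- exists (s ++ t) => s' us' ss'; rewrite {1}(xE s') //; last first.
    by move=> i si; rewrite ss' // mem_cat si.
  rewrite {1}(yE s') //; last by move=> i si; rewrite ss' // mem_cat si orbT.
  by rewrite -big_split /=; apply: eq_bigr => i _; rewrite -tpureDl -cD.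
- have [s aE] := dual_basis_sum bcH a; exists s => s' us' ss'.
  rewrite {1}(aE s') // (addf_sum (f := fun a => w ⊗ a)); last first.
    by move=> ? ?; rewrite tpureDr.
  by apply: eq_bigr => i _; rewrite sliceE // tpureZ.
Qed.

Lemma slice_inj (I : choiceType) (b : I -> H) (c : I -> H -> K) x y :
  dual_basis b c -> (forall i, slice (c i) x = slice (c i) y) -> x = y.
Proof.
move=> bcH xy; have [cl _ _] := bcH.
apply/eqP; rewrite -subr_eq0; apply/eqP.
have t0 (a : H) : (0 : W) ⊗ a = 0 by apply: (addf0 (f := fun w => w ⊗ a)) => ? ?; rewrite tpureDl.
have [s ->] := slice_sum (x - y) bcH; rewrite big1 // => i _.
have cD := (slice_semilin (cl i)).1.
by rewrite cD (addfN cD) xy subrr t0.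
Qed.
End Slice.

Lemma slice_tmap (K L : fieldType) (phi : {rmorphism K -> L}) (W H : lmodType K)
    (W' H' : lmodType L) (f : W -> W') (j : H -> H') (mu : H -> K) (mu' : H' -> L) x :
  semilin phi f -> semilin phi j ->
  semilin idfun (mu : H -> K^o) -> semilin idfun (mu' : H' -> L^o) ->
  (forall a, mu' (j a) = phi (mu a)) ->
  slice mu' (tmap f j x) = f (slice mu x).
Proof.
move=> sf sj sm sm' muE.
move: x; apply: tens_ext => [x y|x y|w a].
- by rewrite (tmapD sf sj) (slice_semilin _ sm').1.
- by rewrite (slice_semilin _ sm).1 sf.1.
by rewrite (tmapE sf sj) !sliceE // muE sf.2.
Qed.

(** * Superspaces with operators *)

Section OpMod.
Variable Om : Type.

(** The label type does not mention the field, so spaces over different fields can carry matching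
    operators. *)
Record opmod (K : fieldType) := OpMod {
  om_space :> superModType K;
  op : Om -> om_space -> om_space;
  op_semilin : forall w, semilin idfun (op w)
}.

Arguments op_semilin {K o} w.

(** For a field automorphism [phi] such a map is a morphism from the conjugate of [V] to [W], or to
    the parity change of [W] when [p] is [true]. *)
Definition ophom (K L : fieldType) (phi : K -> L) (p : bool) (V : opmod K)
    (W : opmod L) (f : V -> W) : Prop :=
  [/\ semilin phi f, forall i v, f (par i v) = par (p (+) i) (f v)
    & forall w v, f (op w v) = op w (f v)].

Definition opsub (K : fieldType) (V : opmod K) (U : V -> Prop) : Prop :=
  [/\ U 0, forall k u v, U u -> U v -> U (k *: u + v),
      forall i u, U u -> U (par i u) & forall w u, U u -> U (op w u)].

Definition opirr (K : fieldType) (V : opmod K) : Prop :=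
  (exists v : V, v != 0) /\
  forall U : V -> Prop, opsub U -> (forall u, U u -> u = 0) \/ (forall u, U u).

Section Theory.
Variables (K L : fieldType) (phi : K -> L) (p : bool).
Variables (V : opmod K) (W : opmod L) (f : V -> W).
Hypothesis hf : ophom phi p f.

Lemma ophomD : {morph f : u v / u + v}. Proof. by case: hf => [[]]. Qed.
Lemma ophomZ k v : f (k *: v) = phi k *: f v. Proof. by case: hf => [[]]. Qed.
Lemma ophom_par i v : f (par i v) = par (p (+) i) (f v). Proof. by case: hf. Qed.
Lemma ophom_op w v : f (op w v) = op w (f v). Proof. by case: hf. Qed.
Lemma ophom0 : f 0 = 0. Proof. exact: addf0 ophomD. Qed.
Lemma ophomN : {morph f : u / - u}. Proof. exact: addfN ophomD. Qed.
Lemma ophomB : {morph f : u v / u - v}.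
Proof. by move=> u v; rewrite ophomD ophomN. Qed.

Lemma opsub_preim (U : W -> Prop) : opsub U -> opsub (fun v => U (f v)).
Proof.
move=> [U0 UD Up Uo]; split=> [|k u v Uu Uv|i u Uu|w u Uu].
- by rewrite ophom0.
- by rewrite ophomD ophomZ; apply: UD.
- by rewrite ophom_par; apply: Up.
- by rewrite ophom_op; apply: Uo.
Qed.

Lemma opirr_inj : opirr V -> (exists v, f v <> 0) -> injective f.
Proof.
move=> [_ irrV] [v fv0].
have W0 : opsub (fun w : W => w = 0).
  split=> [//|k u u' -> ->|i u ->|w u ->]; rewrite ?scaler0 ?addr0 ?par0 //.
  exact: addf0 (op_semilin w).1.
have [ker0|all0] := irrV _ (opsub_preim W0); last by case: fv0; apply: all0.
move=> a b fab; apply/eqP; rewrite -subr_eq0; apply/eqP/ker0.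
by rewrite ophomB fab subrr.
Qed.

(** Since [phi] need not be onto, the image is closed under scalars of L only by hypothesis; later
    the operators coming from the center supply that closure. *)
Lemma opirr_surj : opirr W -> (exists v, f v <> 0) ->
  (forall k w, (exists v, f v = w) -> exists v, f v = k *: w) ->
  forall w, exists v, f v = w.
Proof.
move=> [_ irrW] [v fv0] scal.
have imU : opsub (fun w => exists v, f v = w).
  split=> [|k w w' /scal-/(_ k)[u uE] [u' u'E]|i w [u <-]|o w [u <-]].
  - by exists 0; rewrite ophom0.
  - by exists (u + u'); rewrite ophomD uE u'E.
  - by exists (par (p (+) i) u); rewrite ophom_par addKb.
  - by exists (op o u); rewrite ophom_op.
have [im0|//] := irrW _ imU.
by case: fv0; apply: im0; exists v.
Qed.

End Theory.

Lemma ophom_comp (K L M : fieldType) (phi : K -> L) (psi : L -> M) p q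
    (V : opmod K) (W : opmod L) (U : opmod M) (f : V -> W) (g : W -> U) :
  ophom phi p f -> ophom psi q g -> ophom (psi \o phi) (q (+) p) (g \o f).
Proof.
move=> [sf pf of_] [sg pg og]; split=> [|i v|w v] /=; first exact: semilin_comp sf sg.
  by rewrite pf pg addbA.
by rewrite of_ og.
Qed.

Lemma ophom_inv (K L : fieldType) (phi : K -> L) psi p (V : opmod K) (W : opmod L)
    (f : V -> W) g : ophom phi p f -> cancel psi phi -> cancel f g -> cancel g f ->
  ophom psi p g.
Proof.
move=> hf phiK fK gK; split; first split.
- by move=> u v; rewrite -{1}[u]gK -{1}[v]gK -(ophomD hf) fK.
- by move=> k v; rewrite -{1}[v]gK -{1}[k]phiK -(ophomZ hf) fK.
- by move=> i v; rewrite -{1}[v]gK -{1}[i](addKb p) -(ophom_par hf) fK.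
- by move=> w v; rewrite -{1}[v]gK -(ophom_op hf) fK.
Qed.

Lemma opsub_sum (K : fieldType) (V : opmod K) (U U' : V -> Prop) :
  opsub U -> opsub U' -> opsub (fun v => exists2 u, U u & U' (v - u)).
Proof.
move=> [U0 UD Up Uo] [W0 WD Wp Wo].
split=> [|k u v [a Ua Wa] [b Ub Wb]|i u [a Ua Wa]|w u [a Ua Wa]].
- by exists 0; rewrite ?subr0.
- exists (k *: a + b); first exact: UD.
  by rewrite opprD addrACA -scalerBr; apply: WD.
- by exists (par i a); [apply: Up|rewrite -[- _]scaleN1r -parZ -parD scaleN1r; apply: Wp].
- exists (op w a); first exact: Uo.
  by rewrite -(addfN (op_semilin w).1) -(op_semilin w).1; apply: Wo.
Qed.

Lemma opsub_add (K : fieldType) (V : opmod K) (U : V -> Prop) u v :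
  opsub U -> U u -> U v -> U (u + v).
Proof. by move=> [_ UD _ _] Uu Uv; rewrite -[u]scale1r; apply: UD. Qed.

Lemma opsub_opp (K : fieldType) (V : opmod K) (U : V -> Prop) u :
  opsub U -> U u -> U (- u).
Proof. by move=> [U0 UD _ _] Uu; rewrite -scaleN1r -[_ *: _]addr0; apply: UD. Qed.

Section BaseChange.
Variables (K L : fieldType) (phi : {rmorphism K -> L}) (V : opmod K).

Let bc_op_semi w : semilin (idfun \o phi) (fun v : V => bcin phi (op w v)).
Proof.
exact: (@semilin_comp _ _ _ _ phi _ _ _ _ (bcin phi (V := V)) (op_semilin w)
  (bcin_semilin phi V)).
Qed.

Definition bcom : opmod L := @OpMod L (bc phi V) _ (fun w =>
  bclift_semilin (bc_op_semi w)).

Lemma bcom_bcin : ophom phi false (bcin phi (V := V) : V -> bcom).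
Proof.
split=> [|i v|w v]; first exact: bcin_semilin.
- by rewrite par_bcin.
- by rewrite /= (bclift_in (bc_op_semi w)).
Qed.

Lemma bcom_ext (M : fieldType) (psi : L -> M) (U : lmodType M) (f g : bcom -> U) :
  semilin psi f -> semilin psi g -> (forall v, f (bcin phi v) = g (bcin phi v)) ->
  f =1 g.
Proof.
move=> [fD fZ] [gD gZ] fg; apply: bc_addext => // l v.
by rewrite bctE fZ gZ fg.
Qed.

Lemma bcom_lift (M : fieldType) (psi : {rmorphism L -> M}) p (W : opmod M) (f : V -> W) :
  ophom (psi \o phi) p f -> ophom psi p (bclift psi f : bcom -> W).
Proof.
move=> hf; have [sf _ _] := hf; have sl := bclift_semilin sf; have [bD bP bO] := bcom_bcin.
have ps := par_semilin.
split=> // [i x|w x].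
- move: x; apply: bcom_ext => [||v].
  + exact: (semilin_comp (ps _ bcom i) sl).
  + exact: (semilin_comp sl (ps _ W _)).
  + by rewrite /= -bP !(bclift_in sf) (ophom_par hf).
- move: x; apply: bcom_ext => [||v].
  + exact: (semilin_comp (op_semilin (o := bcom) w) sl).
  + exact: (semilin_comp sl (op_semilin (o := W) w)).
  + by rewrite -bO !(bclift_in sf) (ophom_op hf).
Qed.

End BaseChange.
Arguments bcom_bcin {K L} phi V.

Definition bcom_end (K L : fieldType) (phi : {rmorphism K -> L}) (V W : opmod K) (f : V -> W) :
  bcom phi V -> bcom phi W := bclift (idfun : {rmorphism L -> L}) (fun v => bcin phi (f v)).
Arguments bcom_end {K L} phi {V W} f.

Lemma bcom_endP (K L : fieldType) (phi : {rmorphism K -> L}) (V W : opmod K) p (f : V -> W) :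
  ophom idfun p f ->
  ophom idfun p (bcom_end phi f) /\ forall v, bcom_end phi f (bcin phi v) = bcin phi (f v).
Proof.
move=> hf; have hj := bcom_bcin phi W; have h := ophom_comp hf hj.
split=> [|v]; last by apply: bclift_in; case: h.
exact: (@bcom_lift _ _ phi V _ (idfun : {rmorphism L -> L}) p (bcom phi W) _ h).
Qed.

Section Contract.
Variables (K L : fieldType) (phi : {rmorphism K -> L}) (V : opmod K).
Variable mu : restr phi L^o -> K.
Hypothesis mul : semilin idfun (mu : restr phi L^o -> K^o).

Lemma contract_par i (x : bcom phi V) : contract mu (par i x) = par i (contract mu x).
Proof.
apply: (contract_tmap (f := par i : V -> V) (g := par i : bcom phi V -> bcom phi V)) => //.
- exact: par_semilin.
- exact: parD.
- by move=> l v; rewrite bctE parZ par_bcin -bctE.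
Qed.

Lemma contract_op w (x : bcom phi V) : contract mu (op w x) = op w (contract mu x).
Proof.
have [sj _ jo] := bcom_bcin phi V.
apply: (contract_tmap (f := op w : V -> V) (g := op w : bcom phi V -> bcom phi V)) => //.
- exact: op_semilin.
- exact: (op_semilin (o := bcom phi V) w).1.
- by move=> l v; rewrite bctE (op_semilin (o := bcom phi V) w).2 -jo -bctE.
Qed.

End Contract.
End OpMod.

Arguments op {Om K o}.
Arguments bcom_bcin {Om K L} phi V.
Arguments bcom_end {Om K L} phi {V W} f x.
Arguments op_semilin {Om K o} w.

(** * Conjugates of an irreducible space with operators *)

Section GaloisGroup.
Variables (F L : fieldType) (iota : {rmorphism F -> L}).
Implicit Types s t : galois_aut iota.

Definition gal_one : galois_aut iota :=
  @GaloisAut _ _ iota (idfun : {rmorphism L -> L}) (Bijective (fun=> erefl) (fun=> erefl))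
    (fun=> erefl).

Lemma gal_comp_fix s t x : (s \o t) (iota x) = iota x.
Proof. by rewrite /= !gal_fix. Qed.

Definition gal_comp s t : galois_aut iota :=
  @GaloisAut _ _ iota (s \o t : {rmorphism L -> L}) (bij_comp (gal_bij s) (gal_bij t))
    (gal_comp_fix s t).

Lemma gal_inv_exists s : exists t, cancel s t /\ cancel t s.
Proof.
have [t st ts] := gal_bij s.
have tB : zmod_morphism t by move=> x y; rewrite -{1}[x]ts -{1}[y]ts -rmorphB st.
have tM : monoid_morphism t.
  by split=> [|x y]; rewrite -1?{1}(rmorph1 s) // -{1}[x]ts -{1}[y]ts -rmorphM st.
pose T : {rmorphism L -> L} := HB.pack t (GRing.isZmodMorphism.Build _ _ t tB)
  (GRing.isMonoidMorphism.Build _ _ t tM).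
have tF x : T (iota x) = iota x by rewrite -{1}(gal_fix s) /= st.
by exists (@GaloisAut _ _ iota T (Bijective ts st) tF).
Qed.

Definition gal_inv s := sval (cid (gal_inv_exists s)).
Lemma gal_invK s : cancel s (gal_inv s).
Proof. by have [] := svalP (cid (gal_inv_exists s)). Qed.
Lemma gal_invVK s : cancel (gal_inv s) s.
Proof. by have [] := svalP (cid (gal_inv_exists s)). Qed.

End GaloisGroup.

Section Isotypic.
Variables (Om : Type) (F L : fieldType) (iota : {rmorphism F -> L}).
Variables (V T : opmod Om L).
Hypothesis irrV : opirr V.

(* A homomorphism up to parity to T from the conjugate of V by tw_aut. *)
Record twisted := Twisted {
  tw_aut : galois_aut iota;
  tw_par : bool;
  tw_fun :> V -> T;
  tw_hom : ophom tw_aut tw_par tw_fun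
}.

Lemma tw_scale (h : twisted) k v : h (gal_inv (tw_aut h) k *: v) = k *: h v.
Proof. by rewrite (ophomZ (tw_hom h)) gal_invVK. Qed.

Lemma tw_parity (h : twisted) i v : h (par (tw_par h (+) i) v) = par i (h v).
Proof. by rewrite (ophom_par (tw_hom h)) addKb. Qed.

(** The sum of the images of the members of [hs], peeled off one summand at a time for induction. It
    is an L-subspace because the automorphisms are invertible. *)
Fixpoint tw_img (hs : seq twisted) (y : T) : Prop :=
  if hs is h :: hs' then exists v, tw_img hs' (y - h v) else y = 0.

Lemma tw_img_opsub hs : opsub (tw_img hs).
Proof.
elim: hs => [|h hs [i0 iD ip io]] /=.
  split=> [//|k u v -> ->|i u ->|w u ->]; rewrite ?scaler0 ?addr0 ?par0 //.
  exact: addf0 (op_semilin w).1.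
have hh := tw_hom h.
split=> [|k u v [a ua] [b vb]|i u [a ua]|w u [a ua]].
- by exists 0; rewrite (ophom0 hh) subr0.
- exists (gal_inv (tw_aut h) k *: a + b).
  by rewrite (ophomD hh) tw_scale opprD addrACA -scalerBr; apply: iD.
- exists (par (tw_par h (+) i) a); rewrite tw_parity.
  by rewrite -[- _]scaleN1r -parZ -parD scaleN1r; apply: ip.
- exists (op w a); rewrite (ophom_op hh) -(addfN (op_semilin w).1) -(op_semilin w).1.
  exact: io.
Qed.

Lemma tw_img_cat hs1 hs2 y1 y2 :
  tw_img hs1 y1 -> tw_img hs2 y2 -> tw_img (hs1 ++ hs2) (y1 + y2).
Proof.
elim: hs1 y1 => [|h hs ih] y1 /=; first by move=> ->; rewrite add0r.
by move=> [v hv] h2; exists v; rewrite addrAC; apply: ih.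
Qed.

Section Eigen.
Variable x : L.
(* That is, x lies in the fixed field of the inertia group of V. *)
Hypothesis inertia : forall (s : galois_aut iota) p (g : V -> V),
  ophom s p g -> bijective g -> s x = x.

(** Induction on [hs]. If h(V) met k(V) + I nontrivially, I being the sum over the remaining maps,
    irreducibility would give h(V) ⊂ k(V) + I with h(V) and k(V) both meeting I in 0. Then h factors
    through k modulo I by a semilinear automorphism of V, which must fix x; so h and k would give x
    the same eigenvalue. *)
Lemma tw_img_eq0 hs (h : twisted) :
  all (fun k => tw_aut k x != tw_aut h x) hs ->
  forall v, tw_img hs (h v) -> h v = 0.
Proof.
move=> + v; have hh := tw_hom h; elim: hs => [|k hs ih] //= /andP[kx /ih{}ih] [w0 hw0].
have hk := tw_hom k; have sI := tw_img_opsub hs.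
apply: contrapT => hv0.
have injh : injective h by apply: (opirr_inj hh irrV); exists v.
have v0 : v <> 0 by move=> v0; apply: hv0; rewrite v0 (ophom0 hh).
have hI a : tw_img hs (h a) -> a = 0.
  have [_ /(_ _ (opsub_preim hh sI))] := irrV.
  case=> [|all_]; first exact.
  by case: hv0; apply: ih; exact: all_.
have kI a : tw_img hs (k a) -> a = 0.
  have [_ /(_ _ (opsub_preim hk sI))] := irrV.
  case=> [|all_]; first exact.
  case: v0; apply: hI; rewrite -[h v](subrK (k w0)); exact: opsub_add.
have ex a : exists w, tw_img hs (h a - k w).
  have [_ /(_ _ (opsub_preim hh (tw_img_opsub (k :: hs))))] := irrV.
  by case=> [a0|all_]; [case: v0; apply: a0; exists w0|exact: all_].
(* [g] is the inverse of [k] composed with [h], modulo the sum of the images of [hs]. *)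
pose g a := sval (cid (ex a)); have gP a : tw_img hs (h a - k (g a)) := svalP (cid (ex a)).
have gU a w : tw_img hs (h a - k w) -> g a = w.
  move=> aw; apply/eqP; rewrite -subr_eq0; apply/eqP/kI.
  have := opsub_add sI aw (opsub_opp sI (gP a)).
  by rewrite opprB addrC addrA subrK (ophomB hk).
have hg : ophom (gal_comp (gal_inv (tw_aut k)) (tw_aut h)) (tw_par k (+) tw_par h) g.
  have [I0 ID Ip Io] := sI.
  split; first split.
  - move=> a b; apply: gU; rewrite (ophomD hh) (ophomD hk) opprD addrACA.
    exact: opsub_add.
  - move=> l a; apply: gU; rewrite /= tw_scale (ophomZ hh) -scalerBr -[_ *: _]addr0.
    exact: ID.
  - move=> i a; apply: gU; rewrite (ophom_par hh) -addbA tw_parity.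
    by rewrite -[- _]scaleN1r -parZ -parD scaleN1r; apply: Ip.
  - move=> w a; apply: gU; rewrite (ophom_op hh) (ophom_op hk).
    by rewrite -(addfN (op_semilin w).1) -(op_semilin w).1; apply: Io.
have gv : g v <> 0.
  by move=> gv; have := gP v; rewrite gv (ophom0 hk) subr0 => /hI.
have bg : bijective g.
  apply: inj_surj_bij; first by apply: (opirr_inj hg irrV); exists v.
  apply: (opirr_surj hg irrV); first by exists v.
  move=> l w [a <-]; exists (gal_inv (gal_comp (gal_inv (tw_aut k)) (tw_aut h)) l *: a).
  by rewrite (ophomZ hg) gal_invVK.
have := inertia hg bg => /= /(congr1 (tw_aut k)); rewrite gal_invVK => hx.
by rewrite hx eqxx in kx.
Qed.

(* The graph of the operator acting on the image of each h by tw_aut h x. *)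
Fixpoint tw_rel (hs : seq twisted) (y y' : T) : Prop :=
  if hs is h :: hs' then
    exists v, tw_rel hs' (y - h v) (y' - tw_aut h x *: h v)
  else y = 0 /\ y' = 0.

Lemma tw_rel_cat hs1 hs2 y1 y1' y2 y2' : tw_rel hs1 y1 y1' -> tw_rel hs2 y2 y2' ->
  tw_rel (hs1 ++ hs2) (y1 + y2) (y1' + y2').
Proof.
elim: hs1 y1 y1' => [|h hs ih] y1 y1' /=; first by move=> [-> ->]; rewrite !add0r.
by move=> [v hv] h2; exists v; rewrite ![_ + y2 - _]addrAC ![_ + y2' - _]addrAC; apply: ih.
Qed.

Lemma tw_relZ hs k y y' : tw_rel hs y y' -> tw_rel hs (k *: y) (k *: y').
Proof.
elim: hs y y' => [|h hs ih] y y' /=; first by move=> [-> ->]; rewrite scaler0.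
move=> [v /ih hv]; exists (gal_inv (tw_aut h) k *: v).
by rewrite tw_scale scalerA mulrC -scalerA -!scalerBr.
Qed.

Lemma tw_relD hs y y' z z' :
  tw_rel hs y y' -> tw_rel hs z z' -> tw_rel hs (y + z) (y' + z').
Proof.
elim: hs y y' z z' => [|h hs ih] y y' z z' /=; first by move=> [-> ->] [-> ->]; rewrite !addr0.
move=> [v hv] [w hw]; exists (v + w); rewrite (ophomD (tw_hom h)) scalerDr !opprD.
by rewrite !(addrACA _ _ (- _)); apply: ih.
Qed.

Lemma tw_rel_par hs i y y' : tw_rel hs y y' -> tw_rel hs (par i y) (par i y').
Proof.
elim: hs y y' => [|h hs ih] y y' /=; first by move=> [-> ->]; rewrite par0.
move=> [v /ih hv]; exists (par (tw_par h (+) i) v); rewrite tw_parity -parZ.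
by rewrite -![- par _ _]scaleN1r -!parZ -!parD !scaleN1r.
Qed.

Lemma tw_rel_op hs w y y' : tw_rel hs y y' -> tw_rel hs (op w y) (op w y').
Proof.
have [oD oZ] := op_semilin (o := T) w.
elim: hs y y' => [|h hs ih] y y' /=; first by move=> [-> ->]; rewrite (addf0 oD).
move=> [v /ih hv]; exists (op w v); rewrite (ophom_op (tw_hom h)) -oZ.
by rewrite -!(addfN oD) -!oD.
Qed.

Lemma tw_rel_img hs y y' : tw_rel hs y y' -> tw_img hs y.
Proof. by elim: hs y y' => [|h hs ih] y y' /= [// v /ih]; exists v. Qed.

Lemma tw_img_rel hs y : tw_img hs y -> exists y', tw_rel hs y y'.
Proof.
elim: hs y => [|h hs ih] y /=; first by exists 0.
move=> [v /ih[y' hy']]; exists (y' + tw_aut h x *: h v), v.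
by rewrite addrK.
Qed.

(** Subtracting c kills the summands of eigenvalue c and rescales the others. *)
Lemma tw_rel_eigen hs c y y' : tw_rel hs y y' ->
  tw_img (filter (fun k => tw_aut k x != c) hs) (y' - c *: y).
Proof.
elim: hs y y' => [|h hs ih] y y' /=; first by move=> [-> ->]; rewrite scaler0 subr0.
move=> [v /ih hv]; have [hc|hc] := eqVneq (tw_aut h x) c; rewrite /=.
  by move: hv; rewrite hc scalerBr opprB addrA subrK.
exists (gal_inv (tw_aut h) (tw_aut h x - c) *: v); rewrite tw_scale scalerBl.
suff -> : y' - c *: y - (tw_aut h x *: h v - c *: h v) =
          y' - tw_aut h x *: h v - c *: (y - h v) by [].
by rewrite scalerBr !opprB [c *: h v - _]addrC addrACA [- (c *: y) + _]addrC.
Qed.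

(** Well-definedness of the operator, by induction on [hs]. The case to treat is h(V) inside the sum
    of the remaining images, where the operator r is already defined. Then r - s(x) on h(V), s being
    the automorphism of h, is again a map twisted by s, and it lands in the summands whose
    eigenvalue is not s(x); so it vanishes by [tw_img_eq0]. *)
Lemma tw_rel0 hs y' : tw_rel hs 0 y' -> y' = 0.
Proof.
elim: hs y' => [|h hs ih] y' /=; first by case.
have hh := tw_hom h; set c := tw_aut h x.
have rel_uniq y a b : tw_rel hs y a -> tw_rel hs y b -> a = b.
  move=> ya yb; apply/eqP; rewrite -subr_eq0; apply/eqP/ih.
  have := tw_relD ya (tw_relZ (-1) yb).
  by rewrite !scaleN1r subrr.
suff key v z : tw_rel hs (h v) z -> z = c *: h v.
  move=> [v]; rewrite add0r -(ophomN hh) => /key.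
  by rewrite (ophomN hh) scalerN => /eqP; rewrite subr_eq addNr => /eqP.
have [_ /(_ _ (opsub_preim hh (tw_img_opsub hs)))] := irrV; case=> [D0|D1] hz.
  have v0 : v = 0 by apply: D0; apply: tw_rel_img hz.
  move: hz; rewrite v0 (ophom0 hh) scaler0; exact: ih.
pose r a := sval (cid (tw_img_rel (D1 a))).
have rP a : tw_rel hs (h a) (r a) := svalP (cid (tw_img_rel (D1 a))).
pose d a := r a - c *: h a.
have rU a b : tw_rel hs (h a) b -> r a = b by apply: rel_uniq.
have hd : ophom (tw_aut h) (tw_par h) d.
  split; first split.
  - move=> a b; rewrite /d (rU (a + b) (r a + r b)) ?(ophomD hh) ?scalerDr ?opprD 1?addrACA //.
    exact: tw_relD.
  - move=> k a; rewrite /d (rU (k *: a) (tw_aut h k *: r a)) ?(ophomZ hh).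
      by rewrite scalerBr !scalerA mulrC.
    exact: tw_relZ.
  - move=> i a; rewrite /d (rU _ (par (tw_par h (+) i) (r a))) ?(ophom_par hh).
      by rewrite -scaleN1r -[in RHS]scaleN1r parD !parZ.
    exact: tw_rel_par.
  - move=> w a; have [oD oZ] := op_semilin (o := T) w.
    rewrite /d (rU _ (op w (r a))) ?(ophom_op hh); first by rewrite oD (addfN oD) oZ.
    exact: tw_rel_op.
have : d v = 0.
  apply: (@tw_img_eq0 (filter (fun k => tw_aut k x != c) hs) (Twisted hd)) => /=.
    by rewrite filter_all.
  exact: tw_rel_eigen.
by rewrite /d (rel_uniq _ _ _ (rP v) hz) => /eqP; rewrite subr_eq0 => /eqP.
Qed.

End Eigen.
End Isotypic.

Section TwistedSpan.
Variables (Om : Type) (F L : fieldType) (iota : {rmorphism F -> L}).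
Variables (V T : opmod Om L).
Hypothesis irrV : opirr V.
Local Notation twisted := (twisted iota V T).
Hypothesis spanT : forall y, exists hs : seq twisted, tw_img hs y.

Lemma twisted_ext (U : zmodType) (f g : T -> U) :
  {morph f : u v / u + v} -> {morph g : u v / u + v} ->
  (forall (h : twisted) v, f (h v) = g (h v)) -> f =1 g.
Proof.
move=> fD gD fg y; have [hs] := spanT y; elim: hs y => [|h hs ih] y /=.
  by move=> ->; rewrite (addf0 fD) (addf0 gD).
by move=> [v /ih]; rewrite fD gD (addfN fD) (addfN gD) fg => /addIr.
Qed.

Lemma eigen_operator x :
  (forall (s : galois_aut iota) p (g : V -> V),
     ophom s p g -> bijective g -> s x = x) ->
  exists f : T -> T, ophom idfun false f /\
    forall (h : twisted) v, f (h v) = tw_aut h x *: h v.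
Proof.
move=> inertia.
have ex y : exists y', exists hs : seq twisted, tw_rel x hs y y'.
  by have [hs /(tw_img_rel x)[y' hy']] := spanT y; exists y', hs.
pose f y := sval (cid (ex y)).
have fP y : exists hs : seq twisted, tw_rel x hs y (f y) := svalP (cid (ex y)).
(* Decompositions of [y] along two different lists are compared along their concatenation. *)
have fU y y' (hs : seq twisted) : tw_rel x hs y y' -> f y = y'.
  have [ks hks] := fP y => hhs; apply/eqP; rewrite -subr_eq0; apply/eqP.
  apply: (tw_rel0 irrV inertia (hs := ks ++ hs)).
  have := tw_rel_cat hks (tw_relZ (-1) hhs).
  by rewrite !scaleN1r subrr.
exists f; split; first split; first split.
- move=> u v; have [hs hhs] := fP u; have [ks hks] := fP v.
  exact: fU (tw_rel_cat hhs hks).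
- by move=> k v; have [hs hhs] := fP v; apply: fU (tw_relZ k hhs).
- by move=> i v; have [hs hhs] := fP v; apply: fU (tw_rel_par i hhs).
- by move=> w v; have [hs hhs] := fP v; apply: fU (tw_rel_op w hhs).
- move=> h v; apply: (fU _ _ [:: h]) => /=; exists v.
  by rewrite !subrr.
Qed.

Section EigenOperator.
Variables (x : L) (f : T -> T).
Hypothesis hf : ophom idfun false f.
Hypothesis fE : forall (h : twisted) v, f (h v) = tw_aut h x *: h v.

(** Following a twisted map by g gives a twisted map whose automorphism is multiplied by s; the
    eigenvalue s(t(x)) is exactly what semilinearity of g produces. *)
Lemma eigen_operator_comm (s : galois_aut iota) q (g : T -> T) : ophom s q g ->
  forall y, f (g y) = g (f y).
Proof.
move=> hg; have fD := ophomD hf; have gD := ophomD hg.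
apply: twisted_ext => [u v|u v|h v]; rewrite ?gD ?fD ?gD //.
have hgh := ophom_comp (tw_hom h) hg.
pose k := @Twisted _ _ _ iota _ _ (gal_comp s (tw_aut h)) _ (g \o h) hgh.
by rewrite (fE k) fE (ophomZ hg).
Qed.
End EigenOperator.

(* V is a direct factor of T as soon as finitely many of its conjugates span. *)
Lemma twisted_retraction (f0 : V -> T) :
  (exists hs : seq twisted, forall y, tw_img hs y) ->
  ophom idfun false f0 -> injective f0 ->
  exists pi : T -> V, ophom idfun false pi /\ cancel f0 pi.
Proof.
move=> [hs0 full] hf0 inj0.
(* C is a complement of f0(V), built along the list: the image of the next map k is added to C if it
   meets C + f0(V) in 0, and otherwise already lies in C + f0(V) by irreducibility. *)
suff [C [sC C0 CE]] : exists C : T -> Prop, [/\ opsub C,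
    forall v, C (f0 v) -> v = 0
    & forall y, tw_img hs0 y -> exists v, C (y - f0 v)].
  have ex y : exists v, C (y - f0 v) by apply: CE; apply: full.
  pose pi y := sval (cid (ex y)); have piP y : C (y - f0 (pi y)) := svalP (cid (ex y)).
  have [C1 CD Cp Co] := sC.
  have piU y v : C (y - f0 v) -> pi y = v.
    move=> hv; apply/eqP; rewrite -subr_eq0; apply/eqP/C0.
    have := opsub_add sC hv (opsub_opp sC (piP y)).
    by rewrite opprB addrC addrA subrK (ophomB hf0).
  exists pi; split=> [|v]; last by apply: piU; rewrite subrr.
  split; first split.
  - move=> u v; apply: piU; rewrite (ophomD hf0) opprD addrACA; exact: opsub_add.
  - by move=> k v; apply: piU; rewrite (ophomZ hf0) -scalerBr -[_ *: _]addr0; apply: CD.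
  - move=> i v; apply: piU; rewrite (ophom_par hf0) /=.
    by rewrite -[- _]scaleN1r -parZ -parD scaleN1r; apply: Cp.
  - move=> w v; apply: piU; rewrite (ophom_op hf0).
    by rewrite -(addfN (op_semilin w).1) -(op_semilin w).1; apply: Co.
elim: hs0 {full} => [|k hs [C [sC C0 CE]]] /=.
  exists (fun y => y = 0); split=> [|v|y ->].
  - split=> [//|l u v -> ->|i u ->|w u ->]; rewrite ?scaler0 ?addr0 ?par0 //.
    exact: addf0 (op_semilin w).1.
  - by rewrite -(ophom0 hf0) => /inj0.
  - by exists 0; rewrite (ophom0 hf0) subr0.
have hk := tw_hom k.
have sI : opsub (fun y => exists v, C (y - f0 v)).
  have [C1 CD Cp Co] := sC.
  split=> [|l u v [a ha] [b hb]|i u [a ha]|w u [a ha]].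
  - by exists 0; rewrite (ophom0 hf0) subr0.
  - exists (l *: a + b); rewrite (ophomD hf0) (ophomZ hf0) opprD addrACA -scalerBr.
    exact: CD.
  - exists (par i a); rewrite (ophom_par hf0) /=.
    by rewrite -[- _]scaleN1r -parZ -parD scaleN1r; apply: Cp.
  - exists (op w a); rewrite (ophom_op hf0).
    by rewrite -(addfN (op_semilin w).1) -(op_semilin w).1; apply: Co.
have [_ /(_ _ (opsub_preim hk sI))] := irrV; case=> [k0|k1].
  have skI : opsub (fun y => exists v, y = k v).
    split=> [|l u v [a ->] [b ->]|i u [a ->]|w u [a ->]].
    - by exists 0; rewrite (ophom0 hk).
    - by exists (gal_inv (tw_aut k) l *: a + b); rewrite (ophomD hk) tw_scale.
    - by exists (par (tw_par k (+) i) a); rewrite tw_parity.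
    - by exists (op w a); rewrite (ophom_op hk).
  exists (fun y => exists2 u, C u & exists v, y - u = k v); split.
  - exact: opsub_sum sC skI.
  - move=> v [u Cu [w hw]].
    have w0 : w = 0.
      apply: k0; exists v; rewrite -hw addrAC subrr add0r; exact: opsub_opp.
    by apply: C0; move: hw; rewrite w0 (ophom0 hk) => /eqP; rewrite subr_eq0 => /eqP ->.
  - move=> y [v /CE[u hu]]; exists u; exists (y - k v - f0 u) => //; exists v.
    by rewrite opprB addrA subrK opprB addrC subrK.
exists C; split=> // y [v /CE[u hu]]; have [w hw] := k1 v; exists (u + w).
by have := opsub_add sC hu hw; rewrite addrACA subrK -opprD -(ophomD hf0).
Qed.

End TwistedSpan.

(** * Galois descent *)

Definition fin_gen (K : fieldType) (V : lmodType K) : Prop :=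
  exists n (e : 'I_n -> V), forall v, exists c : 'I_n -> K, v = \sum_i c i *: e i.

Section Descent.
Variables (Om : Type) (F L : fieldType) (iota : {rmorphism F -> L}).
Hypothesis fixF : forall x : L, (forall s : galois_aut iota, s x = x) -> exists c, x = iota c.
Variable VF : opmod Om F.
Local Notation S := (bcom iota VF).
Local Notation inj := (bcin iota (V := VF)).

Definition gal_act (s : galois_aut iota) : S -> S := bclift s (fun v => inj v).

Lemma gal_act_ophom (s : galois_aut iota) : ophom s false (gal_act s).
Proof.
have [[jD jZ] jp jo] := bcom_bcin iota VF.
apply: bcom_lift; split=> //; split=> // k v.
by rewrite jZ /= gal_fix.
Qed.

Lemma gal_act_in s v : gal_act s (inj v) = inj v.
Proof.
have [[jD jZ] jp jo] := bcom_bcin iota VF.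
by apply: bclift_in; split=> // k u; rewrite jZ /= gal_fix.
Qed.

Lemma gal_act_comm (f : S -> S) s : semilin idfun f ->
  (forall v, exists u, f (inj v) = inj u) -> forall y, f (gal_act s y) = gal_act s (f y).
Proof.
move=> sf fin; have [ss _ _] := gal_act_ophom s.
apply: (bcom_ext (psi := s)) => [||v].
- exact: semilin_comp ss sf.
- exact: semilin_comp sf ss.
- by have [u fu] := fin v; rewrite gal_act_in fu gal_act_in.
Qed.

Lemma gal_actK s : cancel (gal_act (gal_inv s)) (gal_act s).
Proof.
have [ss _ _] := gal_act_ophom s; have [si _ _] := gal_act_ophom (gal_inv s).
apply: (bcom_ext (psi := idfun)) => [||v].
- split=> [u v|k v]; first by rewrite si.1 ss.1.
  by rewrite si.2 ss.2 gal_invVK.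
- exact: semilin_id.
- by rewrite !gal_act_in.
Qed.

Section Coordinates.
Variables (I : choiceType) (b : I -> VF) (c : I -> VF -> F).
Hypothesis bcV : dual_basis b c.
Local Notation C i := (bc_scalar iota (c i)).

Lemma coord_gal_act i s y : C i (gal_act s y) = s (C i y).
Proof.
have [cl _ _] := bcV; have sc := bc_scalar_semilin iota (cl i).
have [ss _ _] := gal_act_ophom s.
have sL : semilin s (s : L^o -> L^o) by split=> [u v|k v]; rewrite ?rmorphD ?rmorphM.
move: y; apply: (@bcom_ext _ _ _ _ _ _ s L^o) => [||v].
- exact: semilin_comp ss sc.
- exact: semilin_comp sc sL.
- by rewrite gal_act_in bc_scalar_in // gal_fix.
Qed.

Lemma coord_descent y : (forall i, exists d, C i y = iota d) -> exists v, y = inj v.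
Proof.
move=> h; have [_ _ /(_ y)[t [ut yE]]] := bc_dual_basis iota bcV.
pose d i := sval (cid (h i)); have dE i : C i y = iota (d i) := svalP (cid (h i)).
have [[jD jZ] _ _] := bcom_bcin iota VF.
exists (\sum_(i <- t) d i *: b i); rewrite yE (addf_sum _ _ jD).
by apply: eq_bigr => i _; rewrite jZ dE.
Qed.

End Coordinates.

Lemma gal_act_fixed y : (forall s, gal_act s y = y) -> exists v, y = inj v.
Proof.
move=> fy; have [I [b [c bcV]]] := exists_dual_basis VF.
apply: (coord_descent bcV) => i; apply: fixF => s.
by rewrite -(coord_gal_act bcV) fy.
Qed.

(** Shortest vector argument: a nonzero element of U has one coefficient normalised to 1. If all
    coefficients lie in F, it comes from a nonzero vector of VF, and irreducibility gives
    everything; otherwise some s moves a coefficient and the difference with its s-image is a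
    nonzero element of U with a smaller support. *)
Lemma descent (U : S -> Prop) : opirr VF -> opsub U -> (exists2 y, U y & y <> 0) ->
  (forall s y, U y -> U (gal_act s y)) -> forall y, U y.
Proof.
move=> [_ irr] sU [y0 Uy0 y0N] gU; have [I [b [c bcV]]] := exists_dual_basis VF.
pose C i := bc_scalar iota (c i).
have bcS : dual_basis (fun i => inj (b i)) C := bc_dual_basis iota bcV.
have [Cl Cb _] := bcS.
suff [v [Uv v0]] : exists v, U (inj v) /\ v <> 0.
  have hj := bcom_bcin iota VF.
  have [//|allU] := irr _ (opsub_preim hj sU); first by move=> /(_ v Uv).
  elim/tens_ind => [|x y Ux Uy|l w]; first by case: sU.
    exact: (opsub_add sU Ux Uy).
  rewrite -/(bct iota l w) bctE -[_ *: _]addr0.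
  by have [U0 UD _ _] := sU; apply: UD => //; apply: allU.
have [t [ut yE]] : exists t, uniq t /\ y0 = \sum_(i <- t) C i y0 *: inj (b i).
  by have [_ _ /(_ y0)] := bcS.
have [n tn] := ubnP (size t).
elim: n => // n ih in t ut y0 yE Uy0 y0N tn *.
have [k kt Ck] : exists2 k, k \in t & C k y0 != 0.
  apply: contrapT => /forall2NP nk; apply: y0N; rewrite yE big1_seq // => i /= it.
  by have [|/negP/negPn/eqP ->] := nk i; rewrite ?it // scale0r.
pose y1 := (C k y0)^-1 *: y0.
have C1 i : C i y1 = (C k y0)^-1 * C i y0 by rewrite /y1 (Cl i).2.
have U1 : U y1.
  by have [U0 UD _ _] := sU; rewrite /y1 -[_ *: _]addr0; apply: UD.
have y1E : y1 = \sum_(i <- t) C i y1 *: inj (b i).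
  rewrite {1}/y1 [X in _ *: X = _]yE scaler_sumr; apply: eq_bigr => i _.
  by rewrite C1 scalerA.
have y1N : y1 <> 0.
  move=> /(congr1 (C k)); rewrite C1 mulVf // (addf0 (Cl k).1) => /eqP.
  by rewrite oner_eq0.
have [alld|/existsNP[i nd]] := pselect (forall i, exists d, C i y1 = iota d).
  have [v y1v] := coord_descent bcV alld.
  exists v; split; first by rewrite -y1v.
  by move=> v0; apply: y1N; rewrite y1v v0 (ophom0 (bcom_bcin iota VF)).
have [s si] : exists s : galois_aut iota, s (C i y1) <> C i y1.
  by apply: contrapT => /forallNP ns; apply: nd; apply: fixF => s; apply: contrapT.
have hs := gal_act_ophom s; have cs j := coord_gal_act bcV j s y1.
(* The coefficient at [k] cancels because s fixes 1, while the one at [i] survives by choice of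
   s. *)
pose y2 := gal_act s y1 - y1.
have C2 j : C j y2 = s (C j y1) - C j y1.
  by rewrite /y2 (Cl j).1 (addfN (Cl j).1) -cs.
have y2E : y2 = \sum_(i <- rem k t) C i y2 *: inj (b i).
  have e : y2 = \sum_(i <- t) C i y2 *: inj (b i).
    rewrite {1}/y2 [X in gal_act s X - _]y1E [X in _ - X = _]y1E (addf_sum _ _ (ophomD hs)) -sumrB.
    by apply: eq_bigr => j _; rewrite (ophomZ hs) gal_act_in C2 scalerBl.
  have Ck2 : C k y2 = 0 by rewrite C2 C1 mulVf // rmorph1 subrr.
  by rewrite {1}e (perm_big _ (perm_to_rem kt)) big_cons /= Ck2 scale0r add0r.
apply: (ih (rem k t) _ y2) => //.
- exact: rem_uniq.
- exact: opsub_add (gU _ _ U1) (opsub_opp sU U1).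
- by move=> /(congr1 (C i)); rewrite C2 (addf0 (Cl i).1) => /eqP; rewrite subr_eq0 => /eqP.
- by rewrite size_rem // -ltnS prednK //; case: (t) kt.
Qed.

End Descent.

(** * Endomorphisms of VF attached to elements fixed by inertia *)

Section EigenEndomorphism.
Variables (Om : Type) (F L : fieldType) (iota : {rmorphism F -> L}).
Hypothesis fixF : forall x : L, (forall s : galois_aut iota, s x = x) -> exists c, x = iota c.
Variables (VF : opmod Om F) (V : opmod Om L).
Hypotheses (irrF : opirr VF) (finF : fin_gen VF) (irrV : opirr V).
Local Notation S := (bcom iota VF).
Local Notation inj := (bcin iota (V := VF)).
Variable f0 : V -> S.
Hypotheses (hf0 : ophom idfun false f0) (inj0 : injective f0).
Local Notation twisted := (twisted iota V S).

Definition tw0 : twisted := @Twisted _ _ _ iota V S (gal_one iota) false f0 hf0.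

Definition tw_act s (h : twisted) : twisted :=
  @Twisted _ _ _ iota V S (gal_comp s (tw_aut h)) _ _ (ophom_comp (tw_hom h) (gal_act_ophom VF s)).

Lemma tw_img0 (hs : seq twisted) : tw_img hs 0.
Proof. by have [] := tw_img_opsub hs. Qed.

(** The Galois action composes twisted maps into twisted maps, so the union of their finite sums is
    Galois stable and [descent] applies; [f0] makes it nonzero. *)
Lemma tw_img_span (y : S) : exists hs : seq twisted, tw_img hs y.
Proof.
have [[v0 /eqP v0N] _] := irrV.
move: y; apply: (descent fixF irrF).
- split=> [|k u v [hs hu] [ks hv]|i u [hs hu]|w u [hs hu]].
  + by exists [::].
  + exists (hs ++ ks); apply: tw_img_cat => //.
    by have [_ iD _ _] := tw_img_opsub hs; rewrite -[_ *: _]addr0; apply: iD => //; apply: tw_img0.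
  + by exists hs; have [_ _ ip _] := tw_img_opsub hs; apply: ip.
  + by exists hs; have [_ _ _ io] := tw_img_opsub hs; apply: io.
- exists (f0 v0); last by rewrite -(ophom0 hf0) => /inj0.
  by exists [:: tw0]; exists v0; rewrite /= subrr.
- move=> s y [hs]; have hg := gal_act_ophom VF s; move=> hy; exists (map (tw_act s) hs).
  elim: hs y hy => [|h hs ih] y /=; first by move=> ->; rewrite (ophom0 hg).
  by move=> [v /ih]; rewrite (ophomB hg); exists v.
Qed.

Lemma tw_img_full : exists hs : seq twisted, forall y, tw_img hs y.
Proof.
have [n [e eP]] := finF.
have [hs hsP] : exists hs : seq twisted, forall i, tw_img hs (inj (e i)).
  suff [hs hsP] : exists hs : seq twisted, forall i, i \in enum 'I_n -> tw_img hs (inj (e i)).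
    by exists hs => i; apply: hsP; rewrite mem_enum.
  elim: (enum 'I_n) => [|i t [hs ih]]; first by exists [::].
  have [ks hk] := tw_img_span (inj (e i)); exists (ks ++ hs) => j.
  rewrite inE => /orP[/eqP ->|/ih hj].
    by rewrite -[inj _]addr0; apply: tw_img_cat => //; apply: tw_img0.
  by rewrite -[inj _]add0r; apply: tw_img_cat => //; apply: tw_img0.
exists hs; have sI := tw_img_opsub hs; have [I0 IL _ _] := sI.
have [[jD jZ] _ _] := bcom_bcin iota VF.
elim/tens_ind => [|x y Ix Iy|l w]; rewrite ?I0 //; first exact: (opsub_add sI Ix Iy).
rewrite -/(bct iota l w) bctE; have hl u : tw_img hs u -> tw_img hs ((l : L) *: u).
  by move=> hu; rewrite -[_ *: _]addr0; apply: IL.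
apply: hl.
have [c ->] := eP w; rewrite (addf_sum _ _ jD); elim/big_ind: _ => // [x y Ix Iy|i _].
  exact: (opsub_add sI Ix Iy).
by have := IL (iota (c i)) _ 0 (hsP i) I0; rewrite addr0 -jZ.
Qed.

Definition inertia_fixed (x : L) : Prop := forall (s : galois_aut iota) p (g : V -> V),
  ophom s p g -> bijective g -> s x = x.

(* The extension of g to L ⊗ VF acts as s(x) on the conjugate of V by s. *)
Definition eigen_end (x : L) (g : VF -> VF) : Prop :=
  ophom idfun false g /\ exists f : S -> S, [/\ ophom idfun false f,
    forall v, f (inj v) = inj (g v)
    & forall (h : twisted) v, f (h v) = tw_aut h x *: h v].

(** The operator on S commutes with the Galois action, hence preserves the fixed vectors, which are
    those of VF. *)
Lemma eigen_end_exists x : inertia_fixed x -> exists g, eigen_end x g.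
Proof.
move=> fx; have [f [hf fE]] := eigen_operator irrV tw_img_span fx.
have fcomm := eigen_operator_comm tw_img_span hf fE.
have ex v : exists u, f (inj v) = inj u.
  apply: gal_act_fixed => // s.
  by rewrite -(fcomm s _ _ (gal_act_ophom VF s)) gal_act_in.
pose g v := sval (cid (ex v)); have gE v : f (inj v) = inj (g v) := svalP (cid (ex v)).
exists g; split; last by exists f.
have hj := bcom_bcin iota VF; have jI := @bcin_inj _ _ iota VF.
split; first split.
- by move=> u v; apply: jI; rewrite -gE !(ophomD hj) (ophomD hf) !gE.
- by move=> k v; apply: jI; rewrite -gE !(ophomZ hj) (ophomZ hf) gE.
- by move=> i v; apply: jI; rewrite -gE !(ophom_par hj) (ophom_par hf) gE.
- by move=> w v; apply: jI; rewrite -gE !(ophom_op hj) (ophom_op hf) gE.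
Qed.

Lemma eigen_end_uniq x g g' : eigen_end x g -> eigen_end x g' -> g =1 g'.
Proof.
move=> [_ [f [hf fg fE]]] [_ [f' [hf' fg' fE']]] v; apply: (@bcin_inj _ _ iota VF).
rewrite -fg -fg'; apply: (twisted_ext tw_img_span) => [||h u].
- exact: ophomD hf.
- exact: ophomD hf'.
- by rewrite fE fE'.
Qed.

Lemma eigen_endD x y g g' : eigen_end x g -> eigen_end y g' ->
  eigen_end (x + y) (fun v => g v + g' v).
Proof.
have add (K : fieldType) (W : opmod Om K) (a b : W -> W) :
    ophom idfun false a -> ophom idfun false b -> ophom idfun false (fun v => a v + b v).
  move=> ha hb; split; first split.
  - by move=> u v; rewrite (ophomD ha) (ophomD hb) addrACA.
  - by move=> k v; rewrite (ophomZ ha) (ophomZ hb) scalerDr.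
  - by move=> i v; rewrite (ophom_par ha) (ophom_par hb) parD.
  - by move=> w v; rewrite (ophom_op ha) (ophom_op hb) (op_semilin w).1.
move=> [hg [f [hf fg fE]]] [hg' [f' [hf' fg' fE']]]; split; first exact: add.
exists (fun v => f v + f' v); split=> [|v|h v]; first exact: add.
  by rewrite fg fg' (ophomD (bcom_bcin iota VF)).
by rewrite fE fE' -scalerDl rmorphD.
Qed.

Lemma eigen_endM x y g g' : eigen_end x g -> eigen_end y g' ->
  eigen_end (x * y) (g \o g').
Proof.
move=> [hg [f [hf fg fE]]] [hg' [f' [hf' fg' fE']]].
split; first exact: (ophom_comp hg' hg).
exists (f \o f'); split=> [|v|h v]; first exact: (ophom_comp hf' hf).
  by rewrite /= fg' fg.
by rewrite /= fE' (ophomZ hf) fE /= scalerA -rmorphM [y * x]mulrC.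
Qed.

Lemma eigen_end_scalar k : eigen_end (iota k) (fun v => k *: v).
Proof.
have scal (K : fieldType) (W : opmod Om K) (a : K) : ophom idfun false (fun v : W => a *: v).
  split; first split.
  - by move=> u v; rewrite scalerDr.
  - by move=> l v; rewrite !scalerA mulrC.
  - by move=> i v; rewrite parZ.
  - by move=> w v; rewrite (op_semilin w).2.
split; first exact: scal.
exists (fun y => iota k *: y); split=> [|v|h v]; first exact: scal.
  by rewrite (ophomZ (bcom_bcin iota VF)).
by rewrite gal_fix.
Qed.

Lemma eigen_end_comm x g q k : eigen_end x g -> ophom idfun q k ->
  forall v, g (k v) = k (g v).
Proof.
move=> [hg [f [hf fg fE]]] hk v; apply: (@bcin_inj _ _ iota VF).
have [hK KE] := bcom_endP iota hk.
rewrite -fg -!KE -fg; exact: (eigen_operator_comm tw_img_span hf fE (s := gal_one iota) hK).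
Qed.

(** The extension Z of z commutes with all equivariant endomorphisms of S. As V is a direct factor
    of S, Z is a scalar c on it by Schur, and then on every linear image of V in S. Galois transport
    gives s(c) on conjugates by s. *)
Lemma eigen_end_center (z : VF -> VF) :
  (forall g : V -> V, ophom idfun false g -> exists c, forall v, g v = c *: v) ->
  ophom idfun false z ->
  (forall q k, ophom idfun q k -> forall v, z (k v) = k (z v)) ->
  exists x, inertia_fixed x /\ eigen_end x z.
Proof.
move=> schur hz zcomm.
have [hZ Zin] := bcom_endP iota hz; set Z := bcom_end iota z in hZ Zin.
have hj := bcom_bcin iota VF.
have Zt l v : Z (bct iota l v) = bct iota l (z v).
  by rewrite bctE (ophomZ hZ) Zin -bctE.
have Zcomm q g : ophom idfun q g -> forall y, Z (g y) = g (Z y).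
  move=> hg; apply: (bcom_ext (psi := idfun)) => [||v].
  - by have := ophom_comp hg hZ; case.
  - by have := ophom_comp hZ hg; case.
  (* An endomorphism [g] of S need not come from VF, but its contractions by the coordinates of L
     over F are endomorphisms of VF, with which z commutes. *)
  have [I [b [c bcL]]] := exists_dual_basis (restr iota L^o : lmodType F).
  have [cl _ _] := bcL.
  apply/eqP; rewrite -subr_eq0; apply/eqP; apply: (contract_eq0 bcL) => i.
  have cD := contractD (V := VF) (cl i).
  have hgi : ophom idfun q (fun v => contract (c i) (g (inj v))).
    split; first split.
    - by move=> u w; rewrite (ophomD hj) (ophomD hg) cD.
    - by move=> k w; rewrite (ophomZ hj) (ophomZ hg) (contractZ (cl i)).
    - by move=> k w; rewrite (ophom_par hj) (ophom_par hg) (contract_par (cl i)).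
    - by move=> k w; rewrite (ophom_op hj) (ophom_op hg) (contract_op (cl i)).
  rewrite cD (addfN cD) Zin -(zcomm _ _ hgi).
  rewrite (contract_tmap (f := z) (g := Z) _ (cl i)) ?subrr //.
  - by case: hz.
  - exact: ophomD hZ.
have [pi [hpi f0K]] := twisted_retraction irrV tw_img_full hf0 inj0.
have [c cE] : exists c, forall v, pi (Z (f0 v)) = c *: v.
  by apply: schur; apply: (ophom_comp hf0 (ophom_comp hZ hpi)).
have Zf (f : V -> S) p : ophom idfun p f -> forall v, Z (f v) = c *: f v.
  move=> hf v; have := Zcomm _ _ (ophom_comp hpi hf) (f0 v).
  by rewrite /= f0K cE (ophomZ hf).
have Zh (h : twisted) v : Z (h v) = tw_aut h c *: h v.
  set s := tw_aut h; have hs := gal_act_ophom VF s.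
  have hi := gal_act_ophom VF (gal_inv s).
  (* Composing with the Galois action of the inverse of s untwists h to a linear map, where Z is
     already known to be c. *)
  have hf : ophom idfun (tw_par h) (gal_act (gal_inv s) \o h).
    have [[fD fZ] fp fo] := ophom_comp (tw_hom h) hi; split=> //; split=> // k u.
    by rewrite fZ /= gal_invK.
  have := congr1 (gal_act s) (Zf _ _ hf v).
  rewrite (ophomZ hs) /= gal_actK -gal_act_comm ?gal_actK //.
  - by case: hZ.
  - by move=> u; exists (z u); rewrite Zin.
exists c; split; last by split=> //; exists Z.
(* Precomposing f0 with a semilinear automorphism g of V gives a map twisted by s with image inside
   f0(V), so both s(c) and c are eigenvalues there. *)
move=> s p g hg bg; pose h := @Twisted _ _ _ iota V S s _ _ (ophom_comp hg hf0).
have [[v0 /eqP v0N] _] := irrV; have [gi gK giK] := bg.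
have := Zh h (gi v0); rewrite /= giK (Zf _ _ hf0) => /eqP.
rewrite -subr_eq0 -scalerBl scaler_eq0 subr_eq0 => /orP[/eqP //|/eqP e0].
by case: v0N; apply: inj0; rewrite (ophom0 hf0).
Qed.

(** Composing the projection of S onto V with f1 and a coordinate of L over E gives theta, nonzero
    for a suitable coordinate. It turns the endomorphism attached to y into the scalar y, since that
    endomorphism is y on V and commutes with the projection. Thus its image is stable under E and
    irreducibility on both sides gives bijectivity. *)
Lemma irr_form_restriction (E : fieldType) (iotaE : {rmorphism F -> E})
    (e : {rmorphism E -> L}) (VE : opmod Om E) (f1 : V -> bcom e VE) :
  (forall k, e (iotaE k) = iota k) -> (forall y, inertia_fixed (e y)) ->
  opirr VE -> ophom idfun false f1 -> injective f1 ->
  exists theta : VF -> VE, [/\ ophom iotaE false theta, bijective theta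
    & forall y g, eigen_end (e y) g -> forall v, theta (g v) = y *: theta v].
Proof.
move=> eiota fixE irrE hf1 inj1.
have [pi [hpi f0K]] := twisted_retraction irrV tw_img_full hf0 inj0.
have hG := ophom_comp hpi hf1; set G := f1 \o pi in hG.
have hj := bcom_bcin iota VF.
have [v0 Gv0] : exists v0, G (inj v0) <> 0.
  apply: contrapT => /forallNP G0; have [[v /eqP vN] _] := irrV; apply: vN; apply: inj1.
  rewrite (ophom0 hf1) -(f0K v) -[LHS]/(G (f0 v)).
  apply: (bcom_ext (psi := idfun) (g := fun _ => 0)) => [||u].
  - by case: hG.
  - by split=> [a b|k a]; rewrite ?addr0 ?scaler0.
  - exact: contrapT (G0 u).
have [I [b [c bcL]]] := exists_dual_basis (restr e L^o : lmodType E).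
have [cl _ _] := bcL.
have [i ci] : exists i, contract (c i) (G (inj v0)) <> 0.
  apply: contrapT => /forallNP c0; apply: Gv0; apply: (contract_eq0 bcL) => i.
  exact: contrapT (c0 i).
pose theta v := contract (c i) (G (inj v)).
have ht : ophom iotaE false theta.
  split; first split.
  - by move=> u w; rewrite /theta (ophomD hj) (ophomD hG) (contractD (cl i)).
  - by move=> k w; rewrite /theta (ophomZ hj) (ophomZ hG) /= -eiota (contractZ (cl i)).
  - by move=> k w; rewrite /theta (ophom_par hj) (ophom_par hG) (contract_par (cl i)).
  - by move=> k w; rewrite /theta (ophom_op hj) (ophom_op hG) (contract_op (cl i)).
have tg y g : eigen_end (e y) g -> forall v, theta (g v) = y *: theta v.
  move=> [hg [f [hf fg fE]]] v; rewrite /theta -fg -(contractZ (cl i)) -(ophomZ hG).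
  congr (contract _ (f1 _)); apply: inj0.
  have := eigen_operator_comm tw_img_span hf fE (s := gal_one iota) (ophom_comp hpi hf0).
  move=> /(_ (inj v)) /= <-; rewrite (fE tw0) /=.
  by rewrite (ophomZ hpi) (ophomZ hf0).
exists theta; split=> //; apply: inj_surj_bij.
  by apply: (opirr_inj ht irrF); exists v0.
apply: (opirr_surj ht irrE); first by exists v0.
move=> k w [v <-]; have [g hg] := eigen_end_exists (fixE k).
by exists (g v); rewrite (tg k).
Qed.

End EigenEndomorphism.

(** * Representations as spaces with operators *)

(** If all g - c were injective, so would be their product over the roots of the characteristic
    polynomial of a matrix of g, which is zero by Cayley-Hamilton. The e_i are only generators,
    hence the passage through row vectors. *)
Lemma schur_closed (Om : Type) (L : closedFieldType) (V : opmod Om L) (g : V -> V) :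
  opirr V -> fin_gen V -> ophom idfun false g -> exists c, forall v, g v = c *: v.
Proof.
move=> irrV [n [e eP]] hg; have [[v0 /eqP v0N] _] := irrV.
have hgc c : ophom idfun false (fun v => g v - c *: v).
  split; first split.
  - by move=> u v; rewrite (ophomD hg) scalerDr opprD addrACA.
  - by move=> k v; rewrite (ophomZ hg) scalerBr !scalerA mulrC.
  - move=> i v; rewrite (ophom_par hg) -parZ /=.
    by rewrite -[- _]scaleN1r -[in RHS]scaleN1r -parZ -parD.
  - move=> w v; have [oD oZ] := op_semilin (o := V) w.
    by rewrite (ophom_op hg) -oZ -(addfN oD) -oD.
suff [c ninj] : exists c, ~ injective (fun v => g v - c *: v).
  exists c => v; apply/eqP; rewrite -subr_eq0; apply/eqP.
  apply: contrapT => gv; apply: ninj; apply: (opirr_inj (hgc c) irrV).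
  by exists v.
apply: contrapT => /forallNP allinj.
have inj c v : g v - c *: v = 0 -> v = 0.
  move=> gv; have /contrapT := allinj c; apply.
  by rewrite gv (ophom0 hg) scaler0 subr0.
case: n => [|n] in e eP *.
  by have [c vE] := eP v0; apply: v0N; rewrite vE big_ord0.
have [M ME] : exists M : 'M[L]_n.+1, forall i, g (e i) = \sum_j M i j *: e j.
  exists (\matrix_(i, j) sval (cid (eP (g (e i)))) j) => i.
  rewrite [LHS](svalP (cid (eP (g (e i))))); apply: eq_bigr => j _.
  by rewrite mxE.
pose ev (r : 'rV[L]_n.+1) : V := \sum_i r 0 i *: e i.
have evM c r : ev (r *m (M - c%:M)) = g (ev r) - c *: ev r.
  rewrite mulmxBr mul_mx_scalar /ev (addf_sum _ _ (ophomD hg)) scaler_sumr.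
  have -> : \sum_i g (r 0 i *: e i) = \sum_j (r *m M) 0 j *: e j.
    under [RHS]eq_bigr do rewrite mxE scaler_suml.
    rewrite exchange_big /=; apply: eq_bigr => i _; rewrite (ophomZ hg) ME scaler_sumr.
    by apply: eq_bigr => j _; rewrite scalerA.
  rewrite -sumrB; apply: eq_bigr => j _.
  by rewrite scalerA -scalerBl !mxE.
have [rs] := closed_field_poly_normal (char_poly M).
rewrite (monicP (char_poly_monic M)) scale1r => /(congr1 (horner_mx M)).
rewrite Cayley_Hamilton rmorph_prod => /esym prod0.
have ev0 (r : 'rV_n.+1) : ev r = 0.
  have : ev (r *m \prod_(c <- rs) horner_mx M ('X - c%:P)) = 0.
    by rewrite prod0 mulmx0 /ev big1 // => i _; rewrite mxE scale0r.
  elim: (rs) r => [|c t ih] r; first by rewrite big_nil mulmx1.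
  rewrite big_cons mulmxA => /ih.
  by rewrite rmorphB /= horner_mx_X horner_mx_C evM => /inj.
apply: v0N; have [c ->] := eP v0.
rewrite -[RHS](ev0 (\row_i c i)) /ev.
by apply: eq_bigr => i _; rewrite mxE.
Qed.

Section RepOp.
Variables (L : fieldType) (H : supergroup L) (Om : Type) (ev : Om -> H -> L).
Hypothesis evl : forall w, semilin idfun (ev w : H -> L^o).

Lemma slice_coact_semilin (V : rep H) w :
  semilin idfun (fun v : V => slice (ev w) (coact v)).
Proof. exact: semilin_comp (lin_semilin (@coact L H V)) (slice_semilin _ (evl w)). Qed.

(* The operators (id ⊗ ev w) o coact through which the functionals ev w of    *)
(* the coordinate algebra act on a representation.                            *)
Definition repom (V : rep H) : opmod Om L :=
  @OpMod Om L V _ (slice_coact_semilin V).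

Lemma ophom_coact p (V W : rep H) (f : V -> W) :
  semilin idfun f -> (forall i v, f (par i v) = par (p (+) i) (f v)) ->
  (forall v, coact (f v) = tmap f id (coact v)) ->
  ophom idfun p (f : repom V -> repom W).
Proof.
move=> sf fp fc; split=> // w v; rewrite /= fc.
by rewrite (slice_tmap (phi := idfun) _ sf (semilin_id _) (evl w) (evl w)).
Qed.

Section Dual.
Variables (I : choiceType) (b : I -> H) (wi : I -> Om).
Hypothesis bev : dual_basis b (fun i => ev (wi i)).

(** The operators include the slices by the coordinates of a basis, and these determine an element
    of W ⊗ H. *)
Lemma coact_ophom p (V W : rep H) (f : V -> W) :
  ophom idfun p (f : repom V -> repom W) ->
  forall v, coact (f v) = tmap f id (coact v).
Proof.
move=> [sf fp fo] v; apply: (slice_inj bev) => i.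
rewrite (slice_tmap (phi := idfun) _ sf (semilin_id _) (evl (wi i)) (evl (wi i))) //.
exact/esym/fo.
Qed.

Lemma irreducible_repom (V : rep H) : irreducible_rep V -> opirr (repom V).
Proof.
move=> [V0 irr]; split=> // U [U0 UD Up Uo]; apply: irr; split=> // u Uu.
have [s sE] := slice_sum (coact u) bev.
exists [seq (slice (ev (wi i)) (coact u), b i) | i <- s]; split; last by rewrite big_map.
by move=> _ /mapP[i _ ->]; apply: (Uo (wi i)).
Qed.
End Dual.
End RepOp.

(** * Irreducible representations are finitely generated *)

Section FiniteGeneration.
Variables (L : fieldType) (H : supergroup L) (V : rep H).

Lemma slice_tassoc (la mu : H -> L) (y : tens V (tens H H)) :
  semilin idfun (la : H -> L^o) -> semilin idfun (mu : H -> L^o) ->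
  slice mu (slice la (tassoc y)) = slice (fun t => mu (slice la t)) y.
Proof.
move=> sl sm; have sn : semilin idfun (fun t : tens H H => mu (slice la t) : L^o).
  exact: semilin_comp (slice_semilin _ sl) sm.
move: y; apply: tassoc_ext => [x y|x y|v a c].
- by rewrite tassocD (slice_semilin _ sl).1 (slice_semilin _ sm).1.
- by rewrite (slice_semilin _ sn).1.
- rewrite tassocE (sliceE sl) (slice_semilin _ sm).2 (sliceE sm) (sliceE sn).
  by rewrite (sliceE sl) sm.2 scalerA.
Qed.

Lemma slice_parity (la : H -> L) i j (x : tens V H) : semilin idfun (la : H -> L^o) ->
  par j (slice la (tpar i x)) = slice (fun a => la (par (j (+) i) a)) (tpar i x).
Proof.
move=> sl; have sp : semilin idfun (fun a : H => la (par (j (+) i) a) : L^o).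
  exact: semilin_comp (par_semilin H _) sl.
have st := linear_semilin (@tpar_linear L V H i).
move: x; apply: tens_ext => [x y|x y|v a].
- by rewrite st.1 (slice_semilin _ sl).1 parD.
- by rewrite st.1 (slice_semilin _ sp).1.
have ps := par_semilin.
rewrite /tpar !(tmapE (ps _ V _) (ps _ H _)) !(slice_semilin _ sl).1 !(slice_semilin _ sp).1.
rewrite !sliceE // parD !parZ !par_par.
case: j {sp} => /=; case: i {st}; rewrite /= ?par0 ?scaler0 ?addr0 ?add0r ?(addf0 sl.1) ?scale0r ?addr0 ?add0r //.
Qed.

(** The slices of the coaction of a nonzero homogeneous u form a subrepresentation, by
    coassociativity, and contain u, by the counit; so they exhaust V. They are spanned by the first
    components of any finite expression of the coaction of u. Homogeneity is needed for stability
    under parity. *)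
Lemma irreducible_fin_gen : irreducible_rep V -> fin_gen V.
Proof.
move=> irrV; pose ev (la : {scalar H}) : H -> L := la.
have evl la : semilin idfun (ev la : H -> L^o).
  by split=> [a c|k a]; rewrite /ev ?linearD ?linearZ.
have [I [b [c bH]]] := exists_dual_basis H.
have [[v vN] irr] := @irreducible_repom _ _ _ ev evl I b c bH V irrV.
have [i uN] : exists i, par i v <> 0.
  have [v0|] := pselect (par false v = 0); last by exists false.
  exists true => v1; move/eqP: vN; apply.
  by rewrite -(par_sum v) v0 v1 addr0.
set u := par i v in uN; have uE : u = par i u by rewrite /u par_par eqxx.
have cu : coact u = tpar i (coact u) by rewrite {1}uE coact_par.
pose X (w : V) := exists la : H -> L, semilin idfun (la : H -> L^o) /\ w = slice la (coact u).
have sX : @opsub _ _ (repom evl V) X.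
  split=> [|k _ _ [la [sl ->]] [mu [sm ->]]|j _ [la [sl ->]]|mu _ [la [sl ->]]].
  - have s0 : semilin idfun (fun _ : H => 0 : L^o) by split=> [x y|k x]; rewrite ?addr0 ?scaler0.
    exists (fun=> 0); split=> //.
    move: (coact u); apply: tens_ext => [x y|x y|w a]; first by rewrite addr0.
      by rewrite (slice_semilin _ s0).1.
    by rewrite sliceE // scale0r.
  - have sn : semilin idfun (fun a : H => k * la a + mu a : L^o).
      split=> [x y|l x]; first by rewrite sl.1 sm.1 mulrDr addrACA.
      by rewrite sl.2 sm.2 scalerDr mulrCA.
    exists (fun a => k * la a + mu a); split=> //.
    move: (coact u); apply: tens_ext => [x y|x y|w a].
    + by rewrite (slice_semilin _ sl).1 (slice_semilin _ sm).1 scalerDr addrACA.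
    + by rewrite (slice_semilin _ sn).1.
    + by rewrite !sliceE // scalerDl scalerA.
  - exists (fun a => la (par (j (+) i) a)); split.
      exact: semilin_comp (par_semilin H _) sl.
    by rewrite cu [LHS]slice_parity.
  - have sm := evl mu.
    have sn : semilin idfun (fun t : tens H H => ev mu (slice la t) : L^o).
      exact: semilin_comp (slice_semilin _ sl) sm.
    have sc := lin_semilin (@comul L H).
    exists (fun a => ev mu (slice la (comul a))); split; first exact: semilin_comp sc sn.
    have := congr1 (fun y => slice (ev mu) (slice la y)) (coactA u).
    rewrite slice_tassoc //.
    rewrite (slice_tmap (phi := idfun) (mu := fun a => ev mu (slice la (comul a)))
      _ (semilin_id V) sc (semilin_comp sc sn) sn) //.
    rewrite (slice_tmap (phi := idfun) _ (lin_semilin (@coact L H V)) (semilin_id _) sl sl) //.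
have Xu : X u.
  exists counit; split; last by rewrite [RHS]coact_counit.
  by split=> [x y|k x]; rewrite ?linearD ?linearZ.
have {}allX : forall w, X w by have [X0|//] := irr X sX; case: uN; apply: X0.
pose s := trepr (coact u); exists (size s), (fun k => (tnth (in_tuple s) k).1) => w.
have [la [sl ->]] := allX w; exists (fun k => la (tnth (in_tuple s) k).2).
rewrite (tens_sum (coact u)) (addf_sum _ _ (slice_semilin _ sl).1) big_tnth.
by apply: eq_bigr => k _; rewrite sliceE.
Qed.

End FiniteGeneration.

(** * Endomorphism superalgebras in terms of operators *)

Section UendOperators.
Variables (L : fieldType) (H : supergroup L) (Om : Type) (ev : Om -> H -> L).
Hypothesis evl : forall w, semilin idfun (ev w : H -> L^o).
Variables (I : choiceType) (b : I -> H) (wi : I -> Om).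
Hypothesis bev : dual_basis b (fun i => ev (wi i)).
Variable V : irrep H.
Local Notation M := (repom evl V).

Lemma ophom_zero p : ophom idfun p (fun _ : M => 0 : M).
Proof.
split=> [|i v|w v]; first by split=> [u v|k v]; rewrite ?addr0 ?scaler0.
- by rewrite par0.
- by rewrite (addf0 (op_semilin (o := M) w).1).
Qed.

Lemma ophom_uend q (g : V -> V) : ophom idfun q (g : M -> M) -> g \in @uend_pred L H V.
Proof.
move=> hg; apply/asboolP.
have lin p (h : V -> V) : ophom idfun p (h : M -> M) -> linear h.
  by move=> hh k u v; rewrite (ophomD hh) (ophomZ hh).
have hom0 (h : V -> V) (hh : ophom idfun false (h : M -> M)) : rep_hom (mklin (lin _ _ hh)).
  by split=> [i v|v]; [exact: (ophom_par hh)|exact: (coact_ophom bev hh)].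
have hom1 (h : V -> V) (hh : ophom idfun true (h : M -> M)) :
    rep_hom (@mklin L V (parity_change V) h (lin _ _ hh) : {linear V -> parity_rep V}).
  by split=> [i v|v]; [exact: (ophom_par hh)|exact: (coact_ophom bev hh)].
case: q hg => hg.
- exists (mklin (lin _ _ (ophom_zero false))), (@mklin L V (parity_change V) g (lin _ _ hg)).
  by split=> // v; rewrite /= add0r.
- exists (mklin (lin _ _ hg)), (@mklin L V (parity_change V) _ (lin _ _ (ophom_zero true))).
  by split=> // v; rewrite /= addr0.
Qed.

Lemma uend_parE i (f : uend V) v :
  val (par i f) v = par i (val f (par false v)) + par (~~ i) (val f (par true v)).
Proof. by rewrite [val (par i f)]SubK. Qed.

Lemma uend_ophom (f : uend V) : exists h : bool -> V -> V,
  [/\ forall i, ophom idfun i (h i : M -> M),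
      forall v, val f v = h false v + h true v
    & forall i v, val (par i f) v = h i v].
Proof.
have /asboolP[f0 [f1 [[p0 c0] [p1 c1] fE]]] := valP f.
exists (fun i => if i then (f1 : V -> V) else f0).
have hE i : ophom idfun i ((if i then (f1 : V -> V) else f0) : M -> M).
  case: i; apply: ophom_coact => //; exact: lin_semilin.
split=> // i v; rewrite uend_parE fE (fE (par true v)).
have q0 j u : f0 (par j u) = par j (f0 u) := p0 j u.
have q1 j u : f1 (par j u) = par (~~ j) (f1 u : V) := p1 j u.
have e0 := par_sum (f0 v); have e1 := par_sum (f1 v : V).
rewrite !q0 !q1 !parD !par_par.
by case: i; rewrite /= ?add0r ?addr0 // addrC.
Qed.

Lemma uendM (f g : uend V) v : val (f * g) v = val f (val g v).
Proof. by rewrite [val (f * g)]SubK. Qed.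
Lemma uend1 v : val (1 : uend V) v = v.
Proof. by rewrite [val (1 : uend V)]SubK. Qed.
Lemma uendD (f g : uend V) v : val (f + g) v = val f v + val g v.
Proof. by rewrite raddfD. Qed.
Lemma uendZ k (f : uend V) v : val (k *: f) v = k *: val f v.
Proof. by rewrite linearZ. Qed.

Lemma uend_homogeneous i (a : uend V) : par i a = a -> ophom idfun i (val a : M -> M).
Proof.
move=> ai; have [h [hh _ hp]] := uend_ophom a.
by have -> : val a = h i by apply/funext => v; rewrite -hp ai.
Qed.

Lemma uend_even (a : uend V) : ophom idfun false (val a : M -> M) -> par false a = a.
Proof.
move=> ha; apply: uend_eqP => v; rewrite uend_parE.
by rewrite -!(ophom_par ha) /= !par_par /= -(ophomD ha) par_sum.
Qed.

Lemma uend_additive (a : uend V) : {morph val a : u v / u + v}.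
Proof.
have [h [hh hE _]] := uend_ophom a.
by move=> u v; rewrite !hE (ophomD (hh false)) (ophomD (hh true)) addrACA.
Qed.

Lemma uend_comm (a : uend V) :
  (forall q k, ophom idfun q (k : M -> M) -> forall v, val a (k v) = k (val a v)) ->
  forall b, a * b = b * a.
Proof.
move=> ca f; apply: uend_eqP => v; rewrite !uendM.
have [h [hh hE _]] := uend_ophom f.
by rewrite !hE uend_additive (ca _ _ (hh false)) (ca _ _ (hh true)).
Qed.

(** Schur's lemma: a nonzero homogeneous endomorphism is bijective, with inverse of the same
    parity. *)
Lemma uend_division : division_superalg (uend V).
Proof.
move=> i a /uend_homogeneous ha a0.
have irrM : opirr M := irreducible_repom evl bev (irrep_irr V).
have [v av] : exists v, val a v <> 0.
  apply: contrapT => /forallNP av; move/eqP: a0; apply; apply: uend_eqP => v.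
  by rewrite -(scale0r a) uendZ scale0r; exact: contrapT (av v).
have [g gK Kg] : bijective (val a).
  apply: inj_surj_bij; first by apply: (opirr_inj ha irrM); exists v.
  apply: (opirr_surj ha irrM); first by exists v.
  by move=> k w [u <-]; exists (k *: u : M); rewrite (ophomZ ha).
have hg : ophom idfun i (g : M -> M) by apply: (ophom_inv ha (psi := idfun)).
exists (Sub g (ophom_uend hg)).
by split; apply: uend_eqP => u; rewrite uendM uend1 SubK.
Qed.

Lemma uend_scalar_center k : even_center (k%:A : uend V).
Proof.
split; first by rewrite parZ par1.
by move=> a; rewrite -scalerAl -scalerAr mul1r mulr1.
Qed.
End UendOperators.

(** * Operators under base change and restriction of scalars *)

Section BaseChangeOperators.
Variables (K E : fieldType) (psi : {rmorphism K -> E}) (G : supergroup K) (H : supergroup E).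
Variables (Om : Type) (ev1 : Om -> G -> K) (ev2 : Om -> H -> E).
Hypothesis evl1 : forall w, semilin idfun (ev1 w : G -> K^o).
Hypothesis evl2 : forall w, semilin idfun (ev2 w : H -> E^o).
Variable j : sgmor psi G H.
Hypothesis evj : forall w a, ev2 w (j a) = psi (ev1 w a).
Variable V : rep G.

Lemma coact_bcin v :
  @coact _ _ (rep_bc j V) (bcin psi v) = tmap (bcin psi (V := V)) j (coact v).
Proof.
apply: bclift_in.
exact: (semilin_comp (lin_semilin coact) (tmap_semilin (bcin_semilin psi V) (sgm_semilin j))).
Qed.

Lemma repom_bcin : ophom psi false
  (bcin psi (V := V) : repom evl1 V -> repom evl2 (rep_bc j V)).
Proof.
split=> [|i v|w v]; first exact: bcin_semilin.
- by rewrite [RHS]par_bcin.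
- rewrite -[RHS]/(slice (ev2 w) (@coact _ _ (rep_bc j V) (bcin psi v))) coact_bcin.
  by rewrite (slice_tmap _ (bcin_semilin psi V) (sgm_semilin j) (evl1 w) (evl2 w)).
Qed.

(** Extending the operators of [V] gives those of the base-changed coaction: both are linear and
    agree on the image of [V]. *)
Lemma repom_bc : ophom idfun false
  (fun x : repom evl2 (rep_bc j V) => x : bcom psi (repom evl1 V)).
Proof.
split=> // w; apply: (bcom_ext (phi := psi) (V := repom evl1 V) (psi := idfun)) => [||v].
- exact: (op_semilin (o := repom evl2 (rep_bc j V)) w).
- exact: (op_semilin (o := bcom psi (repom evl1 V)) w).
- by rewrite -(ophom_op repom_bcin) -(ophom_op (bcom_bcin psi (repom evl1 V))).
Qed.

End BaseChangeOperators.

Lemma bc_scalar_map (K E L : fieldType) (phi1 : {rmorphism K -> E}) (phi2 : {rmorphism K -> L})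
    (psi : {rmorphism E -> L}) (phiE : forall k, psi (phi1 k) = phi2 k) (G : supergroup K)
    (la : {scalar G}) (x : sgbc phi1 G) :
  bc_scalar phi2 la (sgbc_map phiE G x) = psi (bc_scalar phi1 la x).
Proof.
have sl := lin_semilin (la : {linear G -> K^o}).
have s1 := bc_scalar_semilin phi1 sl; have s2 := bc_scalar_semilin phi2 sl.
move: x; apply: (@bc_ext_semi _ _ _ _ psi _ L^o) => [||a].
- exact: semilin_comp (sgm_semilin (sgbc_map phiE G)) s2.
- by split=> [u v|k v]; rewrite ?s1.1 ?s1.2 ?rmorphD ?rmorphM.
have -> : sgbc_map phiE G (bcin phi1 a) = bcin phi2 a.
  apply: (@bclift_in _ _ _ _ psi); have [jD jZ] := bcin_semilin phi2 G.
  by split=> [u v|k v]; rewrite ?jD ?jZ //= phiE.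
by rewrite !(bc_scalar_in _ sl) phiE.
Qed.

(** Restriction of scalars leaves the operators labelled by functionals of K[G] unchanged. *)
Lemma slice_res_coact (K L : fieldType) (phi : {rmorphism K -> L}) (G : supergroup K)
    (W : rep (sgbc phi G)) (la : {scalar G}) (w : W) :
  slice la (@coact _ _ (rep_res W) w) = slice (bc_scalar phi la) (coact w).
Proof.
have sl := lin_semilin (la : {linear G -> K^o}).
have sb := bc_scalar_semilin phi sl.
rewrite [coact w]tens_sum (addf_sum _ _ (slice_semilin _ sb).1).
rewrite [X in slice la X]/(collapse _) /collapse /tlift /fsum.
rewrite (addf_sum _ _ (slice_semilin _ sl).1); apply: eq_bigr => p _.
rewrite (addf_sum _ _ (slice_semilin _ sl).1) (sliceE sb) [in RHS](tens_sum p.2).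
rewrite (addf_sum _ _ sb.1) scaler_suml; apply: eq_bigr => q _.
rewrite -/(bct phi q.1 q.2) bctE sb.2 (bc_scalar_in _ sl).
by rewrite (sliceE sl) restrZ scalerA mulrC.
Qed.

(** * The inertia group in terms of semilinear maps *)

Section InertiaGroup.
Variables (F L : fieldType) (iota : {rmorphism F -> L}) (G : supergroup F).

Lemma scalar_semilin (la : {scalar G}) : semilin idfun (la : G -> F^o).
Proof. exact: (lin_semilin (la : {linear G -> F^o})). Qed.

Lemma bc_evl (K : fieldType) (phi : {rmorphism F -> K}) (la : {scalar G}) :
  semilin idfun (bc_scalar phi la : sgbc phi G -> K^o).
Proof. exact (bc_scalar_semilin phi (scalar_semilin la)). Qed.

Definition groupom (V : rep G) : opmod {scalar G} F := repom scalar_semilin V.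

Definition bcgroupom (K : fieldType) (phi : {rmorphism F -> K}) (V : rep (sgbc phi G)) :
  opmod {scalar G} K := repom (bc_evl phi) V.

Lemma bcgroup_dual_basis (K : fieldType) (phi : {rmorphism F -> K}) :
  exists (I : choiceType) (b : I -> sgbc phi G) (c : I -> {scalar G}),
    dual_basis b (fun i => bc_scalar phi (c i) : sgbc phi G -> K).
Proof.
have [I [b [c bG]]] := exists_dual_basis G.
by exists I, (fun i => bcin phi (b i)), c; exact: (bc_dual_basis phi bG).
Qed.

Lemma galois_bcin_bij (s : galois_aut iota) (V : lmodType L) : bijective (bcin s (V := V)).
Proof.
apply: inj_surj_bij; first exact: bcin_inj.
have [jD jZ] := bcin_semilin s V.
elim/tens_ind => [|x y [u <-] [v <-]|l v].
- by exists 0; rewrite (addf0 jD).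
- by exists (u + v); rewrite jD.
- by exists (gal_inv s l *: v); rewrite jZ gal_invVK -bctE.
Qed.

Variable V : rep (sgbc iota G).
Local Notation M := (bcgroupom V).

(** An s-semilinear automorphism of V is the same as a linear isomorphism from the conjugate by s,
    since v |-> 1 ⊗ v is bijective when s is an automorphism. Odd maps correspond to isomorphisms
    onto the parity change. *)
Lemma gal_stab_ophom (s : galois_aut iota) p (g : V -> V) :
  ophom s p (g : M -> M) -> bijective g -> gal_stab V s.
Proof.
move=> hg [gi gK giK]; have [I [b [c bG]]] := bcgroup_dual_basis iota.
have evj := bc_scalar_map (gal_fix s) (G := G).
have hb : ophom idfun p (bclift (idfun : {rmorphism L -> L}) g : bcom s M -> M).
  exact: bcom_lift.
have hc := ophom_comp (repom_bc (bc_evl iota) (bc_evl iota) evj V) hb.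
pose f : galois_conj s V -> V := bclift (idfun : {rmorphism L -> L}) g.
have hf : ophom idfun p (f : bcgroupom (galois_conj s V) -> M).
  by rewrite -[p]addbF; exact: hc.
have flin : linear f by move=> k u v; rewrite (ophomD hf) (ophomZ hf).
have fin v : f (bcin s v) = g v by apply: bclift_in; case: hg.
have [j jK Kj] := galois_bcin_bij s V.
have bf : bijective f.
  exists (fun v => bcin s (gi v)) => [x|v]; last by rewrite /= fin giK.
  by rewrite /= -[x]Kj fin gK.
case: p hg hb hc hf => hg hb hc hf; [right|left].
- exists (@mklin L (galois_conj s V) (parity_rep V) f flin); split=> //.
  split=> [i v|v]; first exact: (ophom_par hf).
  exact: (@coact_ophom _ _ _ _ (bc_evl iota) I b c bG _ _ _ _ hf).
- exists (mklin flin); split=> //.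
  split=> [i v|v]; first exact: (ophom_par hf).
  exact: (@coact_ophom _ _ _ _ (bc_evl iota) I b c bG _ _ _ _ hf).
Qed.

Lemma ophom_gal_stab (s : galois_aut iota) : gal_stab V s ->
  exists p (g : V -> V), ophom s p (g : M -> M) /\ bijective g.
Proof.
have evj := bc_scalar_map (gal_fix s) (G := G).
have hj := repom_bcin (bc_evl iota) (bc_evl iota) evj V.
have bj := galois_bcin_bij s V.
have mk p (f : galois_conj s V -> V) : bijective f ->
    ophom idfun p (f : bcgroupom (galois_conj s V) -> M) ->
    exists p (g : V -> V), ophom s p (g : M -> M) /\ bijective g.
  move=> bf hf; exists (p (+) false), (fun v => f (bcin s v)); split; last exact: (bij_comp bf bj).
  exact: (ophom_comp hj hf).
case=> [[f [[fp fc] bf]]|[f [[fp fc] bf]]].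
  apply: (mk false f bf); apply: ophom_coact => //; exact: lin_semilin.
by apply: (mk true f bf); apply: ophom_coact => //; exact: (lin_semilin f).
Qed.

End InertiaGroup.

(** * The field of definition *)

Theorem corollary3p28
  (F : fieldType) (Fbar : closedFieldType) (iota : {rmorphism F -> Fbar})
  (algFbar : forall x : Fbar, algebraicOver iota x)
  (perfectF : perfect_field F) (charF : 2%N \notin [pchar F])
  (G : supergroup F) (V' : irrep (sgbc iota G))
  (VF : irrep G) (VF_form : is_irr_form (sgbc_in iota G) V' VF) :
  let F' := fixed_field (gal_stab V') in
  let iota' : {rmorphism F -> F'} := fixed_iota (gal_stab V') in
  exists psi : {rmorphism F' -> uend VF},
    (* (1) *)
    [/\ injective psi,
        forall c : F, psi (iota' c) = c%:A
      & forall a : uend VF, even_center a <-> exists x : F', psi x = a] /\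
    (* (2) *)
    forall VF' : irrep (sgbc iota' G),
      is_irr_form (sgbc_map (fixed_val_iota (gal_stab V')) G) V' VF' ->
      super_quasi_rational VF' /\
      exists (theta : {linear VF -> rep_res VF'})
             (Phi : {rmorphism uend VF -> uend VF'}),
        [/\ rep_hom theta, bijective theta, superalg_iso iota' Phi,
            forall (f : uend VF) (v : VF),
              val (Phi f) (theta v) = theta (val f v)
          & forall x : F', Phi (psi x) = x%:A].
Proof.
move=> F' iota'.
have fixF x : (forall s : galois_aut iota, s x = x) -> exists c, x = iota c.
  exact: galois_fixed.
have [IF [bF [cF dF]]] := exists_dual_basis G.
have {}dF : dual_basis bF (fun i => cF i : G -> F) by [].
have [IL [bL [cL dL]]] := bcgroup_dual_basis G iota.
have [IE [bE [cE dE]]] := bcgroup_dual_basis G iota'.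
pose evF (la : {scalar G}) : G -> F := la.
pose MF := groupom VF; pose ML := bcgroupom V'.
have irrF : opirr MF := @irreducible_repom _ _ _ evF (@scalar_semilin F G) _ _ _ dF _ (irrep_irr VF).
have irrL : opirr ML := @irreducible_repom _ _ _ _ (bc_evl iota) _ _ _ dL _ (irrep_irr V').
have finF : fin_gen MF := irreducible_fin_gen (irrep_irr VF).
have finL : fin_gen ML := irreducible_fin_gen (irrep_irr V').
have [f0 [[f0p f0c] inj0]] := VF_form.
have hf0 : ophom idfun false (f0 : ML -> bcom iota MF).
  have evj (la : {scalar G}) a : bc_scalar iota la (sgbc_in iota G a) = iota (evF la a).
    exact: bc_scalar_in (scalar_semilin la) a.
  have h1 := ophom_coact (bc_evl iota) (p := false) (lin_semilin f0) f0p f0c.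
  exact: (ophom_comp h1 (repom_bc (@scalar_semilin F G) (bc_evl iota) evj VF)).
have schur g : ophom idfun false (g : ML -> ML) -> exists c, forall v, g v = c *: v.
  exact: schur_closed.
pose e : {rmorphism F' -> Fbar} := fixed_val (gal_stab V').
(* Together with [Efix]: being fixed by inertia in the sense of semilinear maps cuts out exactly the
   image of F' in Fbar. *)
have fixE (y : F') : inertia_fixed iota ML (e y).
  move=> s p g hg bg; have /asboolP := valP y; apply; exact: gal_stab_ophom hg bg.
have Efix x : inertia_fixed iota ML x -> exists y : F', e y = x.
  move=> hx; have xF : x \in fixed_pred (gal_stab V').
    by apply/asboolP => s /ophom_gal_stab[p [g [hg bg]]]; apply: hx hg bg.
  by exists (Sub x xF : F'); exact: SubK.
have eiota c : e (iota' c) = iota c by exact: fixed_val_iota.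
pose eigen := @eigen_end _ F Fbar iota MF ML.
(* [pf y] is the endomorphism of VF attached to y. Uniqueness makes it multiplicative and additive
   in y, and [comm] makes it central. *)
have ex y : exists g, eigen (e y) g := eigen_end_exists fixF irrF irrL hf0 inj0 (fixE y).
pose pf y := sval (cid (ex y)); have pfP y : eigen (e y) (pf y) := svalP (cid (ex y)).
have uniq x g g' : eigen x g -> eigen x g' -> g =1 g'.
  exact: (eigen_end_uniq fixF irrF irrL hf0 inj0).
have comm x g q k : eigen x g -> ophom idfun q (k : MF -> MF) ->
    forall v, g (k v) = k (g v).
  exact: (eigen_end_comm fixF irrF irrL hf0 inj0).
have memF q (g : VF -> VF) : ophom idfun q (g : MF -> MF) -> g \in @uend_pred F G VF.
  exact: (@ophom_uend _ _ _ evF (@scalar_semilin F G) _ _ _ dF VF).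
pose p0 y : uend VF := Sub (pf y) (memF false _ (proj1 (pfP y))).
have p0E y v : val (p0 y) v = pf y v by rewrite SubK.
have p0M : monoid_morphism p0.
  split=> [|x y]; apply: uend_eqP => v.
    rewrite p0E uend1; apply: (uniq 1 _ (fun v => v)).
      by rewrite -(rmorph1 e); exact: pfP.
    have := @eigen_end_scalar _ F Fbar iota MF ML 1; rewrite rmorph1.
    by congr eigen_end; apply/funext => u; rewrite scale1r.
  rewrite uendM !p0E; apply: (uniq (e (x * y)) _ (pf x \o pf y)); first exact: pfP.
  by rewrite rmorphM; apply: eigen_endM; apply: pfP.
have p0B : zmod_morphism p0.
  move=> x y; apply/esym/eqP; rewrite subr_eq; apply/eqP/uend_eqP => v.
  rewrite uendD !p0E -{1}(subrK y x);
  apply: (uniq (e (x - y + y)) _ (fun v => pf (x - y) v + pf y v)).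
    exact: pfP.
  by rewrite rmorphD; apply: eigen_endD; apply: pfP.
pose psi : {rmorphism F' -> uend VF} := HB.pack p0
  (GRing.isZmodMorphism.Build _ _ p0 p0B) (GRing.isMonoidMorphism.Build _ _ p0 p0M).
have psiE y v : val (psi y) v = pf y v := p0E y v.
have uhF (a : uend VF) := uend_ophom (@scalar_semilin F G) a.
have centerP (a : uend VF) : even_center a <-> exists x : F', psi x = a.
  split=> [[apar acomm]|[x <-]].
    have ha := uend_homogeneous (@scalar_semilin F G) apar.
    have [|x [/Efix[y <-] hx]] := eigen_end_center fixF irrF finF irrL hf0 inj0 schur ha.
      move=> q k hk v; have := congr1 (fun f => val f v) (acomm (Sub k (memF _ _ hk))).
      by rewrite !uendM !SubK.
    exists y; apply: uend_eqP => v; rewrite psiE.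
    exact: uniq (pfP y) hx v.
  split; first by apply: (@uend_even _ _ _ _ (@scalar_semilin F G));
    rewrite SubK; exact: (proj1 (pfP x)).
  apply: (@uend_comm _ _ _ _ (@scalar_semilin F G)) => q k hk v.
  by rewrite !psiE; exact: comm (pfP x) hk v.
exists psi; split.
  split=> // [|c]; first exact: fmorph_inj.
  apply: uend_eqP => v; rewrite psiE uendZ uend1.
  apply: (uniq _ _ (fun v => c *: v) (pfP (iota' c))).
  by rewrite eiota; exact: eigen_end_scalar.
move=> VE VE_form; pose ME := bcgroupom VE.
have irrE : opirr ME := @irreducible_repom _ _ _ _ (bc_evl iota') _ _ _ dE _ (irrep_irr VE).
have [f1 [[f1p f1c] inj1]] := VE_form.
have hf1 : ophom idfun false (f1 : ML -> bcom e ME).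
  have evj := bc_scalar_map (fixed_val_iota (gal_stab V')) (G := G).
  have h1 := ophom_coact (bc_evl iota) (p := false) (lin_semilin f1) f1p f1c.
  exact: (ophom_comp h1 (repom_bc (bc_evl iota') (bc_evl iota) evj VE)).
have [th [hth bth thE]] := irr_form_restriction fixF irrF finF irrL hf0 inj0
  eiota fixE irrE hf1 inj1.
have [thi thK Kth] := bth.
have thp y v : th (pf y v) = y *: th v := thE y _ (pfP y) v.
have th_lin : linear (th : VF -> rep_res VE).
  by move=> k u v; rewrite (ophomD hth) (ophomZ hth).
have th_hom : rep_hom (mklin th_lin).
  split=> [i v|]; first exact: (ophom_par hth).
  apply: (@coact_ophom _ _ _ evF (@scalar_semilin F G) _ _ _ dF false VF (rep_res VE)).
  split=> [|i v|la v]; [exact: linear_semilin|exact: (ophom_par hth)|].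
  by rewrite [RHS]slice_res_coact; exact: (ophom_op hth).
have memE q (g : VE -> VE) : ophom idfun q (g : ME -> ME) -> g \in @uend_pred _ _ VE.
  exact: (@ophom_uend _ _ _ _ (bc_evl iota') _ _ _ dE VE).
have thiD u v : thi (u + v) = thi u + thi v.
  by rewrite -{1}[u]Kth -{1}[v]Kth -(ophomD hth) thK.
(* F'-scalars on VE pull back to the central endomorphisms [pf y]; since endomorphisms of VF commute
   with these, their conjugates by [th] are F'-linear. *)
have thiZ y v : thi (y *: v) = pf y (thi v).
  by rewrite -{1}[v]Kth -thp thK.
have thi_par i v : thi (par i v) = par i (thi v).
  by apply: (can_inj thK); rewrite Kth (ophom_par hth) Kth.
have thi_op w (v : ME) : thi (op w v) = op w (thi v : MF).
  by apply: (can_inj thK); rewrite Kth (ophom_op hth) Kth.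
have conjE q h : ophom idfun q (h : MF -> MF) -> ophom idfun q ((th \o h \o thi) : ME -> ME).
  move=> hh; split; first split.
  - by move=> u v; rewrite /= thiD (ophomD hh) (ophomD hth).
  - by move=> y v; rewrite /= thiZ -(comm _ _ _ _ (pfP y) hh) thp.
  - by move=> i v; rewrite /= thi_par (ophom_par hh) (ophom_par hth).
  - move=> w v; rewrite -[LHS]/(th (h (thi (op w v)))) thi_op.
    by rewrite (ophom_op hh) (ophom_op hth).
have conjF q h : ophom idfun q (h : ME -> ME) -> ophom idfun q ((thi \o h \o th) : MF -> MF).
  move=> hh; split; first split.
  - by move=> u v; rewrite /= (ophomD hth) (ophomD hh) thiD.
  - move=> k v; rewrite /= (ophomZ hth) (ophomZ hh) /=.
    by apply: (can_inj thK); rewrite (ophomZ hth) !Kth.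
  - by move=> i v; rewrite /= (ophom_par hth) (ophom_par hh) thi_par.
  - move=> w v; rewrite -[LHS]/(thi (h (th (op w v)))).
    by rewrite (ophom_op hth) (ophom_op hh) thi_op.
have uhE (a : uend VE) := uend_ophom (bc_evl iota') a.
have conj_mem (f : uend VF) : th \o val f \o thi \in @uend_pred _ _ VE.
  have [h [hh hE _]] := uhF f.
  have -> : (th \o val f \o thi : VE -> VE) =
      (th \o h false \o thi : VE -> VE) + (th \o h true \o thi : VE -> VE).
    by apply/funext => v; rewrite addrfctE /= hE (ophomD hth).
  by apply: rpredD; [exact: memE (conjE _ _ (hh false))|exact: memE (conjE _ _ (hh true))].
have conj_memi (f : uend VE) : thi \o val f \o th \in @uend_pred _ _ VF.
  have [h [hh hE _]] := uhE f.
  have -> : (thi \o val f \o th : VF -> VF) =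
      (thi \o h false \o th : VF -> VF) + (thi \o h true \o th : VF -> VF).
    by apply/funext => v; rewrite addrfctE /= hE thiD.
  by apply: rpredD; [exact: memF (conjF _ _ (hh false))|exact: memF (conjF _ _ (hh true))].
pose P0 (f : uend VF) : uend VE := @Sub _ _ (uend VE) _ (conj_mem f).
have P0E f v : val (P0 f) v = th (val f (thi v)) by rewrite SubK.
have P0B : zmod_morphism P0.
  move=> f g; apply/esym/eqP; rewrite subr_eq; apply/eqP/uend_eqP => v.
  by rewrite uendD !P0E -(ophomD hth) -uendD subrK.
have P0M : monoid_morphism P0.
  split=> [|f g]; apply: uend_eqP => v; first by rewrite P0E !uend1 Kth.
  by rewrite uendM !P0E uendM thK.
pose Phi : {rmorphism uend VF -> uend VE} := HB.pack P0
  (GRing.isZmodMorphism.Build _ _ P0 P0B) (GRing.isMonoidMorphism.Build _ _ P0 P0M).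
have PhiE f v : val (Phi f) v = th (val f (thi v)) := P0E f v.
have bPhi : bijective Phi.
  exists (fun g => @Sub _ _ (uend VF) _ (conj_memi g)) => g; apply: uend_eqP => v.
    by rewrite SubK -[LHS]/(thi (val (Phi g) (th v))) PhiE !thK.
  by rewrite PhiE SubK -[X in th X]/(thi (val g (th (thi v)))) !Kth.
have Phi_psi x : Phi (psi x) = x%:A.
  by apply: uend_eqP => v; rewrite PhiE psiE thp Kth uendZ uend1.
have Phi_par i a : Phi (par i a) = par i (Phi a).
  apply: uend_eqP => v; rewrite PhiE !uend_parE !PhiE (ophomD hth) !(ophom_par hth) /=.
  by rewrite !thi_par.
split.
  split; last exact: (uend_division (bc_evl iota') dE).
  move=> a; split=> [|[k ->]]; last exact: uend_scalar_center.
  (* A central even element of [uend VE] is pulled back to VF, where (1) identifies it as [psi x],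
     and [Phi] sends that to a scalar. *)
  have [Pi PhiK KPhi] := bPhi; rewrite -(KPhi a) => -[apar acomm].
  have /centerP[x <-] : even_center (Pi a).
    split=> [|b]; apply: (can_inj PhiK); first by rewrite Phi_par.
    by rewrite !rmorphM acomm.
  by exists x; rewrite Phi_psi.
exists (mklin th_lin), Phi; split=> //; last by move=> f v; rewrite PhiE /= thK.
split=> // k a; apply: uend_eqP => v.
by rewrite PhiE !uendZ (ophomZ hth) PhiE.
Qed.
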